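(* Let $A=[a_{ij}]_{i,j=1}^N\in\mathbb{C}^{M\times M}$ be a complex matrix in block form, with $a_{ij}\in\mathbb{C}^{m_i\times m_j}$, $m_i\in\{1,\ldots,M-1\}$, $\sum_{i=1}^N m_i=M$ and $M\ge N>1$. Then, for all $\varepsilon\ge 0$ and $n=1,\ldots,N-1$, $$\mathrm{Spec}_\varepsilon A\subset \Sigma^n_\varepsilon(A),\qquad\text{in particular}\qquad \mathrm{Spec}\,A\subset\Sigma^n_0(A),$$ where $\Sigma^n_\varepsilon(A)$ is the $\tau$-method inclusion set defined in the context.
   Context: All norms are (spectral) $2$-norms; $s_{\min}(E)$ is the smallest singular value of a matrix $E$. For a square complex matrix $E$ and $\varepsilon\ge0$, $\mathrm{Spec}_\varepsilon E:=\{\lambda\in\mathbb{C}: s_{\min}(E-\lambda I)\le\varepsilon\}$ (closed $\varepsilon$-pseudospectrum); $\mathrm{Spec}_0E=\mathrm{Spec}\,E$ is the set of eigenvalues. Tridiagonal part: $B=[b_{ij}]_{i,j=1}^N$ with $b_{ij}:=a_{ij}$ if $|i-j|\le1$ and $b_{ij}:=0$ otherwise; remaining part $C:=A-B$. Put $r_L(A):=\max_{1\le i\le N-1}\|a_{i+1,i}\|$, $r_U(A):=\max_{1\le i\le N-1}\|a_{i,i+1}\|$, $r(A):=r_L(A)+r_U(A)$. For $n=1,\ldots,N$ and $k=0,\ldots,N-n$, $B_{n,k}:=[b_{ij}]_{i,j=k+1}^{k+n}$ (an $n\times n$ block matrix). For $n\in\mathbb{N}$, $\varepsilon_n(A):=2r(A)\sin(\theta_n(A)/2)+\|C\|$,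 where $\theta_n(A)$ is the unique solution $t\in\left[\frac{\pi}{2n+1},\frac{\pi}{n+2}\right]$ of $$2\sin\Big(\frac t2\Big)\cos\Big(\Big(n+\frac12\Big)t\Big)+\frac{r_L(A)r_U(A)}{(r(A))^2}\sin((n-1)t)=0$$ (if $r(A)=0$ then $\varepsilon_n(A):=\|C\|$). For $\varepsilon\ge0$ and $1\le n\le N-1$ define $$\sigma^n_\varepsilon(A):=\bigcup_{k=0}^{N-n}\mathrm{Spec}_{\varepsilon+\varepsilon_n(A)}B_{n,k}\ \cup\ \bigcup_{m=1}^{n-1}\left(\mathrm{Spec}_{\varepsilon+\varepsilon_n(A)}B_{m,0}\cup\mathrm{Spec}_{\varepsilon+\varepsilon_n(A)}B_{m,N-m}\right),$$ and, for $3\le n\le N-1$, $\widehat\sigma^n_\varepsilon(A):=\bigcup_{k=0}^{N-n}\mathrm{Spec}_{\varepsilon+\varepsilon_{n-2}(A)}B_{n,k}$. The $\tau$-method inclusion set is $\Sigma^n_\varepsilon(A):=\sigma^n_\varepsilon(A)$ if $n\le2$, and $\Sigma^n_\varepsilon(A):=\sigma^n_\varepsilon(A)\cap\widehat\sigma^n_\varepsilon(A)$ if $n>2$. *)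

(* Defs.v *)
From mathcomp Require Import all_boot all_order all_algebra.
From mathcomp Require Export spectral complex.
From mathcomp Require Import all_classical all_reals all_analysis.
Set Implicit Arguments.
Unset Strict Implicit.
Unset Printing Implicit Defensive.
Import Order.TTheory GRing.Theory Num.Theory.
Local Open Scope classical_set_scope.
Local Open Scope ring_scope.
Local Open Scope complex_scope.
Local Open Scope sesquilinear_scope.

(* Conventions: block indices start at 0; the size M of A is \sum_i m i, and
   a_ij is submxblock A i j. *)

Section Norms.
Variable R : realType.

Definition vnorm2 n (x : 'cV[R[i]]_n) : R :=
  Num.sqrt (\sum_(i < n) ComplexField.Normc.normc (x i 0) ^+ 2).

Definition opnorm2 p n (E : 'M[R[i]]_(p, n)) : R :=
  sup [set vnorm2 (E *m x) | x in [set x : 'cV[R[i]]_n | vnorm2 x <= 1]].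

Definition singular_value n (E : 'M[R[i]]_n) (s : R) : Prop :=
  0 <= s /\ eigenvalue (E ^t* *m E) (s ^+ 2)%:C.

(* The set is finite, and nonempty when n > 0, so this inf is a minimum. *)
Definition smin n (E : 'M[R[i]]_n) : R := inf [set s | singular_value E s].

Definition pseudospec n (eps : R) (E : 'M[R[i]]_n) : set R[i] :=
  [set lambda | smin (E - lambda%:M) <= eps].

Definition spec n (E : 'M[R[i]]_n) : set R[i] :=
  [set lambda | eigenvalue E lambda].

End Norms.

Section Blocks.
Variables (R : realType) (N : nat) (m : 'I_N -> nat).
Implicit Types A : 'M[R[i]]_(\sum_(i < N) m i).

Definition tridiag A : 'M[R[i]]_(\sum_(i < N) m i) :=
  \mxblock_(i < N, j < N)
    if (i <= j.+1)%N && (j <= i.+1)%N then submxblock A i j else 0.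

Definition offtridiag A : 'M[R[i]]_(\sum_(i < N) m i) := A - tridiag A.

Definition rL A : R :=
  \big[Num.max/0]_(i < N) \big[Num.max/0]_(j < N | i == j.+1 :> nat)
    opnorm2 (submxblock A i j).

Definition rU A : R :=
  \big[Num.max/0]_(i < N) \big[Num.max/0]_(j < N | j == i.+1 :> nat)
    opnorm2 (submxblock A i j).

Definition rLU A : R := rL A + rU A.

(* The block index k + i, for i < n. *)
Definition block_idx n k (kn : (k + n <= N)%N) (i : 'I_n) : 'I_N :=
  widen_ord kn (rshift k i).

(* B_{n,k}; the condition k + n <= N says that k ranges over 0, ..., N - n. *)
Definition Bsub A n k (kn : (k + n <= N)%N) :
    'M[R[i]]_(\sum_(i < n) m (block_idx kn i)) :=
  \mxblock_(i < n, j < n)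
    submxblock (tridiag A) (block_idx kn i) (block_idx kn j).

Definition theta_eqn A (n : nat) (t : R) : Prop :=
  2 * sin (t / 2) * cos ((n%:R + 2^-1) * t)
    + rL A * rU A / rLU A ^+ 2 * sin ((n%:R - 1) * t) = 0.

(* xget selects the solution, which is unique in this interval for n >= 1
   and rLU A != 0; the default value 0 is then never used. *)
Definition theta A (n : nat) : R :=
  xget 0 [set t | pi / (2 * n%:R + 1) <= t <= pi / (n%:R + 2)
                  /\ theta_eqn A n t].

Definition eps_ A (n : nat) : R :=
  if rLU A == 0 then opnorm2 (offtridiag A)
  else 2 * rLU A * sin (theta A n / 2) + opnorm2 (offtridiag A).

Definition sigma A (n : nat) (eps : R) : set R[i] :=
  [set lambda |
    (exists k (kn : (k + n <= N)%N),
       pseudospec (eps + eps_ A n) (Bsub A kn) lambda)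
    \/ exists p : nat, (1 <= p <= n - 1)%N /\
       ((exists h : (0 + p <= N)%N,
           pseudospec (eps + eps_ A n) (Bsub A h) lambda)
        \/ (exists h : (N - p + p <= N)%N,
           pseudospec (eps + eps_ A n) (Bsub A h) lambda))].

Definition sigma_hat A (n : nat) (eps : R) : set R[i] :=
  [set lambda | exists k (kn : (k + n <= N)%N),
     pseudospec (eps + eps_ A (n - 2)) (Bsub A kn) lambda].

Definition Sigma A (n : nat) (eps : R) : set R[i] :=
  if (n <= 2)%N then sigma A n eps else sigma A n eps `&` sigma_hat A n eps.

End Blocks.

(* Main.v *)
Require Import Defs.
From mathcomp Require Import all_boot all_order all_algebra.
From mathcomp Require Import ring lra zify.
Set Implicit Arguments.
Unset Strict Implicit.
Unset Printing Implicit Defensive.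
Import Order.TTheory GRing.Theory Num.Theory.
Local Open Scope ring_scope.

(** The argument is an averaging over windows of consecutive blocks. Let B be the tridiagonal part of A, C = A - B,
    r = r_L + r_U, a = r_L / r, b = r_U / r, and T = B - lambda. If lambda lies in the eps-pseudospectrum, there is a
    vector x, nonzero, for which |T x| is at most (eps' + |C|) |x| with eps' slightly above eps; call this bound
    dl r |x|. Suppose that the smallest singular values of all windows in question are at least nu r. For scale factors
    v_j on the blocks of x, block j of T (v x) is
      v_j (T x)_j + (v_(j-1) - v_j) (coupling to block j - 1) + (v_(j+1) - v_j) (coupling to block j + 1),
    so that lambda and the diagonal blocks only occur in the residual T x. Give every window of length n the same
    weights w_1, ..., w_n. Summing the squared bounds over all shifts of the window decouples w from x ([pool_le]) and
    leaves, with la > 0 free,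
      nu^2 |w|^2 <= (dl + la) dl |w|^2 + (dl + la) / la * (roughness of w),
    where the roughness is the discrete Dirichlet energy of w with jumps in the two directions weighted by a and b.

    For sigma, the windows that overhang an end of the chain are the shorter truncations at that end, and they are
    available too. The weights [tau_weight] are the sines whose phase fits the boundary condition on the left; the
    equation for theta is the boundary condition on the right, and under both conditions the roughness is la^2 |w|^2
    with la = 2 sin (theta / 2) ([tau_rough]). The inequality becomes nu <= dl + la, which bounds nu r by
    eps' + eps_n(A) ([sigma_windows], [pseudospec_truncations]). The case r = 0 is a limit.

    For sigma-hat only windows of full length n may be used, but the angle is that of windows of length n - 2. The
    weights sin (i theta) then have less roughness than la^2 |w|^2, and the surplus has to pay for substitutes of the
    overhanging windows. After a reflection b <= 1/2 ([chain_flip]). An overhanging window can be embedded into the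
    outermost full window by padding its weights with zeros, at the cost of one more row; on the right this is always
    affordable. With x = theta / 2 and the phase f = pi - (2 n - 3) x, the left end is treated in three ways
    ([hat_half]). If f <= 16 x / 3, zero padding works there as well ([edge_overlap]). If 2 b <= dl + la, the lower
    bound of the full window is passed to its adjoint, whose restriction to the overhanging part leaks through one
    off-diagonal block of norm at most b r; by duality the overhanging part satisfies the window bound up to a multiple
    of its last row ([adjoint_window], [dual_budget]). In the remaining case sin x < b, and the overhanging windows are
    replaced by windows on the first n blocks that carry the later weights sin (i theta), i > k, as long as these are
    positive, with the last weight repeated; here the cross terms between residual and couplings are kept, as they
    telescope to second order ([taper_windows]).

    All costs are compared with the surplus by inequalities between sin x, cos x, sin f and cos f, tied by the equation
    for theta. They are reduced to polynomial inequalities on a few boxes ([dual_core], [taper_core], [window_core]). *)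

Lemma le_of_eq (R : numDomainType) (x y : R) : x = y -> x <= y.
Proof. by move=> ->. Qed.

(** * Averaging over shifted windows *)

Section Pool.
Variable R : realFieldType.
Implicit Types (w u eta v : nat -> R) (E : (nat -> R) -> nat -> R).

(** Windows have length n and are named by their last position s. All s from 1 to N + n - 1 occur, so that
    windows overhang both ends of 1, ..., N; position j has index j + n - s inside its window. *)
Definition inwin n s j := ((s < j + n) && (j <= s))%N.

(** While a window slides over the chain, every position meets every index 1, ..., n exactly once; hence a
    sum over all windows is a sum over pairs (index, position). *)
Lemma sum_shift (n N : nat) (F : nat -> nat -> R) :
  \sum_(1 <= s < N + n) \sum_(1 <= j < N.+1 | inwin n s j) F (j + n - s)%N j =
  \sum_(1 <= j < N.+1) \sum_(1 <= i < n.+1) F i j.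
Proof.
under eq_bigr do rewrite big_mkcond.
rewrite exchange_big /=; apply: eq_big_nat => j /andP[j1 jN].
rewrite -big_mkcond /=.
transitivity (\sum_(j <= s < j + n) F (j + n - s)%N j).
  rewrite [RHS](@big_nat_widen _ _ _ j _ (N + n)); last by lia.
  rewrite (@big_cat_nat _ _ _ j) /=; [|lia|lia].
  rewrite big_nat_cond big1 ?add0r; last by move=> s; rewrite /inwin; lia.
  by rewrite big_nat_cond [RHS]big_nat_cond; apply: eq_bigl => s; rewrite /inwin; lia.
rewrite -{1}[j]add0n big_addn addKn big_nat_rev /= add0n.
rewrite big_add1 /=; apply: eq_big_nat => s hs.
by congr F; lia.
Qed.

Lemma sum_win_supp (n N s : nat) (w : nat -> R) (G : nat -> R) : w 0%N = 0 ->
  (forall i, (n < i)%N -> w i = 0) ->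
  \sum_(1 <= j < N.+1) w (j + n - s)%N ^+ 2 * G j =
  \sum_(1 <= j < N.+1 | inwin n s j) w (j + n - s)%N ^+ 2 * G j.
Proof.
move=> w0 wn; rewrite [RHS]big_mkcond; apply: eq_big_nat => j hj.
rewrite /inwin; case: ltnP => h1 /=.
  by case: leqP => h2 //; rewrite wn ?expr0n ?mul0r //; lia.
by rewrite (_ : (j + n - s)%N = 0%N) ?w0 ?expr0n ?mul0r //; lia.
Qed.

Lemma sum_pred_le (N : nat) (u : nat -> R) : u 0%N = 0 ->
  \sum_(1 <= j < N.+1) u j.-1 ^+ 2 <= \sum_(1 <= j < N.+1) u j ^+ 2.
Proof.
move=> u0; case: N => [|N]; first by rewrite !big_geq.
rewrite big_nat_recl //= u0 expr0n add0r [leRHS]big_nat_recr //= big_add1 /=.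
by rewrite lerDl sqr_ge0.
Qed.

Lemma sum_succ_le (N : nat) (u : nat -> R) : u N.+1 = 0 ->
  \sum_(1 <= j < N.+1) u j.+1 ^+ 2 <= \sum_(1 <= j < N.+1) u j ^+ 2.
Proof.
move=> uN; case: N uN => [|N] uN; first by rewrite !big_geq.
rewrite big_nat_recr //= uN expr0n addr0 [leRHS]big_nat_recl //.
by rewrite lerDr sqr_ge0.
Qed.

(** Young's inequality separates the residual term from the coupling terms in the proportion dl : la, and
    convexity of the square with a + b = 1 separates the two neighbours. *)
Lemma row_young (a b dl la x y z e u1 u2 : R) :
  0 <= a -> 0 <= b -> a + b = 1 -> 0 < dl -> 0 < la -> 
  (x * e + y * (a * u1) + z * (b * u2)) ^+ 2 <=
  (dl + la) / dl * (x ^+ 2 * e ^+ 2) + (dl + la) / la * (a * y ^+ 2 * u1 ^+ 2 + b * z ^+ 2 * u2 ^+ 2).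
Proof.
move=> a0 b0 ab d0 l0.
set A := y * u1; set B := z * u2.
have cvx : (a * A + b * B) ^+ 2 <= a * A ^+ 2 + b * B ^+ 2.
  have := mulr_ge0 (mulr_ge0 a0 b0) (sqr_ge0 (A - B)).
  have -> : a = 1 - b by lra.
  lra.
have -> : x * e + y * (a * u1) + z * (b * u2) = x * e + (a * A + b * B) by rewrite /A /B; ring.
have -> : a * y ^+ 2 * u1 ^+ 2 + b * z ^+ 2 * u2 ^+ 2 = a * A ^+ 2 + b * B ^+ 2 by rewrite /A /B; ring.
set X := x * e; set Y := a * A + b * B.
have -> : x ^+ 2 * e ^+ 2 = X ^+ 2 by rewrite /X; ring.
apply: le_trans (_ : (dl + la) / dl * X ^+ 2 + (dl + la) / la * Y ^+ 2 <= _).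
  rewrite -subr_ge0.
  have -> : (dl + la) / dl * X ^+ 2 + (dl + la) / la * Y ^+ 2 - (X + Y) ^+ 2 = (la * X - dl * Y) ^+ 2 / (dl * la).
    by field; rewrite !gt_eqF.
  by rewrite divr_ge0 ?sqr_ge0 ?mulr_ge0 ?(ltW d0) ?(ltW l0).
rewrite lerD2l ler_wpM2l // divr_ge0 ?(ltW l0) // addr_ge0 ?(ltW d0) ?(ltW l0) //.
Qed.

Definition mass n w := \sum_(1 <= i < n.+1) w i ^+ 2.
(** The discrete Dirichlet energy of the weights, each direction counted with the relative strength of the
    corresponding off-diagonal. *)
Definition rough n (a b : R) w :=
  a * (\sum_(1 <= i < n.+1) (w i.-1 - w i) ^+ 2) + b * (\sum_(1 <= i < n.+1) (w i.+1 - w i) ^+ 2).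

(** The averaging argument. [E v j] plays the role of the squared norm of block j of T (v x), where v rescales
    the blocks of a vector x with block norms u and residual block norms eta; X s is an allowance for window s. Summed
    over all windows, the window bounds separate the weights w from the vector, and only mass and roughness of w
    remain. *)
Lemma pool_le (n N : nat) (a b dl la nu : R) u eta E w (X : nat -> R) :
  0 <= a -> 0 <= b -> a + b = 1 -> 0 < dl -> 0 < la -> 
  u 0%N = 0 -> u N.+1 = 0 ->
  (forall v j, (1 <= j <= N)%N -> 
     E v j <= (`|v j| * eta j + `|v j.-1 - v j| * (a * u j.-1) + `|v j.+1 - v j| * (b * u j.+1)) ^+ 2) ->
  \sum_(1 <= j < N.+1) eta j ^+ 2 <= dl ^+ 2 * mass N u ->
  w 0%N = 0 -> (forall i, (n < i)%N -> w i = 0) ->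
  (forall s, (1 <= s < N + n)%N -> 
    nu ^+ 2 * (\sum_(1 <= j < N.+1) w (j + n - s)%N ^+ 2 * u j ^+ 2) <= 
    \sum_(1 <= j < N.+1 | inwin n s j) E (fun j => w (j + n - s)%N) j + X s) ->
  nu ^+ 2 * (mass n w * mass N u) <= ((dl + la) * dl * mass n w + (dl + la) / la * rough n a b w) * mass N u
    + \sum_(1 <= s < N + n) X s.
Proof.
move=> a0 b0 ab d0 l0 u0 uN E1 hy w0 wn H.
have {H} := @ler_sum_nat _ _ _ _ _ H.
rewrite big_split /= -mulr_sumr => H.
have e1 : \sum_(1 <= s < N + n) \sum_(1 <= j < N.+1) w (j + n - s)%N ^+ 2 * u j ^+ 2 = mass n w * mass N u.
  under eq_bigr do rewrite (sum_win_supp N _ _ w0 wn).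
  rewrite (@sum_shift n N (fun i j => w i ^+ 2 * u j ^+ 2)).
  by rewrite /mass mulr_sumr; apply: eq_bigr => j _; rewrite mulr_suml.
rewrite e1 in H; apply: le_trans H _; rewrite lerD2r.
pose F i j := (dl + la) / dl * (w i ^+ 2 * eta j ^+ 2) + (dl + la) / la * (a * (w i.-1 - w i) ^+ 2 * u j.-1 ^+ 2 + b * (w i.+1 - w i) ^+ 2 * u j.+1 ^+ 2).
apply: le_trans (_ : \sum_(1 <= s < N + n) \sum_(1 <= j < N.+1 | inwin n s j) F (j + n - s)%N j <= _).
  apply: ler_sum_nat => s hs; rewrite big_nat_cond [leRHS]big_nat_cond; apply: ler_sum => j /andP[/andP[j1 jN] /andP[i1 i2]].
  have hj : (1 <= j <= N)%N by rewrite j1.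
  apply: (le_trans (E1 _ _ hj)).
  apply: le_trans (row_young _ _ _ _ _ _ a0 b0 ab d0 l0) _.
  rewrite !real_normK ?num_real //.
  have ip : (j.-1 + n - s)%N = (j + n - s).-1 by move: j1 i1 i2; clear; lia.
  have iS : (j.+1 + n - s)%N = (j + n - s).+1 by rewrite addSn subSn // ltnW.
  rewrite /F ip iS; exact: lexx.
rewrite sum_shift.
have m1 : 0 <= (dl + la) / dl by rewrite divr_ge0 ?addr_ge0 // ltW.
have m2 : 0 <= (dl + la) / la by rewrite divr_ge0 ?addr_ge0 // ltW.
rewrite mulrDl.
have -> : \sum_(1 <= j < N.+1) \sum_(1 <= i < n.+1) F i j =
   (dl + la) / dl * mass n w * (\sum_(1 <= j < N.+1) eta j ^+ 2) +
   ((dl + la) / la * (a * (\sum_(1 <= i < n.+1) (w i.-1 - w i) ^+ 2)) * (\sum_(1 <= j < N.+1) u j.-1 ^+ 2) +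
   (dl + la) / la * (b * (\sum_(1 <= i < n.+1) (w i.+1 - w i) ^+ 2)) * (\sum_(1 <= j < N.+1) u j.+1 ^+ 2)).
  rewrite !mulr_sumr -!big_split /=; apply: eq_bigr => j _.
  rewrite /F /mass !big_split /= -!mulr_sumr big_split /= -!mulr_suml -!mulr_sumr.
  by rewrite mulrDr !mulrA.
apply: lerD.
  apply: le_trans (ler_wpM2l _ hy) _.
    by rewrite mulr_ge0 // sumr_ge0 // => i _; rewrite sqr_ge0.
  by apply: le_of_eq; field; rewrite gt_eqF.
rewrite /rough mulrDr mulrDl; apply: lerD; apply: ler_wpM2l; rewrite ?sum_pred_le ?sum_succ_le //.
  by apply: mulr_ge0 => //; apply: mulr_ge0 => //; apply: sumr_ge0 => i _; exact: sqr_ge0.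
by apply: mulr_ge0 => //; apply: mulr_ge0 => //; apply: sumr_ge0 => i _; exact: sqr_ge0.
Qed.
End Pool.

Section Profile.
Variable R : realFieldType.
Implicit Types g : nat -> R.

Definition trunc n g i : R := if (1 <= i <= n)%N then g i else 0.

Definition jumps n g : R := \sum_(1 <= i < n.+1) (g i.-1 - g i) ^+ 2.

Lemma mass_trunc n g : mass n (trunc n g) = mass n g.
Proof. by apply: eq_big_nat => i hi; rewrite /trunc -ltnS hi. Qed.

(** Summation by parts: a solution of the discrete oscillator equation with frequency parameter l2 has
    jumps l2 times its mass, up to boundary terms. *)
Lemma jumps_rec n g l2 : (forall i, g i.+2 + g i = (2 - l2) * g i.+1) ->
  jumps n g = l2 * mass n g - g n * (g n - g n.+1) + g 0%N * (g 0%N - g 1%N).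
Proof.
move=> rec; elim: n => [|n IH]; first by rewrite /jumps /mass !big_geq //; lra.
have -> : jumps n.+1 g = jumps n g + (g n - g n.+1) ^+ 2 by rewrite /jumps big_nat_recr.
have -> : mass n.+1 g = mass n g + g n.+1 ^+ 2 by rewrite /mass big_nat_recr.
rewrite IH.
have -> : g n.+2 = (2 - l2) * g n.+1 - g n by rewrite -rec; ring.
by ring.
Qed.

(** Truncation creates two further jumps, from 0 up to g 1 and from g n down to 0. *)
Lemma rough_trunc n g a b : (0 < n)%N ->
  rough n a b (trunc n g) = (a + b) * (jumps n g - (g 0%N - g 1%N) ^+ 2) + a * g 1%N ^+ 2 + b * g n ^+ 2.
Proof.
case: n => // n _; rewrite /rough /jumps.
have -> : \sum_(1 <= i < n.+2) (trunc n.+1 g i.-1 - trunc n.+1 g i) ^+ 2 =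
   g 1%N ^+ 2 + \sum_(1 <= i < n.+1) (g i - g i.+1) ^+ 2.
  rewrite big_nat_recl //= /trunc /= sub0r sqrrN; congr (_ + _).
  by apply: eq_big_nat => i /andP[i1 i2]; rewrite /= i1 (ltnW i2) ifT //; move: i2; clear; lia.
have -> : \sum_(1 <= i < n.+2) (trunc n.+1 g i.+1 - trunc n.+1 g i) ^+ 2 =
   \sum_(1 <= i < n.+1) (g i - g i.+1) ^+ 2 + g n.+1 ^+ 2.
  rewrite big_nat_recr //= /trunc /= ltnn leqnn /= sub0r sqrrN; congr (_ + _).
  by apply: eq_big_nat => i /andP[i1 i2]; rewrite /= i1 (ltnW i2) ifT; [rewrite -sqrrN opprB | move: i2; clear; lia].
rewrite [\sum_(1 <= i < n.+2) _]big_nat_recl //=; ring.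
Qed.
End Profile.

(** * Chains and padded windows *)

Section HatPool.
Variable R : realFieldType.
Implicit Types (w u eta v p q : nat -> R) (E : (nat -> R) -> nat -> R).

Lemma sum_extra (N r : nat) (P Q : pred nat) (e : nat -> R) :
  (1 <= r <= N)%N -> (forall j, 0 <= e j) ->
  (forall j, P j -> ~~ Q j -> j != r -> e j <= 0) ->
  \sum_(1 <= j < N.+1 | P j) e j <= \sum_(1 <= j < N.+1 | Q j) e j + e r.
Proof.
move=> hr e0 h; rewrite big_mkcond [X in _ <= X + _]big_mkcond /=.
have -> : e r = \sum_(1 <= j < N.+1) (if j == r then e j else 0).
  rewrite -big_mkcond /= big_nat1_eq ifT //.
rewrite -big_split /=; apply: ler_sum_nat => j _.
case: ifP => hP; case: ifP => hQ; case: ifP => hj; rewrite ?addr0 ?add0r ?addr_ge0 //.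
- by rewrite lerDl.
- by apply: h; rewrite ?hQ ?hj.
Qed.

(** What is used of a block vector x and T = B - lambda when only windows of full length are available. Here
    u j is the norm of block j of x. In units of a scale r with r_L <= a r and r_U <= b r, eta j is the norm of block j
    of T x, p j and q j are the real inner products of block j of T x with its couplings to the blocks on the left and
    on the right, and E v j is the squared norm of block j of T (v x). The field [ch_E2] keeps the cross terms that the triangle inequality in [ch_E1]
    throws away, because summed over all windows they telescope. The number nu is a lower bound for the smallest
    singular values of the full windows. In [ch_left] and [ch_right] a window overhangs an end of the chain; there the
    bound nu is still available after the row at the cut has been counted again, with a factor that comes from the
    adjoint matrix. *)
Record chain (N n : nat) (a b dl nu : R) u eta p q E : Prop := Chain {
  ch_u0 : u 0%N = 0;
  ch_uN : u N.+1 = 0;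
  ch_u : forall j, 0 <= u j;
  ch_eta : forall j, 0 <= eta j;
  ch_p : forall j, (1 <= j <= N)%N -> `|p j| <= eta j * (a * u j.-1);
  ch_q : forall j, (1 <= j <= N)%N -> `|q j| <= eta j * (b * u j.+1);
  ch_E0 : forall v j, 0 <= E v j;
  ch_E1 : forall v j, (1 <= j <= N)%N ->
    E v j <= (`|v j| * eta j + `|v j.-1 - v j| * (a * u j.-1) + `|v j.+1 - v j| * (b * u j.+1)) ^+ 2;
  ch_E2 : forall v j, (1 <= j <= N)%N ->
    E v j <= v j ^+ 2 * eta j ^+ 2 + 2 * v j * ((v j.-1 - v j) * p j + (v j.+1 - v j) * q j) +
      (a * (v j.-1 - v j) ^+ 2 * u j.-1 ^+ 2 + b * (v j.+1 - v j) ^+ 2 * u j.+1 ^+ 2);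
  ch_res : \sum_(1 <= j < N.+1) eta j ^+ 2 <= dl ^+ 2 * mass N u;
  ch_win : forall s v, (n <= s <= N)%N -> (forall j, (1 <= j <= N)%N -> ~~ inwin n s j -> v j = 0) ->
    nu ^+ 2 * (\sum_(1 <= j < N.+1) v j ^+ 2 * u j ^+ 2) <=
    \sum_(1 <= j < N.+1 | inwin n s j) E v j;
  ch_left : forall s v, (1 <= s < n)%N -> (forall j, (1 <= j <= N)%N -> ~~ inwin n s j -> v j = 0) -> b < nu ->
    nu ^+ 2 * (\sum_(1 <= j < N.+1) v j ^+ 2 * u j ^+ 2) <=
    \sum_(1 <= j < N.+1 | inwin n s j) E v j + b ^+ 2 / (nu ^+ 2 - b ^+ 2) * E v s;
  ch_right : forall s v, (N < s < N + n)%N -> (forall j, (1 <= j <= N)%N -> ~~ inwin n s j -> v j = 0) -> a < nu ->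
    nu ^+ 2 * (\sum_(1 <= j < N.+1) v j ^+ 2 * u j ^+ 2) <=
    \sum_(1 <= j < N.+1 | inwin n s j) E v j + a ^+ 2 / (nu ^+ 2 - a ^+ 2) * E v (s - n).+1 }.

Section PaddedWindows.
Variables (N n : nat) (a b dl nu : R) (u eta p q : nat -> R) (E : (nat -> R) -> nat -> R).
Hypothesis ch : chain N n a b dl nu u eta p q E.
Hypotheses (a0 : 0 <= a) (b0 : 0 <= b) (ab : a + b = 1) (n0 : (0 < n)%N) (nN : (n <= N)%N).

Lemma row_zero v j : (1 <= j <= N)%N -> v j.-1 = 0 -> v j = 0 -> v j.+1 = 0 -> E v j = 0.
Proof.
move=> hj v1 v2 v3; apply/eqP; rewrite eq_le (ch_E0 ch) andbT.
by apply: le_trans (ch_E1 ch v hj) _; rewrite v1 v2 v3 subrr normr0 !mul0r !addr0 expr0n.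
Qed.

(** A window overhanging the right end is the last full window with weights that begin with zeros. Only
    one row outside the overhanging window sees these weights, through its coupling to their first entry. *)
Lemma right_padded w s : w 0%N = 0 -> (N < s < N + n)%N ->
  nu ^+ 2 * (\sum_(1 <= j < N.+1) w (j + n - s)%N ^+ 2 * u j ^+ 2) <=
    \sum_(1 <= j < N.+1 | inwin n s j) E (fun j => w (j + n - s)%N) j + (b * w 1%N * u (s - n).+1) ^+ 2.
Proof.
move=> w0 hs.
have hsN : (n <= N <= N)%N by rewrite nN leqnn.
apply: le_trans (ch_win ch hsN _) _.
  move=> j hj hj'; rewrite (_ : (j + n - s = 0)%N) //.
  by move: hj hs hj'; rewrite /inwin; clear; lia.
have hr : (1 <= s - n <= N)%N by move: hs nN; clear; lia.
apply: le_trans (_ : _ <= \sum_(1 <= j < N.+1 | inwin n s j) E (fun j => w (j + n - s)%N) j + E (fun j => w (j + n - s)%N) (s - n)%N) _.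
  apply: sum_extra => //; first exact: ch_E0 ch _.
  move=> j h1 h2 h3.
  have [jN|jN] := ltnP N j; first by move: h1; rewrite /inwin; move: jN; clear; lia.
  have z k : (k + n <= s)%N -> w (k + n - s)%N = 0 by move=> h; rewrite (_ : (k + n - s)%N = 0%N) //; apply/eqP; rewrite subn_eq0.
  by rewrite row_zero //; first (by move: h1 hs jN nN; rewrite /inwin; clear; lia); apply: z; move: h1 h2 h3 hs jN nN; rewrite /inwin; clear; lia.
rewrite lerD2l.
apply: le_trans (ch_E1 ch _ hr) _ => /=.
rewrite (_ : ((s - n) + n - s)%N = 0%N); last by move: hs nN; clear; lia.
rewrite (_ : ((s - n).-1 + n - s)%N = 0%N); last by move: hs nN; clear; lia.
rewrite (_ : ((s - n).+1 + n - s)%N = 1%N); last by move: hs nN; clear; lia.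
rewrite w0 subr0 normr0 !mul0r !add0r !exprMn real_normK ?num_real //.
by apply: le_of_eq; ring.
Qed.

(** The same at the left end, where the row beyond the window sees the last weight w n. *)
Lemma left_padded w s : (forall i, (n < i)%N -> w i = 0) -> (1 <= s < n)%N ->
  nu ^+ 2 * (\sum_(1 <= j < N.+1) w (j + n - s)%N ^+ 2 * u j ^+ 2) <=
    \sum_(1 <= j < N.+1 | inwin n s j) E (fun j => w (j + n - s)%N) j + (a * w n * u s) ^+ 2.
Proof.
move=> wn hs.
have hsN : (n <= n <= N)%N by rewrite nN leqnn.
apply: le_trans (ch_win ch hsN _) _.
  move=> j hj hj'; apply: wn.
  by move: hj hs hj'; rewrite /inwin; clear; lia.
have hr : (1 <= s.+1 <= N)%N by move: hs nN; clear; lia.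
apply: le_trans (_ : _ <= \sum_(1 <= j < N.+1 | inwin n s j) E (fun j => w (j + n - s)%N) j + E (fun j => w (j + n - s)%N) s.+1) _.
  apply: sum_extra => //; first exact: ch_E0 ch _.
  move=> j h1 h2 h3.
  have z k : (s < k)%N -> w (k + n - s)%N = 0 by move=> h; apply: wn; move: h; clear; lia.
  by rewrite row_zero //; first (by move: h1 hs nN; rewrite /inwin; clear; lia); apply: z; move: h1 h2 h3 hs nN; rewrite /inwin; clear; lia.
rewrite lerD2l.
apply: le_trans (ch_E1 ch _ hr) _ => /=.
rewrite (_ : (s + n - s)%N = n); last by move: hs nN; clear; lia.
rewrite (wn (s.+1 + n - s)%N); last by move: hs nN; clear; lia.
rewrite (wn (s.+2 + n - s)%N); last by move: hs nN; clear; lia.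
rewrite !subr0 normr0 !mul0r add0r addr0 !exprMn real_normK ?num_real //.
by apply: le_of_eq; ring.
Qed.

(** The alternative to [left_padded]: instead of the row beyond the window, the last row inside it is paid
    for, with the factor of the adjoint bound. *)
Lemma left_dual w s : (forall i, (n < i)%N -> w i = 0) -> (1 <= s < n)%N -> b < nu ->
  nu ^+ 2 * (\sum_(1 <= j < N.+1) w (j + n - s)%N ^+ 2 * u j ^+ 2) <=
    \sum_(1 <= j < N.+1 | inwin n s j) E (fun j => w (j + n - s)%N) j +
    b ^+ 2 / (nu ^+ 2 - b ^+ 2) * (`|w n| * eta s + `|w n.-1 - w n| * (a * u s.-1) + `|w n| * (b * u s.+1)) ^+ 2.
Proof.
move=> wn hs bnu.
have hr : (1 <= s <= N)%N by move: hs nN; clear; lia.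
apply: le_trans (ch_left ch hs _ bnu) _.
  move=> j hj hj'; apply: wn.
  by move: hj hs hj'; rewrite /inwin; clear; lia.
rewrite lerD2l ler_wpM2l //.
  by rewrite divr_ge0 ?sqr_ge0 // subr_ge0 ler_pXn2r ?nnegrE ?(ltW bnu) //; apply: le_trans b0 (ltW bnu).
apply: le_trans (ch_E1 ch _ hr) _ => /=.
rewrite (_ : (s + n - s)%N = n); last by move: hs nN; clear; lia.
rewrite (_ : (s.-1 + n - s)%N = n.-1); last by move: hs nN; clear; lia.
rewrite (wn (s.+1 + n - s)%N) ?sub0r ?normrN //; by move: hs nN; clear; lia.
Qed.

Lemma sum_left_extra (f : nat -> R) : (forall j, 0 <= f j) ->
  \sum_(1 <= s < N + n) (if (s < n)%N then f s else 0) <= \sum_(1 <= j < N.+1) f j.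
Proof.
move=> f0; rewrite -big_mkcond /= (@big_cat_nat _ _ _ N.+1) //=; last by move: nN n0; clear; lia.
rewrite [X in _ + X]big_nat_cond [X in _ + X]big1 ?addr0.
  by rewrite big_mkcond /=; apply: ler_sum_nat => j _; case: ifP.
by move=> i; move: nN; clear; lia.
Qed.

Lemma sum_right_extra (f : nat -> R) : (forall j, 0 <= f j) ->
  \sum_(1 <= s < N + n) (if (N < s)%N then f (s - n).+1 else 0) <= \sum_(1 <= j < N.+1) f j.
Proof.
move=> f0; rewrite -big_mkcond /=.
have -> : \sum_(1 <= s < N + n | (N < s)%N) f (s - n).+1 = \sum_(n.+1 <= s < N + n | (N < s)%N) f (s - n).+1.
  rewrite [LHS](@big_cat_nat _ _ _ n.+1) //=; last by move: nN n0; clear; lia.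
  by rewrite big_nat_cond big1 ?add0r // => i; move: nN; clear; lia.
rewrite -[n.+1]addn1 addnC big_addn addnK big_mkcond /=.
apply: le_trans (_ : _ <= \sum_(1 <= i < N) f i.+1) _.
  by apply: ler_sum_nat => j _; rewrite addnK; case: ifP.
rewrite [leRHS]big_ltn ?ltnS; last by move: nN n0; clear; lia.
by rewrite [X in _ <= _ + X]big_add1 /= lerDr.
Qed.

(** The averaging argument with full windows only. Windows overhanging the right end are padded by zeros; the
    treatment of those overhanging the left end is left open, at a cost L s. *)
Lemma hat_pool w (la cl : R) (L : nat -> R) : w 0%N = 0 -> (forall i, (n < i)%N -> w i = 0) ->
  0 < dl -> 0 < la ->
  (forall s, 0 <= L s) ->
  (forall s, (1 <= s < n)%N -> nu ^+ 2 * (\sum_(1 <= j < N.+1) w (j + n - s)%N ^+ 2 * u j ^+ 2) <=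
    \sum_(1 <= j < N.+1 | inwin n s j) E (fun j => w (j + n - s)%N) j + L s) ->
  \sum_(1 <= s < N.+1) L s <= cl * mass N u ->
  nu ^+ 2 * (mass n w * mass N u) <=
   ((dl + la) * dl * mass n w + (dl + la) / la * rough n a b w + cl + b ^+ 2 * w 1%N ^+ 2) * mass N u.
Proof.
move=> w0 wn d0 l0 L0 hL hcl.
pose f j := (b * w 1%N * u j) ^+ 2.
apply: le_trans (@pool_le R n N a b dl la nu u eta E w (fun s => (if (s < n)%N then L s else 0) + (if (N < s)%N then f (s - n).+1 else 0)) a0 b0 ab d0 l0 (ch_u0 ch) (ch_uN ch) (ch_E1 ch) (ch_res ch) w0 wn _) _.
  move=> s hs; have [sn|sn] := ltnP s n.
    rewrite ifN; last by move: sn nN; clear; lia.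
    by rewrite addr0; apply: hL; move: hs sn; clear; lia.
  rewrite add0r; case: ltnP => sN.
    by apply: right_padded => //; move: hs sN; clear; lia.
  rewrite addr0; apply: (ch_win ch); first by rewrite sn sN.
  move=> j hj hj'; have [h|h] := leqP (j + n)%N s.
    by rewrite (_ : (j + n - s)%N = 0%N) //; apply/eqP; rewrite subn_eq0.
  by apply: wn; move: h hj'; rewrite /inwin; clear; lia.
rewrite big_split /= [leRHS]mulrDl [(_ + cl) * _]mulrDl -addrA lerD2l.
apply: lerD; first by apply: le_trans (sum_left_extra L0) hcl.
apply: le_trans (sum_right_extra (fun j => sqr_ge0 _)) _.
rewrite /f /mass mulr_sumr; apply: ler_sum_nat => j _; rewrite -!exprMn; exact: lexx.
Qed.
End PaddedWindows.
End HatPool.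

(** * Tapered windows *)

Section Sums.
Variable R : realFieldType.
Implicit Types w g : nat -> R.


(** The cross terms telescope: up to a boundary term their sum is of second order in the jumps, which is
    what makes the refined row bound worthwhile. *)
Lemma cross_left w m : w 0%N = 0 ->
  \sum_(1 <= i < m.+1) 2 * w i * (w i.-1 - w i) = - w m ^+ 2 - jumps m w.
Proof.
move=> w0; elim: m => [|m IH]; first by rewrite /jumps !big_geq // w0; ring.
have -> : jumps m.+1 w = jumps m w + (w m - w m.+1) ^+ 2 by rewrite /jumps big_nat_recr.
by rewrite big_nat_recr //= IH; ring.
Qed.

Lemma cross_right w m : w 0%N = 0 ->
  \sum_(1 <= i < m.+1) 2 * w i * (w i.+1 - w i) = w m.+1 ^+ 2 - jumps m.+1 w.
Proof.
move=> w0; elim: m => [|m IH]; first by rewrite /jumps big_geq // big_nat1 /= w0; ring.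
have -> : jumps m.+2 w = jumps m.+1 w + (w m.+1 - w m.+2) ^+ 2 by rewrite /jumps big_nat_recr.
by rewrite big_nat_recr //= IH; ring.
Qed.

Lemma jump_right w m : w 0%N = 0 ->
  \sum_(1 <= i < m.+1) (w i.+1 - w i) ^+ 2 = jumps m.+1 w - w 1%N ^+ 2.
Proof.
move=> w0; elim: m => [|m IH]; first by rewrite /jumps big_geq // big_nat1 /= w0; ring.
have -> : jumps m.+2 w = jumps m.+1 w + (w m.+1 - w m.+2) ^+ 2 by rewrite /jumps big_nat_recr.
by rewrite big_nat_recr //= IH; ring.
Qed.

Lemma jumps_mono m k w : (m <= k)%N -> jumps m w <= jumps k w.
Proof.
move=> mk; rewrite /jumps [leRHS](@big_cat_nat _ _ _ m.+1) //= lerDl.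
by apply: sumr_ge0 => i _; exact: sqr_ge0.
Qed.

Lemma mass_mono m k w : (m <= k)%N -> mass m w <= mass k w.
Proof.
move=> mk; rewrite /mass [leRHS](@big_cat_nat _ _ _ m.+1) //= lerDl.
by apply: sumr_ge0 => i _; exact: sqr_ge0.
Qed.

Lemma jumps_trunc m n g : g 0%N = 0 -> (m <= n)%N -> jumps m (trunc n g) = jumps m g.
Proof.
move=> g0 mn; apply: eq_big_nat => i hi.
have -> : trunc n g i = g i by rewrite /trunc ifT //; move: hi mn; clear; lia.
rewrite /trunc; case: ifP => //; case: i hi => [|[|i]] //= hi; first by rewrite g0.
by move: hi mn; clear; lia.
Qed.

Lemma jumps_truncS n g : g 0%N = 0 -> jumps n.+1 (trunc n g) = jumps n g + g n ^+ 2.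
Proof.
move=> g0; rewrite /jumps big_nat_recr //= -/(jumps n (trunc n g)) jumps_trunc //; congr (_ + _).
rewrite /trunc ltnn andbF subr0; case: ifP => // /negbT; case: n => [|n]; first by rewrite g0.
by rewrite leqnn.
Qed.

(** The windows that start to the right of position 1 contribute to position j the indices below j; the
    tapered windows will contribute the remaining ones. *)
Lemma sum_shift_right (n N : nat) (F : nat -> nat -> R) :
  \sum_(n.+1 <= s < N + n) \sum_(1 <= j < N.+1 | inwin n s j) F (j + n - s)%N j =
  \sum_(1 <= j < N.+1) \sum_(1 <= i < n.+1 | (i < j)%N) F i j.
Proof.
pose F' i j := if (i < j)%N then F i j else 0.
transitivity (\sum_(1 <= j < N.+1) \sum_(1 <= i < n.+1) F' i j); last first.
  by apply: eq_big_nat => j _; rewrite [RHS]big_mkcond.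
rewrite -sum_shift.
have [h|h] := leqP (N + n) n.+1.
  rewrite big_geq // big_nat_cond big1 // => s hs; rewrite big_nat_cond big1 // => j hj.
  by rewrite /F' ifF //; move: h hs hj; rewrite /inwin; clear; lia.
rewrite [RHS](@big_cat_nat _ _ _ n.+1) //=; last exact: ltnW.
rewrite [X in _ = X + _]big_nat_cond [X in _ = X + _]big1 ?add0r; last first.
  move=> s hs; rewrite big_nat_cond big1 // => j hj.
  by rewrite /F' ifF //; move: hs hj; rewrite /inwin; clear; lia.
apply: eq_big_nat => s hs; rewrite big_nat_cond [RHS]big_nat_cond; apply: eq_bigr => j hj.
by rewrite /F' ifT //; move: hs hj; rewrite /inwin; clear; lia.
Qed.

Lemma sum_predw_le (N : nat) (f : nat -> R) : f 0%N = 0 -> (forall j, 0 <= f j) ->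
  \sum_(1 <= j < N.+1) f j.-1 <= \sum_(1 <= j < N.+1) f j.
Proof.
move=> u0 f0; case: N => [|N]; first by rewrite !big_geq.
rewrite big_nat_recl //= u0 add0r [leRHS]big_nat_recr //= big_add1 /=.
by rewrite lerDl.
Qed.

Lemma sum_succw_le (N : nat) (f : nat -> R) : f N.+1 = 0 -> (forall j, 0 <= f j) ->
  \sum_(1 <= j < N.+1) f j.+1 <= \sum_(2 <= j < N.+1) f j.
Proof.
move=> uN f0; case: N uN => [|N] uN; first by rewrite !big_geq.
by rewrite big_nat_recr //= uN addr0 [leRHS]big_add1.
Qed.

(** Position j has index j + k in the k-th tapered window, so over all these windows it sees each index from
    j on exactly once. *)
Lemma sum_diag (P j : nat) (G : nat -> R) : (0 < j)%N -> (forall i, (P.+1 < i)%N -> G i = 0) ->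
  \sum_(0 <= k < P.+1) G (j + k)%N = \sum_(j <= i < P.+2) G i.
Proof.
move=> j0 G0; transitivity (\sum_(j <= i < j + P.+1) G i).
  by rewrite -{2}[j]add0n big_addn addKn; apply: eq_bigr => i _; rewrite addnC.
have [jP|jP] := leqP j P.+2; last first.
  rewrite [RHS]big_geq 1?ltnW // big_nat_cond big1 // => i hi; apply: G0; move: hi jP; clear; lia.
rewrite (@big_cat_nat _ _ _ P.+2) //=; last by move: j0; clear; lia.
rewrite [X in _ + X]big_nat_cond [X in _ + X]big1 ?addr0 // => i hi; apply: G0; move: hi; clear; lia.
Qed.
End Sums.

(** The weights 4 and 4/3 suit the situation in which the residual is about a third of the coupling. *)
Lemma sqrD_le4 (R : realFieldType) (x y b : R) : (x + b * y) ^+ 2 <= 4 * x ^+ 2 + 4/3 * b ^+ 2 * y ^+ 2.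
Proof. have := sqr_ge0 (3 * x - b * y); lra. Qed.

Section TaperedWindows.
Variable R : realFieldType.
Variables (N n P : nat) (a b dl nu la : R) (u eta p q g : nat -> R) (E : (nat -> R) -> nat -> R).
Hypothesis ch : chain N n a b dl nu u eta p q E.
Hypotheses (a0 : 0 <= a) (b0 : 0 <= b) (ab : a + b = 1) (n3 : (2 < n)%N) (nN : (n <= N)%N) (nP : (n <= P)%N).
Hypotheses (g0 : g 0%N = 0).

(** [cost_left] and [cost_right] are the parts of the refined row bound that involve the left and the right
    neighbour; x, y, z are the weights at positions j - 1, j, j + 1. *)
Definition cost_left j (x y : R) := y ^+ 2 * eta j ^+ 2 + 2 * y * (x - y) * p j + a * (x - y) ^+ 2 * u j.-1 ^+ 2.
Definition cost_right j (y z : R) := 2 * y * (z - y) * q j + b * (z - y) ^+ 2 * u j.+1 ^+ 2.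

Lemma row_le v j : (1 <= j <= N)%N -> E v j <= cost_left j (v j.-1) (v j) + cost_right j (v j) (v j.+1).
Proof.
move=> hj; apply: le_trans (ch_E2 ch v hj) _; rewrite /cost_left /cost_right.
by apply: le_of_eq; ring.
Qed.

Lemma sum_cost_left w m j : w 0%N = 0 -> \sum_(1 <= i < m.+1) cost_left j (w i.-1) (w i) =
  mass m w * eta j ^+ 2 + (- w m ^+ 2 - jumps m w) * p j + a * jumps m w * u j.-1 ^+ 2.
Proof.
by move=> w0; rewrite -cross_left // /cost_left !big_split /= -!mulr_suml -mulr_sumr.
Qed.

Lemma sum_cost_right w m j : w 0%N = 0 -> \sum_(1 <= i < m.+1) cost_right j (w i) (w i.+1) =
  (w m.+1 ^+ 2 - jumps m.+1 w) * q j + b * (jumps m.+1 w - w 1%N ^+ 2) * u j.+1 ^+ 2.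
Proof.
by move=> w0; rewrite -cross_right // -jump_right // /cost_right !big_split /= -!mulr_suml -mulr_sumr.
Qed.

Let wx := trunc P g.
Let wt := trunc n g.

(** The substitute for a window overhanging the left end. It stays on the positions 1, ..., n but uses the
    weights from index k + 1 on, which continue beyond n up to P; at the last position the weight of position n - 1
    is repeated, so that there is no jump inside the window where the weights are cut off. *)
Definition tapered k j : R := if (j <= n)%N then wx (minn j n.-1 + k)%N else 0.

Definition tail_mass := \sum_(n.-1 <= i < P.+1) g i ^+ 2.

Lemma wxE i : (i <= P)%N -> wx i = g i.
Proof. by move=> h; rewrite /wx /trunc h andbT; case: i h. Qed.

Lemma wx_gt i : (P < i)%N -> wx i = 0.
Proof. by move=> h; rewrite /wx /trunc [(i <= P)%N]leqNgt h andbF. Qed.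

Lemma wtE i : (i <= n)%N -> wt i = g i.
Proof. by move=> h; rewrite /wt /trunc h andbT; case: i h. Qed.

Lemma wt_gt i : (n < i)%N -> wt i = 0.
Proof. by move=> h; rewrite /wt /trunc [(i <= n)%N]leqNgt h andbF. Qed.


Lemma left_window k : nu ^+ 2 * (\sum_(1 <= j < N.+1) tapered k j ^+ 2 * u j ^+ 2) <=
  \sum_(1 <= j < n.+1) E (tapered k) j.
Proof.
apply: le_trans (ch_win ch (_ : (n <= n <= N)%N) _) _.
- by rewrite leqnn.
- by move=> j hj hj'; rewrite /tapered ifF //; move: hj hj'; rewrite /inwin; clear; lia.
apply: le_of_eq.
rewrite [RHS](@big_nat_widen _ _ _ 1 _ N.+1) // [LHS]big_nat_cond [RHS]big_nat_cond.
by apply: eq_bigl => j; rewrite /inwin; clear; lia.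
Qed.

Definition pad_cost s : R := (b * g 1%N * u (s - n).+1) ^+ 2.

Lemma right_window s : (n < s < N + n)%N ->
  nu ^+ 2 * (\sum_(1 <= j < N.+1) wt (j + n - s)%N ^+ 2 * u j ^+ 2) <=
  \sum_(1 <= j < N.+1 | inwin n s j) E (fun j => wt (j + n - s)%N) j + pad_cost s.
Proof.
move=> hs; have [sN|sN] := ltnP N s.
  have -> : pad_cost s = (b * wt 1%N * u (s - n).+1) ^+ 2 by rewrite /pad_cost wtE //; move: n3; clear; lia.
  by apply: (right_padded ch) => //; move: hs sN; clear; lia.
apply: le_trans (ch_win ch (_ : (n <= s <= N)%N) _) _; first by move: hs sN; clear; lia.
  move=> j hj hj'; have [h|h] := leqP (j + n)%N s.
    by rewrite (_ : (j + n - s)%N = 0%N) //; apply/eqP; rewrite subn_eq0.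
  by apply: wt_gt; move: h hj'; rewrite /inwin; clear; lia.
by rewrite lerDl sqr_ge0.
Qed.

Definition rowR j := \sum_(1 <= i < n.+1 | (i < j)%N) (cost_left j (wt i.-1) (wt i) + cost_right j (wt i) (wt i.+1)).
Definition rowL j := \sum_(0 <= k < P.+1) (if (j <= n)%N then E (tapered k) j else 0).

Lemma right_total :
  \sum_(n.+1 <= s < N + n) \sum_(1 <= j < N.+1 | inwin n s j) E (fun j => wt (j + n - s)%N) j <=
  \sum_(1 <= j < N.+1) rowR j.
Proof.
rewrite -(sum_shift_right n N (fun i j => cost_left j (wt i.-1) (wt i) + cost_right j (wt i) (wt i.+1))).
apply: ler_sum_nat => s _; rewrite big_nat_cond [leRHS]big_nat_cond; apply: ler_sum => j /andP[/andP[j1 jN] /andP[i1 i2]].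
have hj : (1 <= j <= N)%N by rewrite j1.
apply: (le_trans (row_le _ hj)).
have ip : (j.-1 + n - s)%N = (j + n - s).-1 by move: j1 i1 i2; clear; lia.
have iS : (j.+1 + n - s)%N = (j + n - s).+1 by rewrite addSn subSn // ltnW.
by rewrite ip iS lexx.
Qed.

Lemma pad_total : \sum_(n.+1 <= s < N + n) pad_cost s <= \sum_(2 <= j < N.+1) b ^+ 2 * g 1%N ^+ 2 * u j ^+ 2.
Proof.
rewrite -[n.+1]add1n big_addn addnK; have N0 : (0 < N)%N by move: nN n3; clear; lia.
rewrite [leRHS]big_add1 /=; apply: le_of_eq; apply: eq_big_nat => j _.
by rewrite /pad_cost addnK !exprMn.
Qed.

(** Row j sees in the tapered windows exactly the jumps of the extended weights from index j on, because
    the windows are translates of each other below the repeated weight. *)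
Lemma left_row_low j : (1 <= j <= n.-1)%N -> rowL j <=
  \sum_(j <= i < P.+2) cost_left j (wx i.-1) (wx i) + (if j == n.-1 then 0 else \sum_(j <= i < P.+2) cost_right j (wx i) (wx i.+1)).
Proof.
move=> hj; have hjN : (1 <= j <= N)%N by move: hj nN; clear; lia.
have -> : (if j == n.-1 then 0 else \sum_(j <= i < P.+2) cost_right j (wx i) (wx i.+1)) =
  \sum_(j <= i < P.+2) (if j == n.-1 then 0 else cost_right j (wx i) (wx i.+1)).
  by case: eqP => // _; rewrite big1_eq.
have j0 : (0 < j)%N by case/andP: hj.
rewrite -big_split /= -(sum_diag j0); last first.
  move=> i hi; have i1 : (P < i)%N by apply: ltnW.
  have i2 : (P < i.-1)%N by move: hi; clear; lia.
  have i3 : (P < i.+1)%N by apply: ltnW.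
  by rewrite /cost_left /cost_right !wx_gt // subrr; case: eqP; rewrite !(mulr0, mul0r, expr0n, addr0).
apply: ler_sum_nat => k _; rewrite ifT; last by move: hj; clear; lia.
apply: (le_trans (row_le _ hjN)).
have e1 : tapered k j.-1 = wx (j + k).-1.
  by rewrite /tapered ifT; [congr wx; move: hj; clear; lia | move: hj; clear; lia].
have e2 : tapered k j = wx (j + k)%N.
  by rewrite /tapered ifT; [congr wx; move: hj; clear; lia | move: hj; clear; lia].
rewrite e1 e2 lerD2l; case: eqP => jn.
  have -> : tapered k j.+1 = wx (j + k)%N.
    by rewrite /tapered ifT; [congr wx; move: hj jn; clear; lia | move: hj jn; clear; lia].
  by rewrite /cost_right subrr !(mulr0, mul0r, expr0n, addr0).
have -> : tapered k j.+1 = wx (j + k).+1.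
  by rewrite /tapered ifT; [congr wx; move: hj jn; clear; lia | move: hj jn; clear; lia].
exact: lexx.
Qed.

(** At position n the left jump vanishes and the right jump is the whole weight. Here the crude row
    bound is good enough, as only the tail of the weights occurs. *)
Lemma left_row_edge : rowL n <= tail_mass * (4 * eta n ^+ 2 + 4/3 * b ^+ 2 * u n.+1 ^+ 2).
Proof.
have hn : (1 <= n <= N)%N by rewrite nN andbT; move: n3; clear; lia.
have -> : tail_mass = \sum_(0 <= k < P.+1) wx (n.-1 + k)%N ^+ 2.
  rewrite (@sum_diag _ P n.-1 (fun i => wx i ^+ 2)); last 2 first.
  - by move: n3; clear; lia.
  - by move=> i hi; rewrite wx_gt ?expr0n //; apply: ltnW.
  rewrite big_nat_recr /=; last by move: nP; clear; lia.
  rewrite wx_gt // expr0n addr0; apply: eq_big_nat => i hi; rewrite wxE //.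
  by move: hi; clear; lia.
rewrite mulr_suml; apply: ler_sum_nat => k _; rewrite leqnn.
apply: (le_trans (ch_E1 ch _ hn)).
have e1 : tapered k n.-1 = wx (n.-1 + k)%N.
  by rewrite /tapered ifT ?leq_pred //; congr wx; clear; lia.
have e2 : tapered k n = wx (n.-1 + k)%N.
  by rewrite /tapered ifT ?leqnn //; congr wx; clear; lia.
have e3 : tapered k n.+1 = 0 by rewrite /tapered ltnn.
rewrite e1 e2 e3 subrr normr0 mul0r addr0 sub0r normrN -mulrDr exprMn real_normK ?num_real //.
apply: ler_wpM2l; first exact: sqr_ge0.
exact: sqrD_le4.
Qed.
End TaperedWindows.

Lemma mulr_le_norm (R : realFieldType) (c D x : R) : - D <= c -> c <= D -> c * x <= D * `|x|.
Proof.
move=> h1 h2; apply: le_trans (ler_norm _) _; rewrite normrM ler_wpM2r //.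
by rewrite ler_norml h1.
Qed.

Lemma row_bound (R : realFieldType) (X1 X2 c1 c2 D A1 A2 B1 B2 e pp qq u1 u2 : R) :
  X1 <= X2 -> - D <= c1 -> c1 <= D -> - D <= c2 -> c2 <= D -> A1 <= A2 -> B1 <= B2 ->
  X1 * e ^+ 2 + c1 * pp + A1 * u1 ^+ 2 + (c2 * qq + B1 * u2 ^+ 2) <=
  X2 * e ^+ 2 + D * (`|pp| + `|qq|) + (A2 * u1 ^+ 2 + B2 * u2 ^+ 2).
Proof.
move=> h1 h2 h3 h4 h5 h6 h7.
have k1 := ler_wpM2r (sqr_ge0 e) h1; have k2 := mulr_le_norm pp h2 h3.
have k3 := mulr_le_norm qq h4 h5; have k4 := ler_wpM2r (sqr_ge0 u1) h6.
have k5 := ler_wpM2r (sqr_ge0 u2) h7.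
move: k1 k2 k3 k4 k5; clear; lra.
Qed.

Lemma edge_assemble (R : realFieldType) (Z L S1 e2 X A u2 B b2 r : R) :
  L <= r * (4 * e2 + 4/3 * b2 * u2) -> Z <= S1 * e2 + X + (A + B * u2) ->
  Z + L <= (S1 + 4 * r) * e2 + X + (A + (B + 4/3 * b2 * r) * u2).
Proof. lra. Qed.

Section RowTotals.
Variable R : realFieldType.
Variables (N n P : nat) (a b dl nu la : R) (u eta p q g : nat -> R) (E : (nat -> R) -> nat -> R).
Hypothesis ch : chain N n a b dl nu u eta p q E.
Hypotheses (a0 : 0 <= a) (b0 : 0 <= b) (ab : a + b = 1) (n3 : (2 < n)%N) (nN : (n <= N)%N) (nP : (n <= P)%N).
Hypotheses (g0 : g 0%N = 0).

Local Notation wx := (trunc P g).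
Local Notation wt := (trunc n g).
Local Notation rho := (tail_mass n P g).
Local Notation SD := (jumps P.+1 wx).
Local Notation SP := (mass P g).
Local Notation W := (mass n g).
Local Notation Jn := (jumps n g).
Local Notation D := (g n.-1 ^+ 2 + SD).
Local Notation rR := (rowR n a b u eta p q g).
Local Notation rL := (rowL n P g E).

Hypothesis gn : g n ^+ 2 <= g n.-1 ^+ 2.

(** [colA c] and [colB c] bound the coefficient of the squared block norm at position c that is produced by row
    c + 1 and by row c - 1. *)
Definition colA c := if (c <= n)%N then a * SD else a * Jn.
Definition colB c := if (c <= n)%N then b * (SD - g 1%N ^+ 2)
  else if c == n.+1 then b * (Jn - g 1%N ^+ 2) + 4/3 * b ^+ 2 * rho
  else b * (Jn + g n ^+ 2 - g 1%N ^+ 2).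
Definition Wm := SP + g n.-1 ^+ 2 + 3 * rho.

Lemma mass_wx : mass P.+1 wx = SP.
Proof.
rewrite /mass big_nat_recr //= wx_gt // expr0n addr0.
by apply: eq_big_nat => i /andP[_ hi]; rewrite (wxE g0).
Qed.

Lemma mass_wt m : (m <= n)%N -> mass m wt = mass m g.
Proof. by move=> mn; apply: eq_big_nat => i hi; rewrite (wtE g0) //; move: hi mn; clear; lia. Qed.

Lemma jumps_wx2 : jumps P.+2 wx = SD.
Proof. by rewrite /jumps big_nat_recr //= !wx_gt // subrr expr0n addr0. Qed.

Lemma jumps_le m : (m <= n)%N -> jumps m g <= SD.
Proof.
move=> mn; rewrite -(@jumps_trunc _ m P) //; last exact: leq_trans nP.
by apply: jumps_mono; apply: leq_trans mn (leq_trans nP _).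
Qed.

Lemma jumps_ge0 m w : 0 <= jumps m w :> R.
Proof. by apply: sumr_ge0 => i _; exact: sqr_ge0. Qed.

Lemma mass_ge0 m w : 0 <= mass m w :> R.
Proof. by apply: sumr_ge0 => i _; exact: sqr_ge0. Qed.

Lemma rho_ge0 : 0 <= rho.
Proof. by apply: sumr_ge0 => i _; exact: sqr_ge0. Qed.

Lemma g1_jumps m : (0 < m)%N -> g 1%N ^+ 2 <= jumps m g.
Proof.
move=> m0; have -> : g 1%N ^+ 2 = jumps 1 g by rewrite /jumps big_nat1 /= g0 sub0r sqrrN.
exact: jumps_mono.
Qed.

Lemma W_le_SP : W <= SP.
Proof. exact: mass_mono. Qed.

Lemma split_rho : SP + g n.-1 ^+ 2 = mass n.-1 g + rho.
Proof.
rewrite /mass /tail_mass [X in X + _](@big_cat_nat _ _ _ n) /=; [|by move: n3; clear; lia|by move: nP; clear; lia].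
have -> : \sum_(n.-1 <= i < P.+1) g i ^+ 2 = g n.-1 ^+ 2 + \sum_(n <= i < P.+1) g i ^+ 2.
  rewrite big_ltn ?prednK //; by move: n3 nP; clear; lia.
by rewrite prednK; [ring | move: n3; clear; lia].
Qed.

Lemma rowR_low j : (1 <= j <= n)%N ->
  rR j = \sum_(1 <= i < j) cost_left a u eta p j (wx i.-1) (wx i) + \sum_(1 <= i < j) cost_right b u q j (wx i) (wx i.+1).
Proof.
move=> hj; rewrite -big_split /= /rowR [RHS](@big_nat_widen _ _ _ 1 _ n.+1); last by move: hj; clear; lia.
rewrite [LHS]big_nat_cond [RHS]big_nat_cond; apply: eq_big => [i|i hi]; first by rewrite andTb.
by rewrite !(wtE g0) ?(wxE g0) //; move: hi hj nP; clear; lia.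
Qed.

Lemma rowR_high j : (n < j)%N ->
  rR j = \sum_(1 <= i < n.+1) cost_left a u eta p j (wt i.-1) (wt i) + \sum_(1 <= i < n.+1) cost_right b u q j (wt i) (wt i.+1).
Proof.
move=> hj; rewrite -big_split /= /rowR [LHS]big_nat_cond [RHS]big_nat_cond; apply: eq_bigl => i.
by move: hj; clear; lia.
Qed.

(** All windows seen from position j. To the left of n the right windows and the tapered windows together
    run once through the extended weights, at n the tapered windows add the tail, and to the right of n a row sees one
    copy of the truncated weights. Every cross term has a coefficient of absolute value at most D. *)
Lemma row_total j : (1 <= j <= N)%N ->
  rR j + rL j <= Wm * eta j ^+ 2 + D * (`|p j| + `|q j|) + (colA j.-1 * u j.-1 ^+ 2 + colB j.+1 * u j.+1 ^+ 2).
Proof.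
move=> hj.
have SD0 : 0 <= SD := jumps_ge0 _ _; have r0 := rho_ge0.
have gp := sqr_ge0 (g n.-1); have gq := sqr_ge0 (g n).
have n10 : (0 < n)%N by move: n3; clear; lia.
have [jn|jn] := ltnP j n.
  have hj1 : (1 <= j <= n.-1)%N by move: hj jn; clear; lia.
  have hjn : (1 <= j <= n)%N by move: hj jn; clear; lia.
  have j0 : (1 <= j)%N by case/andP: hj.
  have cA : colA j.-1 = a * SD by rewrite /colA ifT //; move: jn; clear; lia.
  have cB : colB j.+1 = b * (SD - g 1%N ^+ 2) by rewrite /colB ifT.
  have X : SP <= Wm by move: gp r0; rewrite /Wm; lra.
  have eLx : \sum_(1 <= i < j) cost_left a u eta p j (wx i.-1) (wx i) + \sum_(j <= i < P.+2) cost_left a u eta p j (wx i.-1) (wx i)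
     = SP * eta j ^+ 2 + (- SD) * p j + a * SD * u j.-1 ^+ 2.
    rewrite -big_cat_nat //=; last by move: jn nP; clear; lia.
    by rewrite sum_cost_left // mass_wx wx_gt // expr0n oppr0 sub0r.
  have hL := left_row_low P g ch nN hj1.
  have [jn1|jn1] := eqVneq j n.-1.
    move: hL; rewrite jn1 eqxx addr0 -jn1 => hL.
    apply: le_trans (_ : _ <= rR j + \sum_(j <= i < P.+2) cost_left a u eta p j (wx i.-1) (wx i)) _.
      by rewrite lerD2l.
    rewrite rowR_low // addrAC eLx.
    have -> : \sum_(1 <= i < j) cost_right b u q j (wx i) (wx i.+1) =
       (g j ^+ 2 - jumps j g) * q j + b * (jumps j g - g 1%N ^+ 2) * u j.+1 ^+ 2.
      have jE : (j = j.-1.+1)%N by rewrite prednK.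
      have jP : (j <= P)%N by move: jn nP; clear; lia.
      by rewrite {1}jE sum_cost_right // -jE jumps_trunc // !(wxE g0) //; move: j0 jP; clear; lia.
    have Jj : jumps j g <= SD by apply: jumps_le; exact: ltnW.
    have Jj0 := jumps_ge0 j g.
    rewrite cA cB -jn1 in gp *.
    apply: row_bound => //; rewrite -?jn1; try (by move: SD0 gp Jj Jj0; lra).
    by apply: ler_wpM2l => //; rewrite lerD2r.
  move: hL; rewrite (negbTE jn1) => hL.
  apply: le_trans (_ : _ <= rR j + (\sum_(j <= i < P.+2) cost_left a u eta p j (wx i.-1) (wx i) + \sum_(j <= i < P.+2) cost_right b u q j (wx i) (wx i.+1))) _.
    by rewrite lerD2l.
  rewrite rowR_low // addrACA eLx -big_cat_nat //=; last by move: jn nP; clear; lia.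
  rewrite sum_cost_right // jumps_wx2 wx_gt // expr0n sub0r (wxE g0); last by move: nP n3; clear; lia.
  rewrite cA cB.
  by apply: row_bound => //; move: SD0 gp; lra.
have [jE|jn'] := eqVneq j n.
  subst j; have cA : colA n.-1 = a * SD by rewrite /colA leq_pred.
  have cB : colB n.+1 = b * (Jn - g 1%N ^+ 2) + 4/3 * b ^+ 2 * rho by rewrite /colB ltnn eqxx.
  have hL := left_row_edge ch n3 nN nP g0.
  have hnn : (1 <= n <= n)%N by rewrite leqnn andbT; move: n3; clear; lia.
  have nE : (n = n.-1.+1)%N by rewrite prednK //; move: n3; clear; lia.
  have e1 : rR n = mass n.-1 g * eta n ^+ 2 + (- g n.-1 ^+ 2 - jumps n.-1 g) * p n + a * jumps n.-1 g * u n.-1 ^+ 2 +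
     ((g n ^+ 2 - jumps n g) * q n + b * (jumps n g - g 1%N ^+ 2) * u n.+1 ^+ 2).
    have K F : \sum_(1 <= i < n) F i = \sum_(1 <= i < n.-1.+1) F i :> R by rewrite -nE.
    rewrite rowR_low // !K sum_cost_left // sum_cost_right // -nE !jumps_trunc //; last by rewrite (leq_trans (leq_pred _)).
    rewrite !(wxE g0) ?(leq_trans (leq_pred _)) //; last by move: nP n3; clear; lia.
    congr (_ * _ + _ + _ + _); apply: eq_big_nat => i hi; rewrite (wxE g0) //.
    by move: hi nP; clear; lia.
  rewrite e1.
  have J1 : jumps n.-1 g <= SD by apply: jumps_le; exact: leq_pred.
  have J2 : jumps n g <= SD by exact: jumps_le.
  have J10 := jumps_ge0 n.-1 g; have J20 := jumps_ge0 n g.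
  have WmE : Wm = mass n.-1 g + 4 * rho by rewrite /Wm split_rho; ring.
  rewrite cA cB WmE.
  have hb : mass n.-1 g * eta n ^+ 2 + (- g n.-1 ^+ 2 - jumps n.-1 g) * p n + a * jumps n.-1 g * u n.-1 ^+ 2 +
     ((g n ^+ 2 - jumps n g) * q n + b * (jumps n g - g 1%N ^+ 2) * u n.+1 ^+ 2) <=
    mass n.-1 g * eta n ^+ 2 + D * (`|p n| + `|q n|) + (a * SD * u n.-1 ^+ 2 + b * (Jn - g 1%N ^+ 2) * u n.+1 ^+ 2).
    apply: row_bound => //; try (by move: gn SD0 gp gq J1 J2 J10 J20; lra).
    by apply: ler_wpM2l.
  by move: hL hb; exact: edge_assemble.
have {jn'}jn' : (n < j)%N by rewrite ltn_neqAle eq_sym jn' jn.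
have cA : a * Jn <= colA j.-1.
  by rewrite /colA; case: ifP => _ //; apply: ler_wpM2l => //; exact: jumps_le.
have e0 : rL j = 0 by rewrite /rowL big1 // => k _; rewrite ifN // -ltnNge.
have cB : colB j.+1 = b * (Jn + g n ^+ 2 - g 1%N ^+ 2).
  by rewrite /colB !ifF //; move: jn'; clear; lia.
rewrite e0 addr0 rowR_high // sum_cost_left // sum_cost_right // cB.
have w1 : wt n.+1 = 0 by apply: wt_gt.
have w2 : wt n = g n by apply: wtE.
have w3 : wt 1%N = g 1%N by apply: wtE.
rewrite mass_wt // w1 w2 w3 jumps_trunc // jumps_truncS // expr0n sub0r.
have J2 : jumps n g <= SD by exact: jumps_le.
have J20 := jumps_ge0 n g.
have X : W <= Wm by apply: le_trans W_le_SP _; move: gp r0; rewrite /Wm; lra.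
by apply: row_bound => //; move: gn SD0 gp gq J2 J20; lra.
Qed.
End RowTotals.

Lemma cross_amgm (R : realFieldType) (a b dl e u1 u2 : R) : 0 <= a -> 0 <= b -> a + b = 1 -> 0 < dl ->
  dl * 2 * (e * (a * u1) + e * (b * u2)) <= e ^+ 2 + dl ^+ 2 * (a * u1 ^+ 2 + b * u2 ^+ 2).
Proof.
move=> a0 b0 ab d0; have := mulr_ge0 a0 (sqr_ge0 (e - dl * u1)); have := mulr_ge0 b0 (sqr_ge0 (e - dl * u2)).
have -> : a = 1 - b by lra.
lra.
Qed.

(** For nu > dl + la the averaged inequality would give a quadratic relation in dl that contradicts the
    mass budget [D + dl * (Wm - W) <= 2 * la * W]. *)
Lemma taper_close (R : realFieldType) (nu dl la Wm W D rho VU U : R) :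
  0 <= nu -> 0 < dl -> 0 < la -> 0 < U -> 0 < W -> W * U <= VU ->
  D + dl * (Wm - W) <= 2 * la * W ->
  nu ^+ 2 * VU <= (Wm * dl ^+ 2 + D * dl) * U + la ^+ 2 * VU -> nu <= dl + la.
Proof.
move=> nu0 d0 l0 U0 W0 WV F2 H.
rewrite leNgt; apply/negP => hlt.
have m0 : 0 <= dl + la by rewrite addr_ge0 // ltW.
have e1 : (dl + la) ^+ 2 < nu ^+ 2 by have := ltr_pM m0 m0 hlt hlt; rewrite -!expr2.
have WU : 0 < W * U by rewrite mulr_gt0.
have VU0 : 0 < VU by apply: lt_le_trans WV.
have e2 : ((dl + la) ^+ 2 - la ^+ 2) * VU < (nu ^+ 2 - la ^+ 2) * VU by rewrite ltr_pM2r // ltrD2r.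
have e3 : 0 <= (dl + la) ^+ 2 - la ^+ 2.
  have := mulr_gt0 d0 l0; have := sqr_ge0 dl; clear; lra.
have e4 := ler_wpM2l e3 WV.
have e5 := ler_wpM2r (ltW U0) (ler_wpM2l (ltW d0) F2).
move: e2 e4 e5 H; clear; lra.
Qed.

Section ColumnTotals.
Variable R : realFieldType.
Variables (N n P : nat) (a b dl nu la : R) (u eta p q g : nat -> R) (E : (nat -> R) -> nat -> R).
Hypothesis ch : chain N n a b dl nu u eta p q E.
Hypotheses (a0 : 0 <= a) (b0 : 0 <= b) (ab : a + b = 1) (n3 : (2 < n)%N) (nN : (n <= N)%N) (nP : (n <= P)%N).
Hypotheses (g0 : g 0%N = 0).

Local Notation wx := (trunc P g).
Local Notation wt := (trunc n g).
Local Notation rho := (tail_mass n P g).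
Local Notation SD := (jumps P.+1 wx).
Local Notation SP := (mass P g).
Local Notation W := (mass n g).
Local Notation Jn := (jumps n g).
Local Notation D := (g n.-1 ^+ 2 + SD).
Local Notation U := (mass N u).
Local Notation cA := (colA n P a g).
Local Notation cB := (colB n P b g).

Hypothesis gn : g n ^+ 2 <= g n.-1 ^+ 2.

(** The total squared weight with which position c is covered. *)
Definition colV c : R := if (c <= n)%N then SP else W.
Definition VU := \sum_(1 <= j < N.+1) colV j * u j ^+ 2.

Lemma W_le_V : W * U <= VU.
Proof.
rewrite /mass mulr_sumr; apply: ler_sum_nat => j _; apply: ler_wpM2r; first exact: sqr_ge0.
by rewrite /colV; case: ifP => // _; exact: W_le_SP.
Qed.

(** Positions up to n are covered by the extended weights, those beyond n only by the weights of a window. *)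
Lemma mass_low : VU <=
  \sum_(0 <= k < P.+1) (\sum_(1 <= j < N.+1) tapered n P g k j ^+ 2 * u j ^+ 2) +
  \sum_(n.+1 <= s < N + n) (\sum_(1 <= j < N.+1) wt (j + n - s)%N ^+ 2 * u j ^+ 2).
Proof.
have w0 : wt 0%N = 0 by [].
have wn i : (n < i)%N -> wt i = 0 by move=> h; apply: wt_gt.
under [X in _ + X]eq_bigr do rewrite (sum_win_supp N _ _ w0 wn).
rewrite (sum_shift_right n N (fun i j => wt i ^+ 2 * u j ^+ 2)).
rewrite exchange_big /= -big_split /=; apply: ler_sum_nat => j hj.
rewrite -!mulr_suml -mulrDl; apply: ler_wpM2r; first exact: sqr_ge0.
rewrite /colV; case: leqP => jn; last first.
  rewrite (_ : \sum_(1 <= i < n.+1 | (i < j)%N) wt i ^+ 2 = W).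
    by rewrite lerDr sumr_ge0 // => k _; exact: sqr_ge0.
  rewrite big_nat_cond [RHS]big_nat_cond; apply: eq_big => [i|i hi]; first by move: jn; clear; lia.
  by rewrite (wtE g0) //; move: hi; clear; lia.
have j0 : (0 < j)%N by case/andP: hj.
have e1 : \sum_(1 <= i < n.+1 | (i < j)%N) wt i ^+ 2 = \sum_(1 <= i < j) g i ^+ 2.
  rewrite [RHS](@big_nat_widen _ _ _ 1 _ n.+1); last by move: jn; clear; lia.
  rewrite [LHS]big_nat_cond [RHS]big_nat_cond; apply: eq_big => [i|i hi]; first by rewrite andTb.
  by rewrite (wtE g0) //; move: hi; clear; lia.
rewrite e1.
have e2 : \sum_(j <= i < P.+1) g i ^+ 2 <= \sum_(0 <= k < P.+1) tapered n P g k j ^+ 2.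
  have -> : \sum_(j <= i < P.+1) g i ^+ 2 = \sum_(0 <= k < P.+1) wx (j + k)%N ^+ 2.
    rewrite (@sum_diag _ P j (fun i => wx i ^+ 2)) //; last first.
      by move=> i hi; rewrite wx_gt ?expr0n //; apply: ltnW.
    rewrite [RHS]big_nat_recr /=; last by move: jn nP; clear; lia.
    rewrite wx_gt // expr0n addr0; apply: eq_big_nat => i hi; rewrite (wxE g0) //.
    by move: hi; clear; lia.
  have [jlt|jge] := ltnP j n.
    apply: ler_sum_nat => k _; rewrite /tapered jn.
    by rewrite (_ : minn j n.-1 = j) //; move: jlt; clear; lia.
  have jE : j = n by apply/eqP; rewrite eqn_leq jn jge.
  subst j; have -> : \sum_(0 <= k < P.+1) tapered n P g k n ^+ 2 = rho.
    transitivity (\sum_(0 <= k < P.+1) wx (n.-1 + k)%N ^+ 2).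
      by apply: eq_bigr => k _; rewrite /tapered leqnn; congr (wx _ ^+ 2); clear; lia.
    rewrite (@sum_diag _ P n.-1 (fun i => wx i ^+ 2)); last 2 first.
    - by move: n3; clear; lia.
    - by move=> i hi; rewrite wx_gt ?expr0n //; apply: ltnW.
    rewrite big_nat_recr /=; last by move: nP; clear; lia.
    rewrite wx_gt // expr0n addr0; apply: eq_big_nat => i hi; rewrite (wxE g0) //.
    by move: hi; clear; lia.
  rewrite (@sum_diag _ P n (fun i => wx i ^+ 2) j0); last by move=> i hi; rewrite wx_gt ?expr0n //; apply: ltnW.
  rewrite [leLHS]big_nat_recr /=; last by move: nP; clear; lia.
  rewrite wx_gt // expr0n addr0 /tail_mass [leRHS]big_ltn; last by move: nP n3; clear; lia.
  rewrite prednK // -[leLHS]add0r; apply: lerD; first exact: sqr_ge0.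
  apply: le_of_eq; apply: eq_big_nat => i hi; rewrite (wxE g0) //.
  by move: hi; clear; lia.
apply: le_trans (_ : \sum_(1 <= i < j) g i ^+ 2 + \sum_(j <= i < P.+1) g i ^+ 2 <= _).
  by rewrite -big_cat_nat //=; move: jn nP; clear; lia.
by rewrite addrC lerD2r.
Qed.

Hypotheses (d0 : 0 < dl) (l0 : 0 < la).
Hypothesis hSD : SD <= la ^+ 2 * SP.
Hypothesis hF2 : g n.-1 ^+ 2 + la ^+ 2 * SP + 4 * dl * rho <= 2 * la * W.
Hypothesis hF3 : Jn + 4/3 * b ^+ 2 * rho - a * b * g 1%N ^+ 2 <= la ^+ 2 * W.
Hypothesis hF4 : Jn + b * g n ^+ 2 - a * b * g 1%N ^+ 2 <= la ^+ 2 * W.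
Hypotheses (U0 : 0 < U) (W0 : 0 < W) (nu0 : 0 <= nu).

Lemma colA_ge0 c : 0 <= cA c.
Proof. by rewrite /colA; case: ifP => _; rewrite mulr_ge0 ?jumps_ge0. Qed.

Lemma colB_ge0 c : 0 <= cB c.
Proof.
have k1 : g 1%N ^+ 2 <= SD.
  rewrite -jumps_wx2; have e : wx 1%N = g 1%N by apply: (wxE g0); move: n3 nP; clear; lia.
  by rewrite -e; apply: g1_jumps.
have k2 : g 1%N ^+ 2 <= Jn by apply: g1_jumps => //; move: n3; clear; lia.
rewrite /colB; case: ifP => _; first by rewrite mulr_ge0 // subr_ge0.
case: ifP => _.
  apply: addr_ge0; first by rewrite mulr_ge0 // subr_ge0.
  by apply: mulr_ge0; [apply: mulr_ge0; [exact: divr_ge0 | exact: sqr_ge0] | exact: rho_ge0].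
by rewrite mulr_ge0 // subr_ge0; apply: le_trans k2 _; rewrite lerDl sqr_ge0.
Qed.

(** Each of the three kinds of columns is covered by one of the jump budgets; the term b^2 (g 1)^2 is the
    price of the zero padding on the right. *)
Lemma col_total c : cA c + (cB c + b ^+ 2 * g 1%N ^+ 2) <= la ^+ 2 * colV c.
Proof.
have aE : a = 1 - b by rewrite -ab addrK.
have bg : b ^+ 2 * g 1%N ^+ 2 = b * g 1%N ^+ 2 - a * b * g 1%N ^+ 2 by rewrite aE; ring.
have abg : 0 <= a * b * g 1%N ^+ 2 by rewrite mulr_ge0 ?sqr_ge0 ?mulr_ge0.
rewrite /colA /colB /colV bg; case: ifP => _.
  apply: le_trans hSD; rewrite [X in X * SD]aE.
  have -> : (1 - b) * SD + (b * (SD - g 1%N ^+ 2) + (b * g 1%N ^+ 2 - a * b * g 1%N ^+ 2)) = SD - a * b * g 1%N ^+ 2 by ring.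
  by rewrite gerBl.
case: ifP => _.
  apply: le_trans hF3; rewrite [X in X * Jn]aE; apply: le_of_eq.
  by ring.
apply: le_trans hF4; rewrite [X in X * Jn]aE; apply: le_of_eq.
by ring.
Qed.

(** The cross terms are controlled by the residuals through the inequality of arithmetic and geometric
    means, with ratio dl between residual and neighbour. *)
Lemma cross_total : \sum_(1 <= j < N.+1) (`|p j| + `|q j|) <= dl * U.
Proof.
have d2 : 0 < dl * 2 by rewrite mulr_gt0.
rewrite -(ler_pM2l d2) mulr_sumr.
apply: le_trans (_ : \sum_(1 <= j < N.+1) (eta j ^+ 2 + dl ^+ 2 * (a * u j.-1 ^+ 2 + b * u j.+1 ^+ 2)) <= _).
  apply: ler_sum_nat => j hj; apply: le_trans (cross_amgm _ _ _ a0 b0 ab d0).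
  by apply: ler_wpM2l; [exact: ltW | apply: lerD; [exact: (ch_p ch) | exact: (ch_q ch)]].
rewrite big_split /= -mulr_sumr big_split /= -!mulr_sumr.
have e1 := ch_res ch.
have e2 := ler_wpM2l a0 (sum_pred_le N (ch_u0 ch)).
have e3 := ler_wpM2l b0 (sum_succ_le (ch_uN ch)).
have e4 := ler_wpM2l (sqr_ge0 dl) (lerD e2 e3).
have -> : dl * 2 * (dl * U) = dl ^+ 2 * U + dl ^+ 2 * (a * U + b * U).
  by rewrite -mulrDl ab; ring.
by apply: lerD.
Qed.

(** The bound from tapered windows, for any weights g that satisfy four budgets: the jumps of the
    extended weights, the mass, and the jumps in the column next to the cut and in the columns further right. *)
Lemma taper_windows : nu <= dl + la.
Proof.
have r0 : 0 <= rho by apply: rho_ge0.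
apply: (@taper_close R nu dl la (Wm n P g) W D rho VU U) => //; first exact: W_le_V.
  have e : Wm n P g - W <= 4 * rho.
    rewrite /Wm; have := split_rho g n3 nP.
    have : mass n.-1 g <= W by apply: mass_mono; exact: leq_pred.
    by lra.
  apply: le_trans hF2; apply: lerD; first by rewrite lerD2l.
  by rewrite -mulrA mulrCA; apply: ler_wpM2l => //; exact: ltW.
apply: le_trans (ler_wpM2l (sqr_ge0 nu) mass_low) _.
rewrite mulrDr !mulr_sumr.
apply: le_trans (_ : \sum_(1 <= j < N.+1) (rowR n a b u eta p q g j + rowL n P g E j) + \sum_(2 <= j < N.+1) b ^+ 2 * g 1%N ^+ 2 * u j ^+ 2 <= _).
  rewrite big_split /= [X in _ <= X + _]addrC -addrA; apply: lerD.
    apply: le_trans (ler_sum_nat (fun k _ => left_window P g ch nN k)) _.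
    rewrite /rowL [X in _ <= X]exchange_big /=; apply: le_of_eq.
    apply: eq_bigr => k _; rewrite -big_mkcond /=.
    rewrite [LHS](@big_nat_widen _ _ _ 1 _ N.+1) //.
  apply: le_trans (ler_sum_nat (fun s hs => right_window ch n3 nN g0 hs)) _.
  rewrite big_split /=; apply: lerD; first exact: (right_total g ch).
  exact: (pad_total b u g n3 nN).
have RT := @ler_sum_nat _ 1 N.+1 _ _ (fun j hj => row_total ch a0 b0 n3 nN nP g0 gn hj).
apply: (le_trans (lerD RT (lexx _))) => {RT}.
rewrite !big_split /= -[leLHS]addrA; apply: lerD.
  rewrite -!mulr_sumr.
  rewrite [leRHS]mulrDl; apply: lerD.
    have Wm0 : 0 <= Wm n P g by rewrite /Wm !addr_ge0 ?sqr_ge0 ?mass_ge0 // mulr_ge0.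
    by apply: le_trans (ler_wpM2l Wm0 (ch_res ch)) _; rewrite mulrA.
  have D0 : 0 <= D by rewrite addr_ge0 ?sqr_ge0 ?jumps_ge0.
  by rewrite -[leRHS]mulrA; apply: ler_wpM2l => //; exact: cross_total.
rewrite -[leLHS]addrA; apply: le_trans (_ : \sum_(1 <= j < N.+1) cA j * u j ^+ 2 + \sum_(1 <= j < N.+1) (cB j + b ^+ 2 * g 1%N ^+ 2) * u j ^+ 2 <= _).
  apply: lerD.
    apply: (@sum_predw_le _ N (fun j => cA j * u j ^+ 2)); first by rewrite (ch_u0 ch) expr0n mulr0.
    by move=> j; rewrite mulr_ge0 ?colA_ge0 ?sqr_ge0.
  apply: le_trans (lerD (@sum_succw_le _ N (fun j => cB j * u j ^+ 2) _ _) (lexx _)) _.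
  - by rewrite (ch_uN ch) expr0n mulr0.
  - by move=> j; rewrite mulr_ge0 ?colB_ge0 ?sqr_ge0.
  rewrite -big_split /= [leRHS]big_ltn; last by move: nN n3; clear; lia.
  rewrite -[leLHS]add0r; apply: lerD.
    by rewrite mulr_ge0 ?sqr_ge0 // addr_ge0 ?colB_ge0 // mulr_ge0 ?sqr_ge0.
  by apply: ler_sum_nat => j _; rewrite mulrDl.
rewrite -[leLHS]big_split /=; apply: ler_sum_nat => j _.
by rewrite -mulrDl mulrA; apply: ler_wpM2r; [exact: sqr_ge0 | exact: col_total].
Qed.
End ColumnTotals.

(** * Mirror images *)

Section Mirror.
Variable R : realFieldType.

Definition flip (N : nat) (v : nat -> R) j := v (N.+1 - j)%N.

Lemma sum_flip (N : nat) (P : pred nat) (F : nat -> R) :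
  \sum_(1 <= j < N.+1 | P j) F j = \sum_(1 <= j < N.+1 | P (N.+1 - j)%N) F (N.+1 - j)%N.
Proof. by rewrite big_nat_rev /=; apply: congr_big_nat => // i _; rewrite add1n subSS. Qed.

(** Reversing the order of the blocks exchanges the two off-diagonals and the two ends. It will allow the
    assumption b <= 1/2. *)
Lemma chain_flip (N n : nat) (a b dl nu : R) (u eta p q : nat -> R) E : (0 < n)%N -> (n <= N)%N ->
  chain N n a b dl nu u eta p q E ->
  chain N n b a dl nu (flip N u) (flip N eta) (flip N q) (flip N p)
    (fun v j => E (flip N v) (N.+1 - j)%N).
Proof.
move=> n0 nN ch.
have rj j : (1 <= j <= N)%N -> (1 <= N.+1 - j <= N)%N by clear; lia.
have rp j : (1 <= j <= N)%N -> (N.+1 - j.-1 = (N.+1 - j).+1)%N by clear; lia.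
have rs j : (1 <= j <= N)%N -> (N.+1 - j.+1 = (N.+1 - j).-1)%N by clear; lia.
have rr j : (1 <= j <= N)%N -> (N.+1 - (N.+1 - j) = j)%N by clear; lia.
have rrp j : (1 <= j <= N)%N -> (N.+1 - (N.+1 - j).-1 = j.+1)%N by clear; lia.
have rrs j : (1 <= j <= N)%N -> (N.+1 - (N.+1 - j).+1 = j.-1)%N by clear; lia.
have rw s j : (1 <= s < N + n)%N -> (1 <= j <= N)%N -> inwin n (N + n - s) (N.+1 - j) = inwin n s j.
  by move=> h1 h2; rewrite /inwin; apply/idP/idP; move: h1 h2; clear; lia.
have supp s v : (1 <= s < N + n)%N -> (forall j, (1 <= j <= N)%N -> ~~ inwin n s j -> v j = 0) ->
    (forall j, (1 <= j <= N)%N -> ~~ inwin n (N + n - s) j -> flip N v j = 0).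
  move=> hs hv j hj hj'; rewrite /flip; apply: hv; first exact: rj.
  by rewrite -(rw s) ?rr // rj.
have sums s (F : nat -> R) : (1 <= s < N + n)%N ->
   \sum_(1 <= j < N.+1 | inwin n (N + n - s) j) F j = \sum_(1 <= j < N.+1 | inwin n s j) F (N.+1 - j)%N.
  move=> hs; rewrite sum_flip; apply: congr_big_nat => // j hj.
  by rewrite rw.
have massE v : \sum_(1 <= j < N.+1) v j ^+ 2 * flip N u j ^+ 2 = \sum_(1 <= j < N.+1) flip N v j ^+ 2 * u j ^+ 2.
  rewrite [RHS](sum_flip N predT); apply: eq_big_nat => j hj; rewrite /flip rr //.
split.
- by rewrite /flip subn0 (ch_uN ch).
- by rewrite /flip subnn (ch_u0 ch).
- by move=> j; apply: (ch_u ch).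
- by move=> j; apply: (ch_eta ch).
- by move=> j hj; rewrite /flip rp //; apply: (ch_q ch); exact: rj.
- by move=> j hj; rewrite /flip rs //; apply: (ch_p ch); exact: rj.
- by move=> v j; apply: (ch_E0 ch).
- move=> v j hj; apply: le_trans (ch_E1 ch _ (rj _ hj)) _.
  rewrite /flip rr // rrp // rrs // rp // rs //.
  by rewrite addrAC.
- move=> v j hj; apply: le_trans (ch_E2 ch _ (rj _ hj)) _.
  rewrite /flip rr // rrp // rrs // rp // rs //.
  by apply: le_of_eq; ring.
- rewrite /mass -(sum_flip N predT (fun j => eta j ^+ 2)) -(sum_flip N predT (fun j => u j ^+ 2)).
  exact: (ch_res ch).
- move=> s v hs hv; have hs1 : (1 <= s < N + n)%N by move: hs n0; clear; lia.
  rewrite massE; apply: le_trans (ch_win ch (_ : (n <= N + n - s <= N)%N) (supp s v hs1 hv)) _.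
    by move: hs; clear; lia.
  by rewrite sums.
- move=> s v hs hv hb; have hs1 : (1 <= s < N + n)%N by move: hs n0 nN; clear; lia.
  rewrite massE; apply: le_trans (ch_right ch (_ : (N < N + n - s < N + n)%N) (supp s v hs1 hv) hb) _.
    by move: hs; clear; lia.
  by rewrite sums // (_ : (N + n - s - n).+1 = N.+1 - s)%N //; move: hs nN; clear; lia.
- move=> s v hs hv hb; have hs1 : (1 <= s < N + n)%N by move: hs n0 nN; clear; lia.
  rewrite massE; apply: le_trans (ch_left ch (_ : (1 <= N + n - s < n)%N) (supp s v hs1 hv) hb) _.
    by move: hs; clear; lia.
  by rewrite sums // (_ : (N.+1 - (s - n).+1 = N + n - s)%N) //; move: hs nN; clear; lia.
Qed.
End Mirror.

(** * Polynomial inequalities at the edge of a window *)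

Section Corners.
Variable R : realFieldType.
Implicit Types b m K : R.

(** In the variable s = b1 - b the inequalities at the corners become combinations of powers of s whose signs
    are apparent for 0 <= s <= b1. *)
Lemma le_shift (b1 : R) (Q : R -> Prop) :
  (forall s, 0 <= s -> s <= b1 -> 0 <= s ^+ 2 -> 0 <= s ^+ 3 -> 0 <= s ^+ 4 -> 0 <= s ^+ 5 ->
     s ^+ 4 <= b1 * s ^+ 3 -> s ^+ 6 <= b1 * s ^+ 5 -> Q (b1 - s)) ->
  forall b, 0 <= b -> b <= b1 -> Q b.
Proof.
move=> h b b0 bb; rewrite -[b](subKr b1); have s0 : 0 <= b1 - b by rewrite subr_ge0.
have sb : b1 - b <= b1 by rewrite gerBl.
apply: h => //; try exact: exprn_ge0.
- by rewrite [leLHS]exprS; apply: ler_wpM2r => //; exact: exprn_ge0.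
- by rewrite [leLHS]exprS; apply: ler_wpM2r => //; exact: exprn_ge0.
Qed.

Definition dual_ineq b m K :=
  (3 * (1 - b * (1 - b) * m) + (1 - b) ^+ 2) ^+ 2 <=
  12 * (1 - b * (1 - b) * m) * (1 - b) * (2 - 3 * b) * K.

Lemma dual_corners b : 0 <= b ->
  [/\ b <= 2/5 -> dual_ineq b 3 (948/1000) /\ dual_ineq b (292/100) (948/1000),
      b <= 371/1000 -> dual_ineq b (292/100) (896/1000) /\ dual_ineq b (284/100) (896/1000)
    & b <= 356/1000 -> dual_ineq b (284/100) (94/100) /\ dual_ineq b (2732/1000) (94/100)].
Proof.
move=> b0; split=> bb; split; move: b b0 bb; apply: le_shift => s *; rewrite /dual_ineq; lra.
Qed.

(** The right side is affine in m and the left side a square, so the difference is concave in m and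
    it is enough to check the ends of an interval. *)
Lemma dual_ineq_between b K m0 m1 m : 0 <= b -> b <= 1 -> m1 <= m -> m <= m0 ->
  dual_ineq b m0 K -> dual_ineq b m1 K -> dual_ineq b m K.
Proof.
move=> b0 b1 h1 h0; rewrite /dual_ineq => e0 e1.
have [e|hlt] : m1 = m0 \/ m1 < m0 by case: (ltrgtP m1 m0) => ?; [right|lra|left].
  by have -> : m = m1 by lra.
have d0 : 0 < m0 - m1 by rewrite subr_gt0.
rewrite -(ler_pM2l d0).
have f0 := ler_wpM2l (ltac:(lra) : 0 <= m - m1) e0.
have f1 := ler_wpM2l (ltac:(lra) : 0 <= m0 - m) e1.
have g0 : 0 <= (m - m1) * (m0 - m) * (m0 - m1) * (b * (1 - b)) ^+ 2.
  by apply: mulr_ge0 (sqr_ge0 _); apply: mulr_ge0 (ltW d0); apply: mulr_ge0; rewrite subr_ge0.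
by move: f0 f1 g0; clear; lra.
Qed.

Definition edge_ineq b m :=
  let p := 2 - b * (1 - b) * m in
  136/100 * p * (p ^+ 2 - (b * (1 - b)) ^+ 2) <= 6 * (1 - b) ^+ 2 * (p ^+ 2 - 5 * (b * (1 - b)) ^+ 2).

Lemma edge_corners b : 0 <= b ->
  [/\ b <= 2/5 -> edge_ineq b 3 /\ edge_ineq b (292/100),
      b <= 371/1000 -> edge_ineq b (292/100) /\ edge_ineq b (284/100)
    & b <= 356/1000 -> edge_ineq b (284/100) /\ edge_ineq b (2732/1000)].
Proof.
move=> b0; split=> bb; split; move: b b0 bb; apply: le_shift => s *; rewrite /edge_ineq; lra.
Qed.

(** The condition on A makes the difference of the two sides concave in p between p0 and p1. *)
Lemma cubic_between (A K q p0 p1 p : R) : p0 <= p -> p <= p1 -> A <= 3 * K * p0 -> 0 <= K ->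
  K * p0 * (p0 ^+ 2 - q ^+ 2) <= A * (p0 ^+ 2 - 5 * q ^+ 2) ->
  K * p1 * (p1 ^+ 2 - q ^+ 2) <= A * (p1 ^+ 2 - 5 * q ^+ 2) ->
  K * p * (p ^+ 2 - q ^+ 2) <= A * (p ^+ 2 - 5 * q ^+ 2).
Proof.
move=> h0 h1 hA K0 e0 e1.
have [e|hlt] : p0 = p1 \/ p0 < p1 by case: (ltrgtP p0 p1) => ?; [right|lra|left].
  by have -> : p = p1 by lra.
suff : (p1 - p0) * (K * p * (p ^+ 2 - q ^+ 2)) <= (p1 - p0) * (A * (p ^+ 2 - 5 * q ^+ 2)).
  by rewrite ler_pM2l; lra.
have f0 := ler_wpM2l (ltac:(lra) : 0 <= p1 - p) e0.
have f1 := ler_wpM2l (ltac:(lra) : 0 <= p - p0) e1.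
have g0 : 0 <= (p - p0) * (p1 - p) * (p1 - p0) by rewrite !mulr_ge0; lra.
have g1 : 0 <= K * (p + p0 + p1) - A.
  have : K * (3 * p0) <= K * (p + p0 + p1) by rewrite ler_wpM2l //; lra.
  lra.
have := mulr_ge0 g0 g1.
move: f0 f1; clear; lra.
Qed.

Lemma edge_ineq_between b m0 m1 m : 0 <= b -> b <= 1/2 -> m0 <= 3 -> m1 <= m -> m <= m0 ->
  edge_ineq b m0 -> edge_ineq b m1 -> edge_ineq b m.
Proof.
move=> b0 b2 m3 h1 h0 e0 e1; have q0 : 0 <= b * (1 - b) by apply: mulr_ge0; lra.
apply: (cubic_between _ _ _ _ e0 e1); rewrite ?lerD2l ?lerN2.
- exact: ler_wpM2l.
- exact: ler_wpM2l.
- have := ler_wpM2l q0 m3; nra.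
- lra.
Qed.
End Corners.

Section EdgeData.
Variable R : realFieldType.

(** The quantities at the edge of a window, freed from trigonometry. With half the angle x and the phase f
    at the edge, h = sin x, cc = cos x, S = sin f, C = cos f, h m = sin 3x, C3 = cos 3x, s1 = sin (f - 3x) and
    s2 = sin (f + 3x); [ed_rel] is the equation that determines the angle, [ed_H1] expresses 12 x <= pi, and [ed_tan]
    expresses 16 x / 3 <= f. *)
Record edge_data (h cc S C a b H m C3 s1 s2 q : R) : Prop := EdgeData {
  ed_h0 : 0 < h; ed_cc0 : 0 < cc; ed_hcc : h ^+ 2 + cc ^+ 2 = 1;
  ed_S0 : 0 < S; ed_C0 : 0 < C; ed_SC : S ^+ 2 + C ^+ 2 = 1;
  ed_a : a = 1 - b; ed_b0 : 0 < b; ed_ba : b <= 1/2;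
  ed_H : H = h ^+ 2; ed_m : m = 3 - 4 * H; ed_C3 : C3 = cc * (1 - 4 * H);
  ed_s1 : s1 = S * C3 - h * m * C; ed_s2 : s2 = S * C3 + h * m * C;
  ed_q : q = a * b; ed_rel : q * s2 = 2 * h * C;
  ed_H1 : H <= 67/1000;
  ed_tan : h * C * (16/3 + 50 * H + 550 * H ^+ 2) <= S }.


Lemma ed_H0 (h cc S C a b H m C3 s1 s2 q : R)
  (ed : edge_data h cc S C a b H m C3 s1 s2 q) : 0 < H.
Proof. by rewrite (ed_H ed) exprn_gt0 // (ed_h0 ed). Qed.

Lemma ed_hC (h cc S C a b H m C3 s1 s2 q : R)
  (ed : edge_data h cc S C a b H m C3 s1 s2 q) : 0 < h * C.
Proof. by rewrite mulr_gt0 ?(ed_h0 ed) ?(ed_C0 ed). Qed.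

Lemma ed_tan1 (h cc S C a b H m C3 s1 s2 q : R)
  (ed : edge_data h cc S C a b H m C3 s1 s2 q) : h * C * (16/3 + 50 * H) <= S.
Proof.
apply: le_trans (ed_tan ed); rewrite ler_wpM2l ?(ltW (ed_hC ed)) //.
by rewrite lerDl mulr_ge0 ?exprn_ge0 ?(ltW (ed_H0 ed)).
Qed.

Lemma cc_lb (h cc S C a b H m C3 s1 s2 q : R)
  (ed : edge_data h cc S C a b H m C3 s1 s2 q) : 1 - 52/100 * H <= cc.
Proof.
have H0 := (ed_H0 ed); case: ed => h0 c0 hcc _ _ _ _ _ _ HE _ _ _ _ _ _ H1 _.
rewrite leNgt; apply/negP => hlt.
have : cc ^+ 2 < (1 - 52/100 * H) ^+ 2.
  by rewrite ltr_pXn2r ?nnegrE ?(ltW c0) //; lra.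
have -> : cc ^+ 2 = 1 - H by rewrite HE; lra.
nra.
Qed.

Lemma C3_lb (h cc S C a b H m C3 s1 s2 q : R)
  (ed : edge_data h cc S C a b H m C3 s1 s2 q) : 1 - 452/100 * H <= C3.
Proof. by have := (cc_lb ed); rewrite (ed_C3 ed) => hc; have := (ed_H0 ed); have := ed_H1 ed; nra. Qed.

Lemma ed_q0 (h cc S C a b H m C3 s1 s2 q : R)
  (ed : edge_data h cc S C a b H m C3 s1 s2 q) : 0 < q.
Proof. by case: ed => *; subst q; rewrite mulr_gt0 //; lra. Qed.

(** A large tangent of f makes s2 large compared to h C, and then the angle equation makes q = a b small. *)
Lemma q_le_chi (h cc S C a b H m C3 s1 s2 q : R)
  (ed : edge_data h cc S C a b H m C3 s1 s2 q) : q * ((16/3 + 50 * H) * (1 - 452/100 * H) + (3 - 4 * H)) <= 2.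
Proof.
have c3 := (C3_lb ed); have q0 := (ed_q0 ed); have hC := (ed_hC ed); have tan1 := (ed_tan1 ed).
have H0 := (ed_H0 ed).
case: ed => h0 c0 hcc S0 C0 _ _ _ _ HE mE _ _ s2E _ rel H1 _.
have e : h * C * ((16/3 + 50 * H) * (1 - 452/100 * H) + (3 - 4 * H)) <= s2.
  rewrite mulrDr s2E lerD //; last by rewrite mE; lra.
  rewrite mulrA; apply: le_trans (_ : S * (1 - 452/100 * H) <= _).
    by rewrite ler_wpM2r //; lra.
  by rewrite ler_wpM2l // ltW.
have : q * (h * C * ((16/3 + 50 * H) * (1 - 452/100 * H) + (3 - 4 * H))) <= q * s2.
  by rewrite ler_wpM2l // ltW.
rewrite rel => hh.
rewrite -(ler_pM2l hC); lra.
Qed.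

Lemma b_le_box0 (h cc S C a b H m C3 s1 s2 q : R)
  (ed : edge_data h cc S C a b H m C3 s1 s2 q) : b <= 2/5.
Proof.
have qc := (q_le_chi ed); have H0 := (ed_H0 ed); have q0 := (ed_q0 ed).
case: ed => _ _ _ _ _ _ aE b0 ba _ _ _ _ _ qE _ H1 _.
have : q * (25/3) <= 2.
  by apply: le_trans qc; rewrite ler_wpM2l ?(ltW q0) //; nra.
by rewrite qE aE; nra.
Qed.

Lemma b_le_box1 (h cc S C a b H m C3 s1 s2 q : R)
  (ed : edge_data h cc S C a b H m C3 s1 s2 q) : 2/100 <= H -> b <= 371/1000.
Proof.
move=> hh; have qc := (q_le_chi ed); have q0 := (ed_q0 ed).
case: ed => _ _ _ _ _ _ aE b0 ba _ _ _ _ _ qE _ H1 _.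
have : q * (8573/1000) <= 2.
  by apply: le_trans qc; rewrite ler_wpM2l ?(ltW q0) //; nra.
by rewrite qE aE; nra.
Qed.

Lemma b_le_box2 (h cc S C a b H m C3 s1 s2 q : R)
  (ed : edge_data h cc S C a b H m C3 s1 s2 q) : 4/100 <= H -> b <= 356/1000.
Proof.
move=> hh; have qc := (q_le_chi ed); have q0 := (ed_q0 ed).
case: ed => _ _ _ _ _ _ aE b0 ba _ _ _ _ _ qE _ H1 _.
have : q * (8732/1000) <= 2.
  by apply: le_trans qc; rewrite ler_wpM2l ?(ltW q0) //; nra.
by rewrite qE aE; nra.
Qed.

End EdgeData.

Section DualCore.
Variable R : realFieldType.


Lemma q_s1E (h cc S C a b H m C3 s1 s2 q : R)
  (ed : edge_data h cc S C a b H m C3 s1 s2 q) : q * s1 = 2 * h * C * (1 - q * m).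
Proof.
case: ed => _ _ _ _ _ _ _ _ _ _ _ _ s1E s2E _ rel _ _.
have -> : s1 = s2 - 2 * (h * m * C) by rewrite s1E s2E; ring.
by rewrite mulrBr rel; ring.
Qed.

(** Once tan f >= T >= 1, the product sin f cos f is at most T / (1 + T^2), and [ed_tan] makes tan f grow
    with h. *)
Lemma SC_bounds (h cc S C a b H m C3 s1 s2 q : R)
  (ed : edge_data h cc S C a b H m C3 s1 s2 q) :
  [/\ S * C <= 1/2, 4/100 <= H -> S * C <= 466/1000 & 5/100 <= H -> S * C <= 432/1000].
Proof.
have tan1 := ed_tan1 ed.
have [h0 S0 C0 SC HE] : [/\ 0 < h, 0 < S, 0 < C, S ^+ 2 + C ^+ 2 = 1 & H = h ^+ 2] by case: ed.
have bnd (k T : R) : 0 <= k -> k ^+ 2 <= H -> 1 <= T -> T = k * (16/3 + 50 * k ^+ 2) ->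
    S * C * (1 + T ^+ 2) <= T.
  move=> k0 kH T1 TE.
  have kh : k <= h by rewrite -(@ler_pXn2r _ 2) ?nnegrE ?(ltW h0) // -HE.
  have hT : T * C <= S.
    apply: le_trans tan1; rewrite TE [_ * C]mulrC [h * C]mulrC -mulrA ler_wpM2l ?(ltW C0) //.
    by have k2 := sqr_ge0 k; apply: ler_pM; [| move: k2; clear; lra | | move: kH; clear; lra].
  have e1 : 0 <= S - T * C by rewrite subr_ge0.
  have e2 : 0 <= T * S - C by have := ler_wpM2r (ltW C0) T1; have := ler_wpM2r (ltW S0) T1; move: hT; clear; lra.
  have e3 : T * S ^+ 2 + T * C ^+ 2 = T by rewrite -mulrDr SC mulr1.
  by have := mulr_ge0 e1 e2; move: e3; clear; nra.
split=> [|h4|h5].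
- by have := sqr_ge0 (S - C); move: SC; clear; lra.
- have k : (2/10) ^+ 2 <= H by move: h4; clear; lra.
  by have := bnd (2/10) (22/15) ltac:(clear; lra) k ltac:(clear; lra) ltac:(clear; lra); clear; lra.
have k : (223/1000) ^+ 2 <= H by move: h5; clear; lra.
by have := bnd (223/1000) (223/1000 * (16/3 + 50 * (223/1000) ^+ 2)) ltac:(clear; lra) k ltac:(clear; lra) erefl; clear; nra.
Qed.

(** Multiplied by q^2 and simplified by the angle equation, the claim no longer contains s1 and s2. What
    remains is the bound on sin f cos f and the polynomial inequality [dual_ineq], on three boxes for (b, m): the more
    H grows, the smaller b has to be. *)
Lemma dual_core (h cc S C a b H m C3 s1 s2 q : R)
  (ed : edge_data h cc S C a b H m C3 s1 s2 q) :
  S * C * (3 * s1 + a ^+ 2 * s2) ^+ 2 <= 6 * a * s1 * s2 * (cc * (1 - 2 * H) * (2 - 3 * b)).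
Proof.
have q0 := ed_q0 ed; have hC := ed_hC ed; have H0 := ed_H0 ed; have hcl := cc_lb ed.
have qs1 := (q_s1E ed); have [sc0 sc1 sc2] := SC_bounds ed.
have bx0 := b_le_box0 ed; have bx1 := b_le_box1 ed; have bx2 := b_le_box2 ed.
case: ed => h0 c0 hcc S0 C0 SC aE b0 ba HE mE _ _ _ qE rel H1 _.
set p := 1 - q * m in qs1.
have p0 : 0 < p.
  have q4 : q <= 1/4 by rewrite qE aE; have := sqr_ge0 (b - 1/2); clear; nra.
  by rewrite /p mE; move: (mulr_gt0 q0 H0) q4; clear; nra.
have SC0 : 0 < S * C by rewrite mulr_gt0.
suff core : S * C * (3 * p + a ^+ 2) ^+ 2 <= 6 * a * p * (cc * (1 - 2 * H) * (2 - 3 * b)).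
  rewrite -(@ler_pM2l _ (q ^+ 2)) ?exprn_gt0 //.
  have -> : q ^+ 2 * (S * C * (3 * s1 + a ^+ 2 * s2) ^+ 2) =
     S * C * (3 * (q * s1) + a ^+ 2 * (q * s2)) ^+ 2 by ring.
  have -> : q ^+ 2 * (6 * a * s1 * s2 * (cc * (1 - 2 * H) * (2 - 3 * b))) =
     6 * a * (q * s1) * (q * s2) * (cc * (1 - 2 * H) * (2 - 3 * b)) by ring.
  rewrite qs1 rel.
  have -> : S * C * (3 * (2 * h * C * p) + a ^+ 2 * (2 * h * C)) ^+ 2 =
     (2 * (h * C)) ^+ 2 * (S * C * (3 * p + a ^+ 2) ^+ 2) by ring.
  have -> : 6 * a * (2 * h * C * p) * (2 * h * C) * (cc * (1 - 2 * H) * (2 - 3 * b)) =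
     (2 * (h * C)) ^+ 2 * (6 * a * p * (cc * (1 - 2 * H) * (2 - 3 * b))) by ring.
  by rewrite ler_wpM2l // sqr_ge0.
have ca : 0 <= a by move: aE ba; clear; lra.
have fin K k : 0 <= K -> S * C <= k -> 2 * k * K <= cc * (1 - 2 * H) -> 
    (3 * p + a ^+ 2) ^+ 2 <= 12 * p * a * (2 - 3 * b) * K ->
    S * C * (3 * p + a ^+ 2) ^+ 2 <= 6 * a * p * (cc * (1 - 2 * H) * (2 - 3 * b)).
  move=> K0 hk hK hp.
  apply: le_trans (_ : k * (12 * p * a * (2 - 3 * b) * K) <= _).
    by rewrite ler_pM // ?sqr_ge0 // ltW.
  have -> : k * (12 * p * a * (2 - 3 * b) * K) = (6 * a * p * (2 - 3 * b)) * (2 * k * K) by ring.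
  have -> : 6 * a * p * (cc * (1 - 2 * H) * (2 - 3 * b)) = (6 * a * p * (2 - 3 * b)) * (cc * (1 - 2 * H)) by ring.
  by rewrite ler_wpM2l // !mulr_ge0 ?(ltW p0) //; move: bx0; clear; lra.
have [c0' c1 c2] := dual_corners (ltW b0); have b1' : b <= 1 by move: ba; clear; lra.
have box m0 m1 K k : 0 <= K -> S * C <= k -> 2 * k * K <= cc * (1 - 2 * H) -> m1 <= m -> m <= m0 ->
    dual_ineq b m0 K /\ dual_ineq b m1 K ->
    S * C * (3 * p + a ^+ 2) ^+ 2 <= 6 * a * p * (cc * (1 - 2 * H) * (2 - 3 * b)).
  move=> K0 hk hK l1 l0 [k0 k1]; apply: (fin K k K0 hk hK).
  have := dual_ineq_between (ltW b0) b1' l1 l0 k0 k1.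
  by rewrite /dual_ineq /p qE aE [b * (1 - b)]mulrC.
have [h2|/ltW h2] := lerP H (2/100).
  apply: (box _ _ _ _ _ sc0 _ _ _ (c0' bx0)); rewrite ?mE; [clear; lra | move: hcl H0 h2; clear; nra | move: h2; clear; lra | move: H0; clear; lra].
have [h4|/ltW h4] := lerP H (4/100).
  apply: (box _ _ _ _ _ sc0 _ _ _ (c1 (bx1 h2))); rewrite ?mE; [clear; lra | move: hcl H0 h4; clear; nra | move: h4; clear; lra | move: h2; clear; lra].
have m0 : 2732/1000 <= m by rewrite mE; move: H1; clear; lra.
have m1 : m <= 284/100 by rewrite mE; move: h4; clear; lra.
have {}c2 := c2 (bx2 h4).
have [h5|/ltW h5] := lerP H (5/100).
  by apply: (box _ _ _ _ _ (sc1 h4) _ m0 m1 c2); [clear; lra | move: hcl h5; clear; nra].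
by apply: (box _ _ _ _ _ (sc2 h5) _ m0 m1 c2); [clear; lra | move: hcl h5 H1; clear; nra].
Qed.
End DualCore.

Section TaperCore.
Variable R : realFieldType.

(** A polynomial lower bound for cos 3x times the drop of the sine weights at the edge, in units of 2 h C. *)
Lemma taper_gain (H : R) : 0 <= H -> H <= 67/1000 ->
  1 + 88/10 * H + 24 * H ^+ 2 <= (1 - 452/100 * H) *
     (1 - 8 * H * (1 - H) + 4 * H * (1 - 52/100 * H) * (1 - 2 * H) * (16/3 + 50 * H)).
Proof.
move=> H0 H1.
have h2 := mulr_ge0 H0 H0.
have h3 : H ^+ 3 <= 67/1000 * H ^+ 2 by rewrite exprS ler_wpM2r // sqr_ge0.
have h3' : 0 <= H ^+ 3 by rewrite exprn_ge0.
have h4 : 0 <= H ^+ 4 by rewrite exprn_ge0.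
have h5 : H ^+ 5 <= 67/1000 * H ^+ 4 by rewrite exprS ler_wpM2r // exprn_ge0.
have h6 : 0 <= H ^+ 2 * (H - 67/1000) ^+ 2 by rewrite mulr_ge0 ?sqr_ge0.
lra.
Qed.

(** Quadratic form in sin f and cos f whose coefficients are polynomials in H; it is nonnegative in the
    cone where tan f is large. *)
Lemma taper_gain2 (H X Y : R) : 0 <= H -> H <= 67/1000 -> 0 <= Y -> (284/10 + 533 * H) * Y <= X ->
  0 <= ((1 + 88/10 * H + 24 * H ^+ 2) * (1 - H * (3 - 4 * H) ^+ 2) + 4 * (1 - 452/100 * H) * H * (1 - H) - (1 - H)) * X -
      ((1 + 88/10 * H + 24 * H ^+ 2) * (3 - 4 * H) ^+ 2 - 4 * (1 - 452/100 * H) * (1-H) - 5 * (1 - H)) * Y.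
Proof.
move=> H0 H1 Y0 hX.
have h2 := sqr_ge0 H.
have h3 : H ^+ 3 <= 67/1000 * H ^+ 2 by rewrite exprS ler_wpM2r // sqr_ge0.
have h3' : 0 <= H ^+ 3 by rewrite exprn_ge0.
have h4 : 0 <= H ^+ 4 by rewrite exprn_ge0.
have h5 : H ^+ 5 <= 67/1000 * H ^+ 4 by rewrite exprS ler_wpM2r // exprn_ge0.
have h55 : 0 <= H ^+ 5 by rewrite exprn_ge0.
have h6 : H ^+ 6 <= 67/1000 * H ^+ 5 by rewrite exprS ler_wpM2r // exprn_ge0.
have h22 : H ^+ 2 <= 67/1000 * H by rewrite expr2 ler_wpM2r.
have h44 : H ^+ 4 <= 67/1000 * H ^+ 3 by rewrite exprS ler_wpM2r.
have hint2 : 0 <= H ^+ 2 * (H - 67/1000) ^+ 2 by rewrite mulr_ge0 ?sqr_ge0.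
have hint : 0 <= H * (H - 67/1000) ^+ 2 by rewrite mulr_ge0 ?sqr_ge0.
have hint3 : 0 <= H * (H - 5/100) ^+ 2 by rewrite mulr_ge0 ?sqr_ge0.
set A := (X in 0 <= X * _ - _).
have A0 : 0 <= A by rewrite /A; lra.
have := ler_wpM2l A0 hX.
set B := (X in 0 <= _ - X * _) => e.
have : 0 <= (A * (284/10 + 533 * H) - B) * Y.
  by rewrite mulr_ge0 // /A /B; lra.
move: e; clear; lra.
Qed.

(** The jump budget in the column next to the cut. The hypothesis bounds the tail of the extended weights,
    which the left side charges with the factor 4/3 b^2; it is paid by the drop of the weights at the edge and by the
    first weight. *)
Lemma taper_core (h cc S C a b H m C3 s1 s2 q : R)
  (ed : edge_data h cc S C a b H m C3 s1 s2 q) (rho : R) :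
  6 * h * C * rho <= 102/100 * S * (S ^+ 2 - H) ->
  4/3 * b ^+ 2 * rho <= 2 * h * s1 * (C * (1 - 8 * H * (1 - H)) + S * (4 * h * cc * (1 - 2 * H)))
     + q * (2 * h * cc) ^+ 2.
Proof.
move=> hrho.
have q0 := ed_q0 ed; have hC := ed_hC ed; have H0 := ed_H0 ed; have hcl := cc_lb ed.
have C3l := C3_lb ed; have tan1 := ed_tan1 ed; have qs1 := q_s1E ed.
have bx0 := b_le_box0 ed; have bx1 := b_le_box1 ed; have bx2 := b_le_box2 ed.
case: ed => h0 c0 hcc S0 C0 SC aE b0 ba HE mE C3E s1E s2E qE rel H1 _.
have C30 : 0 < C3 by move: C3l H1; clear; lra.
have cc2 : cc ^+ 2 = 1 - H by move: hcc; rewrite HE; clear; lra.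
have C32 : C3 ^+ 2 = 1 - H * m ^+ 2.
  by rewrite C3E exprMn cc2 mE; ring.
have s12 : s1 * s2 = S ^+ 2 - H * m ^+ 2.
  rewrite s1E s2E.
  have -> : (S * C3 - h * m * C) * (S * C3 + h * m * C) = S ^+ 2 * C3 ^+ 2 - h ^+ 2 * m ^+ 2 * C ^+ 2 by ring.
  by rewrite C32 -HE; move: (f_equal (fun x => x * (H * m ^+ 2)) SC); clear; lra.
set Ch := C * (1 - 8 * H * (1 - H)) + S * (4 * h * cc * (1 - 2 * H)).
have s20 : 0 < s2 by rewrite s2E mE addr_gt0 ?mulr_gt0 //; move: H1; clear; lra.
have p0 : 0 < 1 - q * m.
  have q4 : q <= 1/4 by rewrite qE aE; have := sqr_ge0 (b - 1/2); clear; nra.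
  by rewrite mE; move: (mulr_gt0 q0 H0) q4; clear; nra.
have s10 : 0 < s1 by rewrite -(pmulr_rgt0 _ q0) qs1 !mulr_gt0.
have X0 : 0 < S ^+ 2 - H * m ^+ 2 by rewrite -s12 mulr_gt0.
have gain : C * (1 + 88/10 * H + 24 * H ^+ 2) <= C3 * Ch.
  have e1 := taper_gain (ltW H0) H1.
  have e2 : C * (1 - 8 * H * (1 - H) + 4 * H * (1 - 52/100 * H) * (1 - 2 * H) * (16/3 + 50 * H)) <= Ch.
    rewrite /Ch mulrDr lerD2l.
    have -> : C * (4 * H * (1 - 52/100 * H) * (1 - 2 * H) * (16/3 + 50 * H)) =
       (h * C * (16/3 + 50 * H)) * (4 * h * (1 - 2 * H) * (1 - 52/100 * H)) by rewrite HE; ring.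
    have -> : S * (4 * h * cc * (1 - 2 * H)) = S * (4 * h * (1 - 2 * H) * cc) by ring.
    apply: ler_pM => //.
    - by rewrite mulr_ge0 ?(ltW hC) //; move: H0; clear; lra.
    - by rewrite !mulr_ge0 ?(ltW h0) //; move: H0 H1; clear; lra.
    - by rewrite ler_wpM2l // !mulr_ge0 ?(ltW h0) //; move: H0 H1; clear; lra.
  have Z0 : 0 <= C * (1 - 8 * H * (1 - H) + 4 * H * (1 - 52/100 * H) * (1 - 2 * H) * (16/3 + 50 * H)).
    rewrite mulr_ge0 ?(ltW C0) //.
    have : 0 <= (1 - 452/100 * H) * (1 - 8 * H * (1 - H) + 4 * H * (1 - 52/100 * H) * (1 - 2 * H) * (16/3 + 50 * H)).
      by apply: le_trans e1; move: (sqr_ge0 H) H0; clear; lra.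
    by rewrite pmulr_rge0 //; move: H1; clear; lra.
  apply: le_trans (_ : C3 * (C * (1 - 8 * H * (1 - H) + 4 * H * (1 - 52/100 * H) * (1 - 2 * H) * (16/3 + 50 * H))) <= _).
    apply: le_trans (_ : (1 - 452/100 * H) * (C * (1 - 8 * H * (1 - H) + 4 * H * (1 - 52/100 * H) * (1 - 2 * H) * (16/3 + 50 * H))) <= _).
      by have := ler_wpM2l (ltW C0) e1; clear; lra.
    by rewrite ler_wpM2r.
  by rewrite ler_wpM2l // ltW.
have key : C * ((1 - H) * (S ^+ 2 - 5 * H * C ^+ 2)) <=
    C3 * ((S ^+ 2 - H * m ^+ 2) * Ch + 4 * C * H * (1 - H)).
  have e1 := ler_wpM2l (ltW X0) gain.
  have tan2 : (284/10 + 533 * H) * (H * C ^+ 2) <= S ^+ 2.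
    apply: le_trans (_ : (h * C * (16/3 + 50 * H)) ^+ 2 <= _).
      have -> : (h * C * (16/3 + 50 * H)) ^+ 2 = (16/3 + 50 * H) ^+ 2 * (H * C ^+ 2) by rewrite HE; ring.
      apply: ler_wpM2r; first by rewrite mulr_ge0 ?sqr_ge0 ?(ltW H0).
      by have := sqr_ge0 H; move: H0; clear; lra.
    have t0 : 0 <= h * C * (16/3 + 50 * H).
      by apply: mulr_ge0; [exact: ltW | move: H0; clear; lra].
    by rewrite ler_pXn2r ?nnegrE ?(ltW S0).
  have e2 := ler_wpM2l (ltW C0) (@taper_gain2 H (S ^+ 2) (H * C ^+ 2) (ltW H0) H1 (mulr_ge0 (ltW H0) (sqr_ge0 C)) tan2).
  have H10 : 0 <= 1 - H by move: H1; clear; lra.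
  have e3 := ler_wpM2r (mulr_ge0 (mulr_ge0 (ltW C0) (ltW H0)) H10) C3l.
  have hS : H = H * S ^+ 2 + H * C ^+ 2 by rewrite -mulrDr SC mulr1.
  have e5 : C * ((1 - H) * (S ^+ 2 - 5 * H * C ^+ 2)) <=
     (S ^+ 2 - (H * S ^+ 2 + H * C ^+ 2) * m ^+ 2) * (C * (1 + 88 / 10 * H + 24 * H ^+ 2)) +
     4 * ((1 - 452/100 * H) * (C * (H * S ^+ 2 + H * C ^+ 2) * (1 - H))).
    by move: e2; rewrite mulr0 mE; clear; lra.
  move: e5; rewrite -hS => e5; move: e1 e3 e5.
  clear; lra.
have h0' := ltW h0.
set p := 2 - q * m.
have box : 136/100 * p * (p ^+ 2 - q ^+ 2) <= 6 * a ^+ 2 * (p ^+ 2 - 5 * q ^+ 2).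
  have [c0' c1 c2] := edge_corners (ltW b0).
  have mk m0 m1 : m0 <= 3 -> m1 <= m -> m <= m0 -> edge_ineq b m0 /\ edge_ineq b m1 ->
      136/100 * p * (p ^+ 2 - q ^+ 2) <= 6 * a ^+ 2 * (p ^+ 2 - 5 * q ^+ 2).
    move=> l3 l1 l0 [k0 k1]; have := edge_ineq_between (ltW b0) ba l3 l1 l0 k0 k1.
    by rewrite /edge_ineq /p qE aE [(1 - b) * b]mulrC.
  have [hh|/ltW hh] := lerP H (2/100).
    by apply: (mk _ _ _ _ _ (c0' bx0)); rewrite ?mE; move: hh H0; clear; lra.
  have [hh'|/ltW hh'] := lerP H (4/100).
    by apply: (mk _ _ _ _ _ (c1 (bx1 hh))); rewrite ?mE; move: hh hh'; clear; lra.
  by apply: (mk _ _ _ _ _ (c2 (bx2 hh'))); rewrite ?mE; move: hh' H1; clear; lra.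
have q4 : q <= 1/4 by rewrite qE aE; have := sqr_ge0 (b - 1/2); clear; nra.
have pp : 5/4 <= p by move: q4 H0 q0; rewrite /p mE; clear; nra.
have pq5 : 0 < p ^+ 2 - 5 * q ^+ 2 by move: pp q4 q0; clear; nra.
have slope : 0 <= 6 * a ^+ 2 - 136/100 * p.
  rewrite subr_ge0 -(ler_pM2r pq5); apply: le_trans box.
  rewrite ler_wpM2l //; first by move: pp; clear; lra.
  by move: (sqr_ge0 q); clear; lra.
have SqC : q * (S * C3) = h * C * p.
  by move: rel; rewrite s2E /p; clear; lra.
have Sq2 : p ^+ 2 * (H * C ^+ 2) <= q ^+ 2 * S ^+ 2.
  have -> : p ^+ 2 * (H * C ^+ 2) = (h * C * p) ^+ 2 by rewrite HE; ring.
  rewrite -SqC -exprMn ler_pXn2r ?nnegrE ?mulr_ge0 ?(ltW q0) ?(ltW S0) ?(ltW C30) //.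
  rewrite ler_wpM2l ?(ltW q0) // ler_piMr ?(ltW S0) //.
  have : C3 ^+ 2 <= 1 by rewrite C32; move: (sqr_ge0 m) H0; clear; nra.
  by rewrite -[X in _ <= X](expr1n _ 2) ler_pXn2r ?nnegrE ?(ltW C30).
have lin : 136/100 * p * (S ^+ 2 - H) <= 6 * a ^+ 2 * ((1 - H) * (S ^+ 2 - 5 * H * C ^+ 2)).
  have hS : S ^+ 2 - H <= (1 - H) * (S ^+ 2 - H * C ^+ 2).
    have -> : C ^+ 2 = 1 - S ^+ 2 by rewrite -SC; ring.
    by move: (sqr_ge0 C) (mulr_ge0 (sqr_ge0 H) (sqr_ge0 C)); rewrite (_ : C ^+ 2 = 1 - S ^+ 2); [clear; lra | rewrite -SC; ring].
  apply: le_trans (_ : 136/100 * p * ((1 - H) * (S ^+ 2 - H * C ^+ 2)) <= _).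
    by rewrite ler_wpM2l //; move: pp; clear; lra.
  rewrite [X in X <= _]mulrCA [X in _ <= X]mulrCA ler_wpM2l //; first by move: H1; clear; lra.
  rewrite -(@ler_pM2l _ (q ^+ 2)) ?exprn_gt0 //.
  have e1 := ler_wpM2l slope Sq2.
  have e2 := ler_wpM2r (mulr_ge0 (ltW H0) (sqr_ge0 C)) box.
  move: e1 e2; clear; lra.
have rr : 0 < 6 * (h * C) * C3 by rewrite !mulr_gt0.
rewrite -(ler_pM2l rr).
set Ch' := (X in 2 * h * s1 * X).
have -> : 6 * (h * C) * C3 * (2 * h * s1 * Ch' + q * (2 * h * cc) ^+ 2) =
   6 * h * C3 * ((2 * h * C) * s1 * Ch + q * (4 * C * h ^+ 2 * cc ^+ 2)) by rewrite /Ch' -/Ch; ring.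
rewrite -rel -HE cc2.
have -> : 6 * h * C3 * (q * s2 * s1 * Ch + q * (4 * C * H * (1 - H))) =
   6 * h * q * (C3 * ((s1 * s2) * Ch + 4 * C * H * (1 - H))) by ring.
rewrite s12.
have hq : 0 <= 6 * h * q by rewrite !mulr_ge0 // ltW.
apply: le_trans (ler_wpM2l hq key).
have bSC : b * (S * C3) * a = h * C * p by rewrite -SqC qE; ring.
have a0 : 0 < a by rewrite aE; move: ba; clear; lra.
have w : 4/3 * b ^+ 2 * C3 * (6 * h * C * rho) <= 4/3 * b ^+ 2 * C3 * (102/100 * S * (S ^+ 2 - H)).
  apply: ler_wpM2l hrho; apply: mulr_ge0 (ltW C30); apply: mulr_ge0 (sqr_ge0 _); clear; lra.
apply: le_trans (_ : 4/3 * b ^+ 2 * C3 * (102/100 * S * (S ^+ 2 - H)) <= _).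
  by move: w; clear; lra.
rewrite -(ler_pM2r a0).
have -> : 4 / 3 * b ^+ 2 * C3 * (102 / 100 * S * (S ^+ 2 - H)) * a =
   136/100 * b * (b * (S * C3) * a) * (S ^+ 2 - H) by clear; lra.
rewrite bSC qE.
have bhC : 0 <= b * (h * C) by rewrite mulr_ge0 ?(ltW hC) ?(ltW b0).
have := ler_wpM2l bhC lin; clear; lra.
Qed.
End TaperCore.

Section Slabs.
Variable R : realFieldType.
(** The inequality of [window_core] on a slab h0 <= h <= h1, with all quantities replaced by their worst
    values there; G is an upper bound for b tan f / h. *)
Definition window_slab (S C h0 h1 G : R) := (S - C * h0)^+2 * C + 136/100 * (S^+2 - h0^+2) * (G * C - S) <= C * ((1-h1) * (147/100 + 98/100 * C + 294/100 * h1) - 16/10 * h1).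
(* The squares vanish at a point (c, s) of the unit circle near which the inequality is tight. *)
Ltac slab c s := move=> S0 C0 h hT;
(have e : S^+2 = 1 - C^+2 by lra);
(have h1 : 0 <= C * (C - c)^+2 by rewrite mulr_ge0 ?sqr_ge0 // ltW);
(have h2 : 0 <= S * (C - c)^+2 by rewrite mulr_ge0 ?sqr_ge0 // ltW);
(have h3 : 0 <= S * (S - s)^+2 by rewrite mulr_ge0 ?sqr_ge0 // ltW);
(have h4 : 0 <= C * (S - s)^+2 by rewrite mulr_ge0 ?sqr_ge0 // ltW);
rewrite /window_slab;
nra.
Implicit Types S C : R.
Lemma window_slab1 S C : 0 < S -> 0 < C -> S^+2 + C^+2 = 1 -> 0 * C <= S -> window_slab S C 0 (145/1000) (2432/1000).
Proof. slab (571/1000 : R) (821/1000 : R). Qed.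
Lemma window_slab2 S C : 0 < S -> 0 < C -> S^+2 + C^+2 = 1 -> 96/100 * C <= S -> window_slab S C (145/1000) (185/1000) (2532/1000).
Proof. slab (559/1000 : R) (829/1000 : R). Qed.
Lemma window_slab3 S C : 0 < S -> 0 < C -> S^+2 + C^+2 = 1 -> 142/100 * C <= S -> window_slab S C (185/1000) (21/100) (2673/1000).
Proof. slab (548/1000 : R) (836/1000 : R). Qed.
Lemma window_slab4 S C : 0 < S -> 0 < C -> S^+2 + C^+2 = 1 -> 18/10 * C <= S -> window_slab S C (21/100) (2237/10000) (2766/1000).
Proof. slab (485/1000 : R) (874/1000 : R). Qed.
End Slabs.

Section WindowCore.
Variable R : realFieldType.

Lemma rate_le (g b m a : R) : 0 <= b -> a = 1 - b -> 
  [\/ (g = 22/10 /\ b <= 2/5 /\ 292/100 <= m), (g = 214/100 /\ b <= 371/1000 /\ 284/100 <= m)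
     | (g = 214/100 /\ b <= 356/1000 /\ 279/100 <= m)] ->
  2 - m * (a * b) <= g * a.
Proof.
move=> b0 -> [] [-> [hb hm]].
- have : 292/100 * ((1 - b) * b) <= m * ((1-b) * b).
    by rewrite ler_wpM2r // mulr_ge0 //; lra.
  have : 0 <= b * (2/5 - b) by rewrite mulr_ge0 //; lra.
  lra.
- have : 284/100 * ((1 - b) * b) <= m * ((1-b) * b).
    by rewrite ler_wpM2r // mulr_ge0 //; lra.
  have : 0 <= b * (371/1000 - b) by rewrite mulr_ge0 //; lra.
  lra.
have : 279/100 * ((1 - b) * b) <= m * ((1-b) * b).
  by rewrite ler_wpM2r // mulr_ge0 //; lra.
have : 0 <= b * (356/1000 - b) by rewrite mulr_ge0 //; lra.
lra.
Qed.

Lemma window_core_box (h cc S C a b H m C3 s1 s2 q : R)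
  (ed : edge_data h cc S C a b H m C3 s1 s2 q) (rho h0 h1 G : R) :
  0 <= rho -> 6 * h * C * rho <= 102/100 * S * (S ^+ 2 - H) ->
  0 <= h0 -> h0 <= h <= h1 -> h1 <= 1 -> h <= b -> 0 <= G -> 
  b * S <= h * C * G ->
  window_slab S C h0 h1 G ->
  (S * cc - C * h) ^+ 2 + 8 * (b - h) * rho <= (1 - h) * (147/100 + 98/100 * C + 294/100 * h) - 16/10 * h.
Proof.
move=> r0 hrho h00 /andP[hh0 hh1] h11 hb G0 hG; rewrite /window_slab => hy.
have hC := ed_hC ed; have tan1 := ed_tan1 ed; have H0 := ed_H0 ed; have hcl := cc_lb ed.
case: ed => h0' c0 hcc S0 C0 SC _ b0 _ HE _ _ _ _ _ _ H1 _.
have r1 : 0 <= S ^+ 2 - H.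
  have e : 0 <= 102/100 * S * (S ^+ 2 - H).
    apply: le_trans hrho; apply: mulr_ge0 => //; move: hC; clear; lra.
  by move: e; rewrite pmulr_rge0 //; move: S0; clear; lra.
rewrite -(ler_pM2r C0).
have cc1 : cc <= 1.
  have : cc ^+ 2 <= 1 ^+ 2 by rewrite expr1n; move: hcc; rewrite -HE; move: H0; clear; lra.
  by rewrite ler_pXn2r ?nnegrE ?(ltW c0).
have p1 : 0 <= S * cc - C * h.
  have : h * C * 2 <= S * cc; last by move: hC; clear; lra.
  have c2 : 9/10 <= cc by move: hcl H1; clear; lra.
  have : S * (9/10) <= S * cc by rewrite ler_wpM2l // ltW.
  have : 0 <= h * C * H by rewrite mulr_ge0 ?(ltW hC) ?(ltW H0).
  by move: tan1 hC; clear; lra.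
have p2 : (S * cc - C * h) ^+ 2 <= (S - C * h0) ^+ 2.
  rewrite ler_pXn2r ?nnegrE //.
    have : S * cc <= S by rewrite ler_piMr ?(ltW S0).
    have : C * h0 <= C * h by rewrite ler_wpM2l ?(ltW C0).
    by move: p1; clear; lra.
  have : S * cc <= S by rewrite ler_piMr ?(ltW S0).
  have : C * h0 <= C * h by rewrite ler_wpM2l ?(ltW C0).
  by move: p1; clear; lra.
have p3 : 8 * (b - h) * rho * C <= 136/100 * (S ^+ 2 - h0 ^+ 2) * (G * C - S).
  have e1 : (b - h) * (6 * h * C * rho) <= (b - h) * (102/100 * S * (S ^+ 2 - H)).
    by rewrite ler_wpM2l // subr_ge0.
  have e2 : h * (8 * (b - h) * rho * C) <= h * (136/100 * (S ^+ 2 - H) * (G * C - S)).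
    apply: le_trans (_ : 136/100 * ((b * S - h * S) * (S ^+ 2 - H)) <= _).
      by move: e1; clear; lra.
    have : (b * S - h * S) * (S ^+ 2 - H) <= (h * C * G - h * S) * (S ^+ 2 - H).
      by rewrite ler_wpM2r // lerD2r.
    by clear; lra.
  have e3 : S <= G * C.
    rewrite -(ler_pM2l h0'); apply: le_trans (_ : b * S <= _).
      by rewrite ler_wpM2r // ltW.
    by move: hG; clear; lra.
  move: e2; rewrite ler_pM2l // => e2; apply: le_trans e2 _.
  have e4 : h0 ^+ 2 <= H by rewrite HE ler_pXn2r ?nnegrE ?(ltW h0').
  by rewrite ler_wpM2r ?subr_ge0 //; move: e4; clear; lra.
have p4 : (1-h1) * (147/100 + 98/100 * C + 294/100 * h1) - 16/10 * h1 <= (1 - h) * (147/100 + 98/100 * C + 294/100 * h) - 16/10 * h.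
  have : 0 <= (h1 - h) * (13/100 + 98/100 * C + 294/100 * (h1 + h)).
    apply: mulr_ge0; first by rewrite subr_ge0.
    by move: h0' C0 hh1; clear; lra.
  by clear; lra.
have := ler_wpM2r (ltW C0) p2; have := ler_wpM2r (ltW C0) p4.
by move: p3 hy; clear; lra.
Qed.

(** The mass budget of tapered windows. On each of four slabs for h the lower bounds for tan f and for
    cos 3x reduce it to a polynomial inequality in sin f and cos f. *)
Lemma window_core (h cc S C a b H m C3 s1 s2 q : R)
  (ed : edge_data h cc S C a b H m C3 s1 s2 q) (rho : R) :
  0 <= rho -> 6 * h * C * rho <= 102/100 * S * (S ^+ 2 - H) ->
  h <= 2237/10000 -> h <= b ->
  (S * cc - C * h) ^+ 2 + 8 * (b - h) * rho <= (1 - h) * (147/100 + 98/100 * C + 294/100 * h) - 16/10 * h.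
Proof.
move=> r0 hrho hh hb.
have hC := ed_hC ed; have H0 := ed_H0 ed; have C3l := C3_lb ed; have q0 := ed_q0 ed.
have bx0 := b_le_box0 ed; have bx1 := b_le_box1 ed; have tan := ed_tan ed.
have [h00 S0 C0 aE] : [/\ 0 < h, 0 < S, 0 < C & a = 1 - b] by case: ed.
have [SC b0 ba] : [/\ S ^+ 2 + C ^+ 2 = 1, 0 < b & b <= 1/2] by case: ed.
have [HE mE s2E qE rel] : [/\ H = h ^+ 2, m = 3 - 4 * H, s2 = S * C3 + h * m * C, q = a * b & q * s2 = 2 * h * C].
  by case: ed.
have a0 : 0 < a by rewrite aE; move: ba; clear; lra.
have SqC : b * (S * C3) * a = h * C * (2 - m * q).
  by move: rel; rewrite s2E qE; clear; lra.
have toG (g G hi : R) : 2 - m * (a * b) <= g * a -> 0 <= G -> h <= hi -> 0 <= hi -> 0 < 1 - 452/100 * hi ^+ 2 ->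
   g <= G * (1 - 452/100 * hi ^+ 2) -> b * S <= h * C * G.
  move=> e1 G0 hhi hi0 e2 e3.
  have Hhi : H <= hi ^+ 2 by rewrite HE ler_pXn2r ?nnegrE ?(ltW h00).
  have C31 : 1 - 452/100 * hi ^+ 2 <= C3 by move: Hhi C3l; clear; lra.
  have C30 : 0 < C3 by apply: lt_le_trans e2 C31.
  rewrite -(ler_pM2r C30) -(ler_pM2r a0).
  have -> : b * S * C3 * a = b * (S * C3) * a by ring.
  rewrite SqC -[_ * G * _ * _]mulrA -[_ * G * _]mulrA ler_wpM2l ?(ltW hC) //.
  rewrite qE; apply: le_trans e1 _; rewrite mulrA ler_wpM2r ?(ltW a0) //.
  by apply: le_trans e3 _; rewrite ler_wpM2l.
have toT (hi T0 : R) : 0 <= hi -> hi <= h -> T0 <= hi * (16/3 + 50 * hi ^+ 2 + 550 * hi ^+ 4) -> T0 * C <= S.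
  move=> hi0 hih e.
  have e2 : hi * (16/3 + 50 * hi ^+ 2 + 550 * hi ^+ 4) <= h * (16/3 + 50 * H + 550 * H ^+ 2).
    have l2 : hi ^+ 2 <= H by rewrite HE ler_pXn2r ?nnegrE ?(ltW h00).
    have l4 : hi ^+ 4 <= H ^+ 2 by rewrite HE -exprM ler_pXn2r ?nnegrE ?(ltW h00).
    have : 0 <= hi ^+ 2 by rewrite sqr_ge0.
    have : 0 <= hi ^+ 4 by rewrite exprn_ge0.
    move=> k4 k2; apply: ler_pM => //; last by move: l2 l4; clear; lra.
    by move: k2 k4; clear; lra.
  apply: le_trans tan; rewrite -mulrA [C * _]mulrC mulrA ler_wpM2r ?(ltW C0) //.
  by apply: le_trans e e2.
have m_rate1 : 2/100 <= H -> H <= 501/10000 -> 2 - m * (a * b) <= 214/100 * a.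
  move=> k1 k2; apply: rate_le (ltW b0) aE _; have [k3|k3] := lerP H (4/100).
    constructor 2; split => //; split; first exact: bx1.
    by rewrite mE; move: k3; clear; lra.
  constructor 3; split => //; split; first by apply: (b_le_box2 ed); rewrite ltW.
  by rewrite mE; move: k2; clear; lra.
have m_rate0 : H <= 2/100 -> 2 - m * (a * b) <= 22/10 * a.
  move=> k2; apply: rate_le (ltW b0) aE _; constructor 1; split => //; split => //.
  by rewrite mE; move: k2; clear; lra.
have hiH (hi : R) : 0 <= hi -> hi <= h -> hi ^+ 2 <= H.
  by move=> k1 k2; rewrite HE ler_pXn2r ?nnegrE ?(ltW h00).
have Hhi (hi : R) : h <= hi -> H <= hi ^+ 2.
  by move=> k1; rewrite HE ler_pXn2r ?nnegrE ?(ltW h00) //; apply: le_trans k1; rewrite ltW.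
have H5 : H <= 501/10000 by move: (Hhi _ hh); clear; lra.
have mk := window_core_box ed r0 hrho.
have [k1|/ltW k1] := lerP h (145/1000).
  have bG : b * S <= h * C * (2432/1000).
    have [k2|/ltW k2] := lerP H (2/100).
      by apply: (toG _ _ (145/1000) (m_rate0 k2)); [clear; lra | exact: k1 | clear; lra..].
    by apply: (toG _ _ (145/1000) (m_rate1 k2 H5)); [clear; lra | exact: k1 | clear; lra..].
  apply: (mk 0 (145/1000) (2432/1000)); [by [] | by rewrite k1 ltW | clear; lra | exact: hb | clear; lra | exact: bG |].
  by apply: window_slab1 => //; rewrite mul0r ltW.
have H2 : 2/100 <= H by move: (hiH (145/1000)); rewrite k1; move=> /(_ ltac:(clear; lra) isT); clear; lra.
have e1 := m_rate1 H2 H5.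
have [k2|/ltW k2] := lerP h (185/1000).
  have bG : b * S <= h * C * (2532/1000).
    by apply: (toG _ _ (185/1000) e1); [clear; lra | exact: k2 | clear; lra..].
  apply: (mk (145/1000) (185/1000) (2532/1000)); [clear; lra | by rewrite k1 k2 | clear; lra | exact: hb | clear; lra | exact: bG |].
  by apply: window_slab2 => //; apply: (toT (145/1000)); [clear; lra | exact: k1 | clear; lra].
have [k3|/ltW k3] := lerP h (21/100).
  have bG : b * S <= h * C * (2673/1000).
    by apply: (toG _ _ (21/100) e1); [clear; lra | exact: k3 | clear; lra..].
  apply: (mk (185/1000) (21/100) (2673/1000)); [clear; lra | by rewrite k2 k3 | clear; lra | exact: hb | clear; lra | exact: bG |].
  by apply: window_slab3 => //; apply: (toT (185/1000)); [clear; lra | exact: k2 | clear; lra].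
have bG : b * S <= h * C * (2766/1000).
  by apply: (toG _ _ (2237/10000) e1); [clear; lra | exact: hh | clear; lra..].
apply: (mk (21/100) (2237/10000) (2766/1000)); [clear; lra | by rewrite hh k3 | clear; lra | exact: hb | clear; lra | exact: bG |].
by apply: window_slab4 => //; apply: (toT (21/100)); [clear; lra | exact: k3 | clear; lra].
Qed.
End WindowCore.

Section EdgeAlgebra.
Variable R : realFieldType.
(** Second regime: the last row of a left window, counted with the adjoint factor, is paid by the surplus
    s1 K of the sine weights. As 2 b <= mu < nu, the factor is at most 4 b^2 / (3 mu^2). *)
Lemma dual_budget (h cc S C a b H m C3 s1 s2 q : R)
  (ed : edge_data h cc S C a b H m C3 s1 s2 q) (mu nu K D0 : R) :
  0 < mu -> 2 * b <= mu -> mu < nu -> 0 <= K ->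
  (2 * h) ^+ 2 * (cc * (1 - 2 * H) * (2 - 3 * b)) <= K * S ->
  0 <= D0 -> D0 <= mu / 2 * (3 * s1 + a ^+ 2 * s2) -> 0 <= s1 ->
  b ^+ 2 / (nu ^+ 2 - b ^+ 2) * D0 ^+ 2 <= mu / (2 * h) * (s1 * K).
Proof.
move=> mu0 bmu munu K0 hK D00 hD s10; have dc := dual_core ed.
have [h0 S0 C0 rel] : [/\ 0 < h, 0 < S, 0 < C & q * s2 = 2 * h * C] by case: ed.
have [aE b0 b12 qE] : [/\ a = 1 - b, 0 < b, b <= 1/2 & q = a * b] by case: ed.
set P := 3 * s1 + a ^+ 2 * s2 in dc hD.
have a0 : 0 < a by rewrite aE; lra.
have s20 : 0 < s2.
  by rewrite -(pmulr_rgt0 _ (mulr_gt0 a0 b0)) -qE rel !mulr_gt0.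
set la := 2 * h; have la0 : 0 < la by rewrite /la mulr_gt0.
have e1 : b * P ^+ 2 * la <= 6 * (s1 * K).
  rewrite -(ler_pM2r C0) -(ler_pM2r S0).
  have : la * b * la * (S * C * P ^+ 2) <= b * (6 * a * s1 * s2 * (K * S)).
    apply: le_trans (_ : la * b * la * (6 * a * s1 * s2 * (cc * (1 - 2 * H) * (2 - 3 * b))) <= _).
      by rewrite ler_wpM2l // !mulr_ge0 // ltW.
    have -> : la * b * la * (6 * a * s1 * s2 * (cc * (1 - 2 * H) * (2 - 3 * b))) =
      b * (6 * a * s1 * s2 * (la ^+ 2 * (cc * (1 - 2 * H) * (2 - 3 * b)))) by ring.
    by rewrite ler_wpM2l ?(ltW b0) // ler_wpM2l // !mulr_ge0 // ltW.
  have -> : b * (6 * a * s1 * s2 * (K * S)) = 6 * s1 * (q * s2) * (K * S) by rewrite qE; ring.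
  rewrite rel -/la => e.
  rewrite -(ler_pM2l la0); move: e; clear; lra.
have nb : mu ^+ 2 * (3/4) <= nu ^+ 2 - b ^+ 2.
  have k1 : mu ^+ 2 <= nu ^+ 2 by rewrite ler_pXn2r ?nnegrE ?ltW //; apply: lt_trans munu.
  have k2 : (2 * b) ^+ 2 <= mu ^+ 2.
    by rewrite ler_pXn2r ?nnegrE ?(ltW mu0) // mulr_ge0 // ltW.
  by move: k1 k2; clear; lra.
have m0 : 0 < mu ^+ 2 * (3/4) by rewrite mulr_gt0 ?exprn_gt0 //; lra.
have nb0 : 0 < nu ^+ 2 - b ^+ 2 by apply: lt_le_trans nb.
have e2 : D0 ^+ 2 <= (mu / 2 * P) ^+ 2 by rewrite ler_pXn2r ?nnegrE //; apply: le_trans hD.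
rewrite mulrAC ler_pdivrMr //.
apply: le_trans (_ : b ^+ 2 * (mu / 2 * P) ^+ 2 <= _).
  by rewrite ler_wpM2l ?sqr_ge0.
have sK : 0 <= s1 * K by rewrite mulr_ge0.
apply: le_trans (_ : mu / la * (s1 * K) * (mu ^+ 2 * (3/4)) <= _); last first.
  by rewrite ler_wpM2l // mulr_ge0 // divr_ge0 // ltW.
have -> : mu / la * (s1 * K) * (mu ^+ 2 * (3/4)) = mu * (s1 * K) * (mu ^+ 2 * (3/4)) / la by ring.
rewrite ler_pdivlMr //.
have -> : b ^+ 2 * (mu / 2 * P) ^+ 2 * la = (b * P ^+ 2 * la) * (mu ^+ 2 * b / 4) by field.
apply: le_trans (_ : 6 * (s1 * K) * (mu ^+ 2 * b / 4) <= _).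
  by rewrite ler_wpM2r // divr_ge0 // mulr_ge0 ?sqr_ge0 // ltW.
have : (2 * b) * (s1 * K * mu ^+ 2) <= mu * (s1 * K * mu ^+ 2).
  by rewrite ler_wpM2r // mulr_ge0 ?sqr_ge0.
by clear; lra.
Qed.

(** Up to the factor 2 h, the left side is the second-order part of the drop of the weights at the edge; it stays
    below the last weight s1. *)
Lemma bend_le_s1 (h cc S C a b H m C3 s1 s2 q : R)
  (ed : edge_data h cc S C a b H m C3 s1 s2 q) : 2 * a * h * S <= s1.
Proof.
have C3l := C3_lb ed; have bx0 := b_le_box0 ed; have bx2 := b_le_box2 ed.
have H0 := ed_H0 ed.
have [h0 S0 C0 rel] : [/\ 0 < h, 0 < S, 0 < C & q * s2 = 2 * h * C] by case: ed.
have [aE b0 b12 qE] : [/\ a = 1 - b, 0 < b, b <= 1/2 & q = a * b] by case: ed.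
have [s1E s2E mE HE H1] : [/\ s1 = S * C3 - h * m * C, s2 = S * C3 + h * m * C, m = 3 - 4 * H, H = h ^+ 2 & H <= 67/1000] by case: ed.
have a0 : 0 < a by rewrite aE; move: b12; clear; lra.
have q0 : 0 < q by rewrite qE mulr_gt0.
have qm : 0 < 1 - q * m / 2.
  have q4 : q <= 1/4 by rewrite qE aE; have := sqr_ge0 (b - 1/2); clear; nra.
  have := mulr_ge0 (ltW q0) (ltW H0); rewrite mE; move: q4; clear; lra.
have k1 : s2 * (1 - q * m / 2) = S * C3.
  by move: (f_equal (fun z => z * m) rel); rewrite s2E; clear; lra.
have k2 : s1 * (1 - q * m / 2) = S * C3 * (1 - q * m).
  have -> : s1 = s2 - m * (q * s2) by rewrite rel s1E s2E; ring.
  by rewrite -k1; ring.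
rewrite -(ler_pM2r qm) k2.
suff : 2 * a * h * (1 - q * m / 2) <= C3 * (1 - q * m).
  by move=> e; have := ler_wpM2l (ltW S0) e; clear; lra.
have q24 : q <= 24/100.
  have g1 : 0 <= 2/5 - b by move: bx0; clear; lra.
  have g2 : 0 <= 3/5 - b by move: bx0; clear; lra.
  by have := mulr_ge0 g1 g2; rewrite qE aE; clear; lra.
have m3 : m <= 3 by rewrite mE; move: H0; clear; lra.
have q1m : 0 <= 1 - q * m.
  by have := ler_wpM2l (ltW q0) m3; move: q24; clear; lra.
have [H4|/ltW H4] := lerP H (4/100).
  have h2 : h <= 2/10.
    rewrite leNgt; apply/negP => hh.
    have k : 0 <= 2/10 :> R by clear; lra.
    by have := ltr_pM k k hh hh; move: H4; rewrite HE; clear; lra.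
  apply: le_trans (_ : 819/1000 * (1 - q * m) <= _); last first.
    by rewrite ler_wpM2r //; move: C3l H4; clear; lra.
  apply: le_trans (_ : 2 * a * (2/10) * (1 - q * m / 2) <= _).
    by rewrite ler_wpM2r ?(ltW qm) // ler_wpM2l // mulr_ge0 // ltW.
  have e0 := ler_wpM2l (ltW q0) m3.
  have e3 : 0 <= 819/1000 - 2/10 * a by rewrite aE; move: b0; clear; lra.
  have e4 := ler_wpM2l e3 e0.
  suff : 2 * a * (2/10) * (1 - q * 3 / 2) <= 819/1000 * (1 - q * 3).
    by move: e4; clear; lra.
  have e5 := sqr_ge0 (b - 2/5); have e6 : 0 <= b ^+ 3 by rewrite exprn_ge0 // ltW.
  by rewrite qE aE; move: e5 e6 b0 bx0; clear; lra.
have h2 : h <= 259/1000.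
  rewrite leNgt; apply/negP => hh.
  have k : 0 <= 259/1000 :> R by clear; lra.
  by have := ltr_pM k k hh hh; move: H1; rewrite HE; clear; lra.
have m2 : m <= 284/100 by rewrite mE; move: H4; clear; lra.
have b3 := bx2 H4.
apply: le_trans (_ : 697/1000 * (1 - q * m) <= _); last first.
  by rewrite ler_wpM2r //; move: C3l H1; clear; lra.
apply: le_trans (_ : 2 * a * (259/1000) * (1 - q * m / 2) <= _).
  by rewrite ler_wpM2r ?(ltW qm) // ler_wpM2l // mulr_ge0 // ltW.
have e0 := ler_wpM2l (ltW q0) m2.
have e3 : 697/1000 - 259/1000 * a >= 0 by rewrite aE; move: b0; clear; lra.
have e4 := ler_wpM2l e3 e0.
suff : 2 * a * (259/1000) * (1 - q * (284/100) / 2) <= 697/1000 * (1 - q * (284/100)).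
  by move: e4; clear; lra.
have e5 := sqr_ge0 (b - 356/1000).
have e6 := mulr_ge0 (ltW b0) e5.
by rewrite qE aE; move: e5 e6 b0 b3; clear; lra.
Qed.
End EdgeAlgebra.

From mathcomp Require Import all_classical all_reals all_analysis.
Import numFieldNormedType.Exports.
Local Open Scope classical_set_scope.
Local Open Scope ring_scope.

(** * Taylor bounds for sine and cosine *)

Section Taylor.
Variable R : realType.
Implicit Types (f df : R -> R) (u x : R).

(** Integrating an inequality from 0; applied repeatedly it yields the alternating Taylor bounds. *)
Lemma derive_ge0_ge0 f df :
  (forall x, is_derive x 1 f (df x)) -> f 0 = 0 -> (forall x, 0 <= x -> 0 <= df x) ->
  forall x, 0 <= x -> 0 <= f x.
Proof.
move=> fE f0 df0 x; rewrite le_eqVlt => /predU1P[<-|x0]; first by rewrite f0.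
have fc : {within `[0, x], continuous f}.
  by apply: derivable_within_continuous => y _; exact: ex_derive.
have [c] := @MVT R f df 0 x x0 (fun x _ => fE x) fc.
rewrite in_itv/= f0 subr0 => /andP[c0 cx ->].
by rewrite subr0 mulr_ge0 ?df0 // ltW.
Qed.

Lemma is_derive_monomial (c : R) n x : is_derive x (1:R) (fun y : R => c * y ^+ n.+1) (c * (n.+1%:R * x ^+ n)).
Proof.
have -> : (fun y : R => c * y ^+ n.+1) = c \*: (@id R ^+ n.+1).
  by apply/funext => y /=; rewrite fctE.
apply: is_derive_eq.
by rewrite /= /GRing.scale /= mulr1.
Qed.

Lemma sin_le_id u : 0 <= u -> sin u <= u.
Proof.
move=> u0; rewrite -subr_ge0; move: u u0.
apply: (@derive_ge0_ge0 (fun u => u - sin u) (fun u => 1 - cos u)).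
- by rewrite /= sin0; lra.
- by move=> x _; rewrite subr_ge0 cos_le1.
Qed.

Lemma cos_ge2 u : 0 <= u -> 1 - u ^+ 2 / 2 <= cos u.
Proof.
move=> u0; rewrite -subr_ge0.
have -> : cos u - (1 - u ^+ 2 / 2) = (cos u - 1) + 2^-1 * u ^+ 2 by lra.
move: u u0; apply: (@derive_ge0_ge0 _ (fun u => (- sin u - 0) + 2^-1 * (2 * u ^+ 1))).
- by move=> x; do ?apply: is_deriveD; exact: is_derive_monomial.
- by rewrite /= cos0 expr0n /=; lra.
- by move=> x /sin_le_id; lra.
Qed.

Lemma sin_ge3 u : 0 <= u -> u - u ^+ 3 / 6 <= sin u.
Proof.
move=> u0; rewrite -subr_ge0.
have -> : sin u - (u - u ^+ 3 / 6) = (sin u - u) + 6^-1 * u ^+ 3 by lra.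
move: u u0; apply: (@derive_ge0_ge0 _ (fun u => (cos u - 1) + 6^-1 * (3 * u ^+ 2))).
- by move=> x; do ?apply: is_deriveD; exact: is_derive_monomial.
- by rewrite /= sin0 expr0n /=; lra.
- by move=> x /cos_ge2; lra.
Qed.

Lemma cos_le4 u : 0 <= u -> cos u <= 1 - u ^+ 2 / 2 + u ^+ 4 / 24.
Proof.
move=> u0; rewrite -subr_ge0.
have -> : 1 - u ^+ 2 / 2 + u ^+ 4 / 24 - cos u = (1 - cos u) + (- 2^-1) * u ^+ 2 + 24^-1 * u ^+ 4 by lra.
move: u u0; apply: (@derive_ge0_ge0 _ (fun u => (0 - - sin u) + (-2^-1) * (2 * u ^+ 1) + 24^-1 * (4 * u ^+ 3))).
- by move=> x; do ?apply: is_deriveD; exact: is_derive_monomial.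
- by rewrite /= cos0 !expr0n /=; lra.
- by move=> x /sin_ge3; lra.
Qed.

Lemma sin_le5 u : 0 <= u -> sin u <= u - u ^+ 3 / 6 + u ^+ 5 / 120.
Proof.
move=> u0; rewrite -subr_ge0.
have -> : u - u ^+ 3 / 6 + u ^+ 5 / 120 - sin u = (u - sin u) + (- 6^-1) * u ^+ 3 + 120^-1 * u ^+ 5 by lra.
move: u u0; apply: (@derive_ge0_ge0 _ (fun u => (1 - cos u) + (-6^-1) * (3 * u ^+ 2) + 120^-1 * (5 * u ^+ 4))).
- by move=> x; do ?apply: is_deriveD; exact: is_derive_monomial.
- by rewrite /= sin0 !expr0n /=; lra.
- by move=> x /cos_le4; lra.
Qed.

Lemma cos_ge6 u : 0 <= u -> 1 - u ^+ 2 / 2 + u ^+ 4 / 24 - u ^+ 6 / 720 <= cos u.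
Proof.
move=> u0; rewrite -subr_ge0.
have -> : cos u - (1 - u ^+ 2 / 2 + u ^+ 4 / 24 - u ^+ 6 / 720) =
   (cos u - 1) + 2^-1 * u ^+ 2 + (- 24^-1) * u ^+ 4 + 720^-1 * u ^+ 6 by lra.
move: u u0; apply: (@derive_ge0_ge0 _ (fun u => (- sin u - 0) + 2^-1 * (2 * u ^+ 1) + (- 24^-1) * (4 * u ^+ 3) + 720^-1 * (6 * u ^+ 5))).
- by move=> x; do ?apply: is_deriveD; exact: is_derive_monomial.
- by rewrite /= cos0 !expr0n /=; lra.
- by move=> x /sin_le5; lra.
Qed.

Lemma sin_ge7 u : 0 <= u -> u - u ^+ 3 / 6 + u ^+ 5 / 120 - u ^+ 7 / 720 / 7 <= sin u.
Proof.
move=> u0; rewrite -subr_ge0.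
have -> : sin u - (u - u ^+ 3 / 6 + u ^+ 5 / 120 - u ^+ 7 / 720 / 7) =
   (sin u - u) + 6^-1 * u ^+ 3 + (- 120^-1) * u ^+ 5 + (720^-1 * 7^-1) * u ^+ 7 by lra.
move: u u0; apply: (@derive_ge0_ge0 _ (fun u => (cos u - 1) + 6^-1 * (3 * u ^+ 2) + (- 120^-1) * (5 * u ^+ 4) + (720^-1 * 7^-1) * (7 * u ^+ 6))).
- by move=> x; do ?apply: is_deriveD; exact: is_derive_monomial.
- by rewrite /= sin0 !expr0n /=; lra.
- by move=> x /cos_ge6; lra.
Qed.

Lemma sin_pi6 : sin (pi / 6 : R) = 2^-1.
Proof.
have p0 := pi_gt0 R.
have c0 : 0 < cos (pi / 6 : R) by apply: cos_gt0_pihalf; apply/andP; split; lra.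
have : cos (pi / 2 : R) = 0 by exact: cos_pihalf.
have -> : (pi / 2 : R) = pi / 6 *+ 2 + pi / 6 by rewrite -mulr_natl; lra.
rewrite cosD cos_mulr2n sin_mulr2n => e.
have e2 := sin2cos2 (pi / 6 : R).
have s0 : 0 < sin (pi / 6 : R) by apply: sin_gt0_pi; apply/andP; split; lra.
have : cos (pi / 6 : R) * (1 - 4 * sin (pi/6) ^+ 2) = 0.
  by move: e (f_equal (fun z => cos (pi / 6 : R) * z) e2); clear; lra.
move/eqP; rewrite mulf_eq0 (gt_eqF c0) /= => /eqP e3.
have /eqP : (2 * sin (pi / 6 : R)) ^+ 2 = 1 by lra.
by rewrite sqrf_eq1 => /orP[] /eqP; lra.
Qed.

Lemma pi_ge3 : 3 <= pi :> R.
Proof.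
have := @sin_le_id (pi / 6); rewrite sin_pi6; have := pi_gt0 R; move=> h /(_ ltac:(lra)); lra.
Qed.

Lemma pi_le3_2 : pi <= 32/10 :> R.
Proof.
rewrite leNgt; apply/negP => h.
have p4 : pi <= 4 :> R by have := pihalf_lt2 R; lra.
have : sin (16/30 : R) < sin (pi / 6).
  by rewrite ltr_sin ?in_itv /= ?andbT; try (apply/andP; split); lra.
rewrite sin_pi6 => h2.
have := @sin_ge3 (16/30) ltac:(lra); lra.
Qed.

End Taylor.

(** * Trigonometry at the edge of a window *)

Section EdgeTrig.
Variable R : realType.
Implicit Types (x y f : R).

Lemma sin_3x x : sin (3 * x) = sin x * (3 - 4 * sin x ^+ 2).
Proof.
have -> : 3 * x = x *+ 2 + x by rewrite -mulr_natl; lra.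
rewrite sinD sin_mulr2n cos_mulr2n.
by move: (f_equal (fun z => sin x * z) (sin2cos2 x)); clear; lra.
Qed.

Lemma cos_3x x : cos (3 * x) = cos x * (1 - 4 * sin x ^+ 2).
Proof.
have -> : 3 * x = x *+ 2 + x by rewrite -mulr_natl; lra.
rewrite cosD sin_mulr2n cos_mulr2n.
by move: (f_equal (fun z => cos x * z) (sin2cos2 x)); clear; lra.
Qed.

Lemma sin_2x x : sin (2 * x) = 2 * sin x * cos x.
Proof. by rewrite mulr_natl sin_mulr2n; lra. Qed.

Lemma cos_2x x : cos (2 * x) = 1 - 2 * sin x ^+ 2.
Proof. by rewrite mulr_natl cos_mulr2n; have := sin2cos2 x; lra. Qed.

Lemma le_sin x y : - (pi / 2) <= x -> x <= y -> y <= pi / 2 -> sin x <= sin y.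
Proof.
move=> h1; rewrite le_eqVlt => /predU1P[-> //|h2] h3.
by apply: ltW; rewrite ltr_sin // ?in_itv /=; apply/andP; split=> //; lra.
Qed.

Lemma le_cos x y : 0 <= x -> x <= y -> y <= pi -> cos y <= cos x.
Proof.
move=> h1; rewrite le_eqVlt => /predU1P[-> //|h2] h3.
by apply: ltW; rewrite ltr_cos // ?in_itv /=; apply/andP; split=> //; lra.
Qed.

Lemma sin_pihalfB x : sin (pi / 2 - x) = cos x.
Proof. by rewrite sinB sin_pihalf cos_pihalf; lra. Qed.


(** The Taylor coefficients 1/3 and 2/15 of the tangent, slightly lowered so that truncated series suffice. *)
Lemma tan_ge y : 0 <= y -> y <= pi / 2 ->
  y * cos y * (1 + 33/100 * y ^+ 2 + 128/1000 * y ^+ 4) <= sin y.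
Proof.
move=> y0 y1; apply: le_trans (sin_ge7 y0).
have y2 : y <= 16/10 by have := pi_le3_2 R; lra.
have Y : 0 <= y ^+ 2 by exact: sqr_ge0.
have Y1 : y ^+ 2 <= 256/100.
  by have := ler_pM y0 y0 y2 y2; lra.
set s := y ^+ 2 in Y Y1 *.
have e4 : y ^+ 4 = s ^+ 2 by rewrite /s -exprM.
have -> : y - y ^+ 3 / 6 + y ^+ 5 / 120 - y ^+ 7 / 720 / 7 = y * (1 - s / 6 + s ^+ 2 / 120 - s ^+ 3 / 720 / 7).
  by rewrite /s; lra.
rewrite -mulrA; apply: ler_wpM2l => //.
rewrite e4; apply: le_trans (_ : (1 - s / 2 + s ^+ 2 / 24) * (1 + 33 / 100 * s + 128 / 1000 * s ^+ 2) <= _).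
  apply: ler_wpM2r; first by have := sqr_ge0 s; lra.
  by have := cos_le4 y0; rewrite e4.
have s2 := sqr_ge0 s; have s3 : 0 <= s ^+ 3 by rewrite exprn_ge0.
have s4 : s ^+ 4 <= 256/100 * s ^+ 3 by rewrite exprS; apply: ler_wpM2r.
lra.
Qed.

(** The value at pi / 12 is (2 - sqrt 3) / 4 < 67/1000. *)
Lemma sin_sqr_le_pi12 x : 0 < x -> 12 * x <= pi -> sin x ^+ 2 <= 67/1000.
Proof.
move=> x0 hx.
have c3 : 0 <= cos (3 * (2 * x)) by apply: cos_ge0_pihalf; apply/andP; split; lra.
have cp : 0 < cos (2 * x) by apply: cos_gt0_pihalf; apply/andP; split; lra.
move: c3; rewrite cos_3x pmulr_rge0 // => e.
have := cos2sin2 (2 * x) => e2.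
rewrite leNgt; apply/negP => h.
have c2 := cos_2x x.
have k : cos (2 * x) < 866/1000 by lra.
have := ltr_pM (ltW cp) (ltW cp) k k.
by move: e e2; clear; lra.
Qed.

Lemma x_le_sin x : 0 < x -> 12 * x <= pi -> 98/100 * x <= sin x.
Proof.
move=> x0 hx; have := sin_ge3 (ltW x0).
have x1 : x <= 27/100 by have := pi_le3_2 R; lra.
have : x ^+ 3 <= 73/1000 * x.
  have : x ^+ 2 <= 73/1000 by have := ler_pM (ltW x0) (ltW x0) x1 x1; lra.
  by move=> e; rewrite exprSr; apply: ler_wpM2r e; rewrite ltW.
lra.
Qed.

(** tan is increasing, so f >= 16 x / 3 gives the lower bound [ed_tan] for tan f. *)
Lemma edge_data_intro x f a b :
  0 < x -> 16/3 * x <= f -> f <= pi / 2 -> f + 7 * x <= pi ->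
  a = 1 - b -> 0 < b -> b <= 1/2 -> a * b * sin (f + 3 * x) = 2 * sin x * cos f ->
  edge_data (sin x) (cos x) (sin f) (cos f) a b (sin x ^+ 2) (3 - 4 * sin x ^+ 2)
     (cos (3 * x)) (sin (f - 3 * x)) (sin (f + 3 * x)) (a * b).
Proof.
move=> x0 hf f1 f7 aE b0 b1 rel.
have x12 : 12 * x <= pi by lra.
have s0 : 0 < sin x by apply: sin_gt0_pi; apply/andP; split; lra.
have s2 : 0 < sin (f + 3 * x) by apply: sin_gt0_pi; apply/andP; split; lra.
have q0 : 0 < a * b by rewrite mulr_gt0 //; lra.
have S0 : 0 < sin f by apply: sin_gt0_pi; apply/andP; split; lra.
have C0 : 0 < cos f.
  by have := mulr_gt0 q0 s2; rewrite rel pmulr_rgt0 // mulr_gt0.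
split=> //.
- by apply: cos_gt0_pihalf; apply/andP; split; lra.
- by rewrite addrC cos2Dsin2.
- by rewrite addrC cos2Dsin2.
- by rewrite cos_3x.
- by rewrite sinB sin_3x; ring.
- by rewrite sinD sin_3x; ring.
- exact: sin_sqr_le_pi12.
have [y yE] : exists y, y = 16/3 * x by exists (16/3 * x).
have y0 : 0 <= y by rewrite yE; lra.
have yp : y <= pi / 2 by rewrite yE; lra.
have hB : sin y * cos f <= sin f * cos y.
  have : 0 <= sin (f - y).
    by apply: sin_ge0_pi; apply/andP; split; rewrite yE; lra.
  by rewrite sinB; lra.
have [cy|cy] := ltrP 0 (cos y); last first.
  have : 0 <= cos y by apply: cos_ge0_pihalf; apply/andP; split; lra.
  move=> cy2; have c00 : cos y = 0 by lra.
  have sy : 0 < sin y by apply: sin_gt0_pi; apply/andP; split; rewrite yE; lra.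
  by have := mulr_gt0 sy C0; move: hB; rewrite c00 mulr0; lra.
rewrite -(ler_pM2r cy); apply: le_trans hB.
have t := tan_ge y0 yp.
apply: le_trans (_ : (y * cos y * (1 + 33/100 * y ^+ 2 + 128/1000 * y ^+ 4)) * cos f <= _); last first.
  by apply: ler_wpM2r t; rewrite ltW.
have sx := sin_le_id (ltW x0).
have sx2 : sin x ^+ 2 <= x ^+ 2 by rewrite ler_pXn2r ?nnegrE ?(ltW s0) ?(ltW x0).
have sx4 : (sin x ^+ 2) ^+ 2 <= x ^+ 4.
  by rewrite (exprM x 2 2) ler_pXn2r ?nnegrE ?sqr_ge0.
have -> : sin x * cos f * (16 / 3 + 50 * sin x ^+ 2 + 550 * (sin x ^+ 2) ^+ 2) * cos y =
  (sin x * (16 / 3 + 50 * sin x ^+ 2 + 550 * (sin x ^+ 2) ^+ 2)) * (cos f * cos y) by ring.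
have -> : y * cos y * (1 + 33/100 * y ^+ 2 + 128/1000 * y ^+ 4) * cos f =
  (y * (1 + 33/100 * y ^+ 2 + 128/1000 * y ^+ 4)) * (cos f * cos y) by ring.
apply: ler_wpM2r; first by rewrite mulr_ge0 // ltW.
apply: le_trans (_ : x * (16 / 3 + 50 * x ^+ 2 + 550 * x ^+ 4) <= _).
  apply: ler_pM; [exact: ltW | | exact: sx |].
    by have := sqr_ge0 (sin x); have := sqr_ge0 (sin x ^+ 2); lra.
  by move: sx2 sx4; clear; lra.
rewrite yE; have k3 : 0 <= x ^+ 3 by rewrite exprn_ge0 // ltW.
have k5 : 0 <= x ^+ 5 by rewrite exprn_ge0 // ltW.
by move: k3 k5; clear; lra.
Qed.
End EdgeTrig.

Section EdgeTrigonometry.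
Variable R : realType.
Lemma prod_sin (y z : R) : 2 * (sin y * sin z) = cos (y - z) - cos (y + z).
Proof. by rewrite cosB cosD; ring. Qed.

(** By the angle equation a times the second factor is sin (f - x) - b sin (f + x), so the product can
    be expanded into cosines without a. *)
Lemma tail_identity (x f a b : R) : a + b = 1 ->
  a * b * sin (f + 3 * x) = 2 * sin x * cos f ->
  (a * sin (f - 3 * x) - sin (f - 5 * x)) * (sin (f + x) - b * sin (f + 3 * x)) =
  sin (2 * x) * (sin (4 * x) - b * sin (6 * x)).
Proof.
move=> ab rel.
have e : a * (sin (f + x) - b * sin (f + 3 * x)) = sin (f - x) - b * sin (f + x).
  have -> : a * (sin (f + x) - b * sin (f + 3 * x)) = a * sin (f + x) - a * b * sin (f + 3 * x) by ring.
  by rewrite rel (_ : a = 1 - b) ?sinB ?sinD; [ring | lra].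
have e1 := prod_sin (f - 3 * x) (f - x); have e2 := prod_sin (f - 5 * x) (f + x).
have e3 := prod_sin (f - 3 * x) (f + x); have e4 := prod_sin (f - 5 * x) (f + 3 * x).
have e5 := prod_sin (4 * x) (2 * x); have e6 := prod_sin (6 * x) (2 * x).
have r1 : cos (f - 3 * x - (f - x)) = cos (2 * x) by rewrite -cosN; congr cos; ring.
have r2 : cos (f - 5 * x - (f + x)) = cos (6 * x) by rewrite -cosN; congr cos; ring.
have r3 : cos (f - 3 * x - (f + x)) = cos (4 * x) by rewrite -cosN; congr cos; ring.
have r4 : cos (f - 5 * x - (f + 3 * x)) = cos (8 * x) by rewrite -cosN; congr cos; ring.
have r5 : cos (4 * x - 2 * x) = cos (2 * x) by congr cos; ring.
have r6 : cos (6 * x - 2 * x) = cos (4 * x) by congr cos; ring.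
have r7 : cos (4 * x + 2 * x) = cos (6 * x) by congr cos; ring.
have r8 : cos (6 * x + 2 * x) = cos (8 * x) by congr cos; ring.
have r9 : cos (f - 3 * x + (f - x)) = cos (f - 5 * x + (f + x)) by congr cos; ring.
have r10 : cos (f - 3 * x + (f + x)) = cos (f - 5 * x + (f + 3 * x)) by congr cos; ring.
rewrite r1 r9 in e1; rewrite r2 in e2; rewrite r3 r10 in e3; rewrite r4 in e4.
rewrite r5 r7 in e5; rewrite r6 r8 in e6.
have -> : (a * sin (f - 3 * x) - sin (f - 5 * x)) * (sin (f + x) - b * sin (f + 3 * x)) =
  sin (f - 3 * x) * (a * (sin (f + x) - b * sin (f + 3 * x))) - sin (f - 5 * x) * (sin (f + x) - b * sin (f + 3 * x)) by ring.
rewrite e.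
have g3 := f_equal (fun z => b * z) e3; have g4 := f_equal (fun z => b * z) e4.
have g6 := f_equal (fun z => b * z) e6.
by move: e1 e2 g3 g4 e5 g6; clear; lra.
Qed.

(** First regime: the cost of zero padding at both ends is paid by the surplus of the sine weights. It
    is enough that the weight after the last one is at most 2 a b sin 2x. *)
Lemma edge_overlap (x f a b : R) : 0 < x -> 3 * x <= f -> f <= pi / 2 ->
  0 <= a -> 0 <= b -> a * b * sin (f + 3 * x) = 2 * sin x * cos f ->
  f <= 16/3 * x -> (5 * x < f -> f + 7 * x <= pi) ->
  sin (f - 3 * x) * sin (f - 5 * x) <= a * b * (sin (2 * x) ^+ 2 + sin (f - 3 * x) ^+ 2).
Proof.
move=> x0 f3 f2 a0 b0 rel f16 f7; have p0 := pi_gt0 R.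
have c0 : 0 <= a * b by rewrite mulr_ge0.
have sn : 0 <= sin (f - 3 * x) by apply: sin_ge0_pi; apply/andP; split; lra.
have [f5|f5] := lerP f (5 * x).
  apply: le_trans (_ : 0 <= _); last by rewrite mulr_ge0 // addr_ge0 // sqr_ge0.
  rewrite mulr_ge0_le0 //.
  have : 0 <= sin (5 * x - f) by apply: sin_ge0_pi; apply/andP; split; lra.
  by rewrite -opprB sinN oppr_ge0.
have {}f7 := f7 f5.
have x12 : 12 * x <= pi by lra.
have h0 : 0 < sin x by apply: sin_gt0_pi; apply/andP; split; lra.
have cc0 : 0 < cos x by apply: cos_gt0_pihalf; apply/andP; split; lra.
have S0 : 0 < sin f by apply: sin_gt0_pi; apply/andP; split; lra.
have H1 := sin_sqr_le_pi12 x0 x12.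
have s2x : 0 <= sin (2 * x) by apply: sin_ge0_pi; apply/andP; split; lra.
suff k : sin (f - 5 * x) <= 2 * (a * b) * sin (2 * x).
  apply: le_trans (ler_wpM2l sn k) _.
  have := mulr_ge0 c0 (sqr_ge0 (sin (2 * x) - sin (f - 3 * x))); clear; lra.
have s2 : 0 < sin (f + 3 * x) by apply: sin_gt0_pi; apply/andP; split; lra.
rewrite -(ler_pM2r s2).
have -> : 2 * (a * b) * sin (2 * x) * sin (f + 3 * x) = 2 * sin (2 * x) * (a * b * sin (f + 3 * x)) by ring.
rewrite rel sin_2x.
(* f - 5x <= x / 3, and sin 3y >= 2.93 sin y for the small y = x / 3. *)
have hz : sin (f - 5 * x) * (293/100) <= sin x.
  have le1 : sin (f - 5 * x) <= sin (x / 3) by apply: le_sin; move: x0 f5 f7 f16 f2 p0; clear; lra.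
  apply: le_trans (_ : sin (x / 3) * (293/100) <= _).
    by apply: ler_wpM2r le1; clear; lra.
  have E : sin x = sin (x/3) * (3 - 4 * sin (x / 3) ^+ 2).
    by rewrite -sin_3x; congr sin; field.
  rewrite E; apply: ler_wpM2l; first by apply: sin_ge0_pi; apply/andP; split; move: x0 x12; clear; lra.
  have z0 : 0 <= x / 3 by lra.
  have z1 := sin_le_id z0.
  have z2 : 0 <= sin (x / 3) by apply: sin_ge0_pi; apply/andP; split; move: x0 x12; clear; lra.
  have x1 : x / 3 <= 9/100 by have := pi_le3_2 R; lra.
  have z3 : sin (x / 3) <= 9/100 by lra.
  by have := ler_pM z2 z2 z3 z3; clear; lra.
have C0 : 0 <= cos f by apply: cos_ge0_pihalf; apply/andP; split; move: x0 f3 f2 p0; clear; lra.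
have main : sin (f + 3 * x) <= 2244/100 * (sin x * cos f).
  rewrite sinD sin_3x cos_3x.
  set h := sin x in h0 H1 *; set C := cos f in C0 *; set S := sin f in S0 *; set cc := cos x in cc0 *.
  have cc1 : cc <= 1 by exact: cos_le1.
  have S1 : S <= 1 by exact: sin_le1.
  have H0 : 0 <= h ^+ 2 by exact: sqr_ge0.
  have xh := x_le_sin x0 x12; rewrite -/h in xh.
  have x1 : x <= 27/100 by have := pi_le3_2 R; lra.
  have C3u : cc * (1 - 4 * h ^+ 2) <= 1 - 4 * h ^+ 2.
    by rewrite ler_piMl //; lra.
  have C3p : 0 <= cc * (1 - 4 * h ^+ 2) by apply: mulr_ge0; [exact: ltW | move: H1; clear; lra].
  have m3 : C * (h * (3 - 4 * h ^+ 2)) <= 3 * (h * C).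
    have := mulr_ge0 (mulr_ge0 (ltW h0) C0) H0; clear; lra.
  suff k : S * (cc * (1 - 4 * h ^+ 2)) <= 1944/100 * (h * C) by move: k m3; clear; lra.
  have [h23|/ltW h23] := lerP h (225/1000).
    have fh : f <= 545/100 * h by move: f16 xh h0; clear; lra.
    have f0 : 0 <= f by move: f3 x0; clear; lra.
    have hC := cos_ge2 f0; rewrite -/C in hC.
    have f2h : f ^+ 2 <= (545/100 * h) ^+ 2 by have := ler_pM f0 f0 fh fh; rewrite -!expr2.
    have Sf : S <= 545/100 * h by apply: le_trans fh; exact: sin_le_id.
    have h2 : h ^+ 2 <= 507/10000.
      by have := ler_pM (ltW h0) (ltW h0) h23 h23; clear; lra.
    apply: le_trans (_ : (545/100 * h) * (1 - 4 * h ^+ 2) <= _).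
      by apply: ler_pM => //; exact: ltW.
    have kk : 545/100 * (1 - 4 * h ^+ 2) <= 1944/100 * C by move: hC f2h h2; clear; lra.
    by have := ler_wpM2l (ltW h0) kk; clear; lra.
  have Cl : 82/100 * h <= C.
    have c1 : sin (5/6 * x) <= C.
      have -> : C = sin (pi / 2 - f) by rewrite sin_pihalfB.
      by apply: le_sin; move: f16 f7 f3 x0 p0; clear; lra.
    have := @sin_ge3 R (5/6 * x) ltac:(move: x0; clear; lra).
    have sx := sin_le_id (ltW x0); rewrite -/h in sx.
    have x2 : x ^+ 2 <= 73/1000 by have := ler_pM (ltW x0) (ltW x0) x1 x1; clear; lra.
    have := ler_wpM2l (ltW x0) x2.
    by move: sx c1 x0; clear; lra.
  have Hl : 506/10000 <= h ^+ 2.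
    have k0 : 0 <= 225/1000 :> R by clear; lra.
    by have := ler_pM k0 k0 h23 h23; clear; lra.
  apply: le_trans (_ : 1 * (1 - 4 * h ^+ 2) <= _).
    by apply: ler_pM => //; exact: ltW.
  have := ler_wpM2l (ltW h0) Cl; move: Hl; clear; lra.
have ccl : 96/100 <= cos x.
  rewrite leNgt; apply/negP => hlt.
  have := ltr_pM (ltW cc0) (ltW cc0) hlt hlt; have := cos2sin2 x; move: H1; clear; lra.
have s5 : 0 <= sin (f - 5 * x) by apply: sin_ge0_pi; apply/andP; split; move: f5 f2 x0 p0; clear; lra.
have e1 := ler_wpM2l s5 main.
have e2 := ler_wpM2r (mulr_ge0 (ltW h0) C0) hz.
have e3 := ler_wpM2l (mulr_ge0 (mulr_ge0 (ltW h0) (ltW h0)) C0) ccl.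
have e4 := mulr_ge0 (mulr_ge0 (ltW h0) (ltW h0)) C0.
by move: e1 e2 e3 e4; clear; lra.
Qed.
End EdgeTrigonometry.

(** * The angle and the sharp weights *)

Section Theta.
Variable R : realType.

(** Intermediate values: at the left end the cosine vanishes, at the right end the function has the sign
    of c sin 3x - sin x with x = t / 2, and sin 3x <= 3 sin x together with c <= 1/4 makes this nonpositive. *)
Lemma theta_exists (n : nat) (c : R) : (0 < n)%N -> 0 <= c -> c <= 1/4 ->
  exists t, [/\ pi / (2 * n%:R + 1) <= t, t <= pi / (n%:R + 2) &
    2 * sin (t / 2) * cos ((n%:R + 2^-1) * t) + c * sin ((n%:R - 1) * t) = 0].
Proof.
move=> n0 c0 c4; have p0 := pi_gt0 R.
have n1 : 1 <= n%:R :> R by rewrite ler1n.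
pose f t := 2 * sin (t / 2) * cos ((n%:R + 2^-1) * t) + c * sin ((n%:R - 1) * t).
set l := pi / (2 * n%:R + 1); set r := pi / (n%:R + 2).
have l0 : 0 < l by rewrite divr_gt0 //; lra.
have r0 : 0 < r by rewrite divr_gt0 //; lra.
have lE : (2 * n%:R + 1) * l = pi by rewrite mulrC divfK // gt_eqF //; lra.
have rE : (n%:R + 2) * r = pi by rewrite mulrC divfK // gt_eqF //; lra.
have lr : l <= r by rewrite ler_wpM2l ?lef_pV2 ?posrE ?(ltW p0) //; lra.
have fl : 0 <= f l.
  rewrite /f (_ : (n%:R + 2^-1) * l = pi / 2); last by move: lE; clear; lra.
  rewrite cos_pihalf mulr0 add0r mulr_ge0 // sin_ge0_pi //.
  apply/andP; split; first by rewrite mulr_ge0 ?(ltW l0) // subr_ge0.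
  by move: lE l0 (mulr_ge0 (ler0n R n) (ltW l0)); clear; lra.
have fr : f r <= 0.
  set x := r / 2; have rx : r = 2 * x by rewrite /x; clear; lra.
  have -> : f r = 2 * cos (3 * x) * (c * sin (3 * x) - sin x).
    rewrite /f -/x (_ : (n%:R + 2^-1) * r = pi - 3 * x); last by move: rE; rewrite rx; clear; lra.
    rewrite (_ : (n%:R - 1) * r = pi - 2 * (3 * x)); last by move: rE; rewrite rx; clear; lra.
    by rewrite !cosB !sinB cospi sinpi sin_2x; clear; lra.
  have x0 : 0 < x by rewrite /x; lra.
  have x6 : 6 * x <= pi.
    have : r * 3 <= (n%:R + 2) * r by rewrite mulrC; apply: ler_wpM2r; [exact: ltW | lra].
    by rewrite rE rx; clear; lra.
  have c3 : 0 <= cos (3 * x) by apply: cos_ge0_pihalf; apply/andP; split; move: x0 x6 p0; clear; lra.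
  have s0 : 0 <= sin x by apply: sin_ge0_pi; apply/andP; split; move: x0 x6 p0; clear; lra.
  have s3 : 0 <= sin (3 * x) by apply: sin_ge0_pi; apply/andP; split; move: x0 x6 p0; clear; lra.
  rewrite mulr_ge0_le0 ?mulr_ge0 // subr_le0.
  apply: le_trans (ler_wpM2r s3 c4) _.
  rewrite sin_3x; have := mulr_ge0 s0 (sqr_ge0 (sin x)); move: s0; clear; lra.
have fc : {within `[l, r], continuous f}.
  apply: continuous_subspaceT => t; apply: cvgD; apply: cvgM.
  - apply: cvgM; first exact: cvg_cst.
    apply: continuous_comp; last exact: continuous_sin.
    by apply: cvgM; [exact: cvg_id | exact: cvg_cst].
  - apply: continuous_comp; last exact: continuous_cos.
    by apply: cvgM; [exact: cvg_cst | exact: cvg_id].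
  - exact: cvg_cst.
  - apply: continuous_comp; last exact: continuous_sin.
    by apply: cvgM; [exact: cvg_cst | exact: cvg_id].
have [|t] := @IVT R f l r 0 lr fc.
  by rewrite /Num.min /Num.max; case: ltP => h; apply/andP; split=> //; move: fl fr h; clear; lra.
by rewrite in_itv /= => /andP[h1 h2] ft; exists t.
Qed.

(** A sine whose phase is adjusted so that g 0 = b (g 1). The equation for the angle is precisely the
    boundary condition g (n + 1) = a (g n) at the other end. *)
Definition tau_weight (b t : R) i := sin (i%:R * t) - b * sin ((i%:R - 1) * t).

Lemma sin_rec (t y : R) : sin (y + t) + sin (y - t) = (2 - (2 * sin (t / 2)) ^+ 2) * sin y.
Proof.
rewrite sinD sinB; have := cos_2x (t / 2); rewrite (_ : 2 * (t / 2) = t); last by lra.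
by move=> ->; ring.
Qed.

(** With both boundary conditions the boundary terms in the summation by parts cancel: these weights have
    the least ratio of roughness to mass. *)
Lemma tau_rough (n : nat) (a b t : R) : (0 < n)%N -> a + b = 1 ->
  2 * sin (t / 2) * cos ((n%:R + 2^-1) * t) + a * b * sin ((n%:R - 1) * t) = 0 ->
  let w := trunc n (tau_weight b t) in
  rough n a b w = (2 * sin (t / 2)) ^+ 2 * mass n w.
Proof.
move=> n0 ab eqn w; rewrite /w rough_trunc // mass_trunc.
set g := tau_weight b t.
rewrite (@jumps_rec _ n g ((2 * sin (t / 2)) ^+ 2)); last first.
  move=> i; rewrite /g /tau_weight.
  have e1 := sin_rec t (i.+1%:R * t); have e2 := sin_rec t (i%:R * t).
  rewrite mulrBr [_ * (b * _)]mulrCA (_ : (i.+1%:R - 1) * t = i%:R * t); last by rewrite -natr1; ring.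
  rewrite -e1 -e2 -[i.+2%:R]natr1 -[i.+1%:R]natr1.
  rewrite (_ : (i%:R + 1 + 1) * t = (i%:R + 1) * t + t); last by ring.
  rewrite (_ : (i%:R + 1) * t - t = i%:R * t); last by ring.
  rewrite (_ : (i%:R + 1 + 1 - 1) * t = i%:R * t + t); last by ring.
  rewrite (_ : (i%:R - 1) * t = i%:R * t - t); last by ring.
  by ring.
have g0 : g 0%N = b * g 1%N.
  rewrite /g /tau_weight (_ : (0%:R - 1) * t = - t); last by ring.
  rewrite (_ : 0%:R * t = 0); last by ring.
  rewrite (_ : (1%:R - 1) * t = 0); last by ring.
  by rewrite mul1r sinN sin0; ring.
have gn : g n.+1 = a * g n.
  rewrite /g /tau_weight -natr1 (_ : (n%:R + 1 - 1) * t = n%:R * t); last by ring.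
  apply/eqP; rewrite -subr_eq0; apply/eqP; rewrite -[RHS]eqn.
  have -> : 2 * sin (t / 2) * cos ((n%:R + 2^-1) * t) = sin ((n%:R + 1) * t) - sin (n%:R * t).
    rewrite (_ : (n%:R + 1) * t = (n%:R + 2^-1) * t + t / 2); last by lra.
    rewrite (_ : n%:R * t = (n%:R + 2^-1) * t - t / 2); last by lra.
    by rewrite sinD sinB; ring.
  by rewrite (_ : a = 1 - b); [ring | lra].
by rewrite g0 gn (_ : a = 1 - b); [ring | lra].
Qed.

Lemma tau_mass_gt0 (n : nat) (b t : R) : (0 < n)%N -> 0 < t < pi -> 0 < mass n (trunc n (tau_weight b t)).
Proof.
move=> n0 ht; rewrite mass_trunc /mass big_ltn ?ltnS //.
apply: ltr_pwDl; last by rewrite sumr_ge0 // => i _; rewrite sqr_ge0.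
by rewrite exprn_gt0 // /tau_weight subrr mul0r sin0 mulr0 subr0 mul1r sin_gt0_pi.
Qed.

(** All truncated windows are available, also those overhanging an end, so the averaging argument needs
    no allowance; with dl : la as the proportion in Young's inequality it gives exactly (dl + la)^2. *)
Lemma sigma_windows (n N : nat) (a b dl nu t : R) (u eta : nat -> R) E :
  (0 < n)%N -> 0 <= a -> 0 <= b -> a + b = 1 -> 0 < dl ->
  0 < t < pi ->
  2 * sin (t / 2) * cos ((n%:R + 2^-1) * t) + a * b * sin ((n%:R - 1) * t) = 0 ->
  u 0%N = 0 -> u N.+1 = 0 -> 0 < mass N u ->
  (forall v j, (1 <= j <= N)%N ->
     E v j <= (`|v j| * eta j + `|v j.-1 - v j| * (a * u j.-1) + `|v j.+1 - v j| * (b * u j.+1)) ^+ 2) ->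
  \sum_(1 <= j < N.+1) eta j ^+ 2 <= dl ^+ 2 * mass N u ->
  0 <= nu ->
  (forall s v, (1 <= s < N + n)%N -> (forall j, ~~ inwin n s j -> v j = 0) ->
    nu ^+ 2 * (\sum_(1 <= j < N.+1) v j ^+ 2 * u j ^+ 2) <=
    \sum_(1 <= j < N.+1 | inwin n s j) E v j) ->
  nu <= dl + 2 * sin (t / 2).
Proof.
move=> n0 a0 b0 ab d0 ht eqn u0 uN U0 E1 hy nu0 H.
set la := 2 * sin (t / 2).
have l0 : 0 < la.
  by rewrite mulr_gt0 // sin_gt0_pi //; case/andP: ht => *; apply/andP; split; lra.
pose w := trunc n (tau_weight b t).
have W0 : 0 < mass n w by exact: tau_mass_gt0.
have w0 : w 0%N = 0 by [].
have wn : forall i, (n < i)%N -> w i = 0.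
  by move=> i hi; rewrite /w /trunc [(i <= n)%N]leqNgt hi andbF.
have Hs s : (1 <= s < N + n)%N ->
    nu ^+ 2 * (\sum_(1 <= j < N.+1) w (j + n - s)%N ^+ 2 * u j ^+ 2) <=
    \sum_(1 <= j < N.+1 | inwin n s j) E (fun j => w (j + n - s)%N) j + 0.
  move=> hs; rewrite addr0; apply: (H s (fun j => w (j + n - s)%N)) => // j hj.
  by rewrite /w /trunc; case: ifP => //; move: hj; rewrite /inwin; clear; lia.
have := @pool_le R n N a b dl la nu u eta E w (fun=> 0) a0 b0 ab d0 l0 u0 uN E1 hy w0 wn Hs.
rewrite big1 // addr0 (tau_rough n0 ab eqn) -/w -/la.
have -> : (dl + la) * dl * mass n w + (dl + la) / la * (la ^+ 2 * mass n w) = (dl + la) ^+ 2 * mass n w.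
  by field; rewrite gt_eqF.
rewrite -[X in _ <= X]mulrA ler_pM2r ?mulr_gt0 //.
by rewrite ler_pXn2r ?nnegrE // addr_ge0 ?ltW.
Qed.
End Theta.

(** * Sine weights *)

Section EdgeProfile.
Variable R : realType.

(** The situation of the second and third regime: half the angle x, the phase f for which the n-th sine weight is
    sin (f - 3x), and the angle equation of the theorem for windows of length n - 2 in terms of x and f. *)
Record edge (x f a b : R) (n : nat) : Prop := Edge {
  e_x : 0 < x; e_f : 16/3 * x <= f; e_f2 : f <= pi / 2;
  e_n : (2 * n%:R - 3) * x = pi - f; e_n5 : (4 < n)%N;
  e_a : a = 1 - b; e_b0 : 0 < b; e_b2 : b <= 1/2;
  e_rel : a * b * sin (f + 3 * x) = 2 * sin x * cos f }.

Definition sine (x : R) (i : nat) := sin (i%:R * (2 * x)).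

Lemma edge_7 x f a b n : edge x f a b n -> f + 7 * x <= pi.
Proof.
case=> x0 _ _ nx n5 _ _ _ _.
have : 5%:R * x <= n%:R * x by rewrite ler_pM2r // ler_nat.
by move: nx; clear; lra.
Qed.

Lemma edge_ed x f a b n : edge x f a b n ->
  edge_data (sin x) (cos x) (sin f) (cos f) a b (sin x ^+ 2) (3 - 4 * sin x ^+ 2)
     (cos (3 * x)) (sin (f - 3 * x)) (sin (f + 3 * x)) (a * b).
Proof. by move=> e; have := edge_7 e; case: e => *; apply: edge_data_intro. Qed.

Lemma sine_shift x f (n i : nat) (c : R) : (2 * n%:R - 3) * x = pi - f ->
  i%:R = n%:R + c -> sine x i = sin (f - (3 + 2 * c) * x).
Proof.
move=> nx ic; rewrite /sine.
have -> : i%:R * (2 * x) = pi - (f - (3 + 2 * c) * x) by rewrite ic; move: nx; clear; lra.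
by rewrite sinB sinpi cospi; ring.
Qed.

Lemma sine_n x f (n : nat) : (2 * n%:R - 3) * x = pi - f -> sine x n = sin (f - 3 * x).
Proof. by move=> nx; rewrite (@sine_shift _ _ _ _ 0 nx) ?addr0 //; congr sin; ring. Qed.

Lemma sine_nS x f (n : nat) : (2 * n%:R - 3) * x = pi - f -> sine x n.+1 = sin (f - 5 * x).
Proof. by move=> nx; rewrite (@sine_shift _ _ _ _ 1 nx) ?natr1 //; congr sin; ring. Qed.

Lemma sine_np x f (n : nat) : (0 < n)%N -> (2 * n%:R - 3) * x = pi - f -> sine x n.-1 = sin (f - x).
Proof.
move=> n0 nx; rewrite (@sine_shift _ _ _ _ (-1) nx) //; first by congr sin; ring.
by rewrite -[in RHS](prednK n0) -natr1; ring.
Qed.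

Lemma sine_rec x i : sine x i.+2 + sine x i = (2 - (2 * sin x) ^+ 2) * sine x i.+1.
Proof.
have := sin_rec (2 * x) (i.+1%:R * (2 * x)).
rewrite (_ : 2 * x / 2 = x); last by field.
rewrite /sine => <-; congr (sin _ + sin _); rewrite -?[i.+2%:R]natr1 -?[i.+1%:R]natr1; ring.
Qed.

Lemma sine0 x : sine x 0%N = 0. Proof. by rewrite /sine mul0r sin0. Qed.

Lemma sine1 x : sine x 1%N = 2 * sin x * cos x.
Proof. by rewrite /sine mul1r sin_2x. Qed.

Lemma jumps_sine x m : jumps m (sine x) = (2 * sin x) ^+ 2 * mass m (sine x) - sine x m * (sine x m - sine x m.+1).
Proof. by rewrite (jumps_rec _ (sine_rec x)) sine0 mul0r addr0. Qed.

Lemma mass_sine x m : 4 * sin (2 * x) * mass m (sine x) = (2 * m%:R + 1) * sin (2 * x) - sin ((2 * m%:R + 1) * (2 * x)).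
Proof.
elim: m => [|m IH]; first by rewrite /mass big_geq // (_ : (2 * 0%:R + 1 = 1 :> R)) ?mul1r; ring.
have -> : mass m.+1 (sine x) = mass m (sine x) + sine x m.+1 ^+ 2 by rewrite /mass big_nat_recr.
rewrite mulrDr IH /sine -![m.+1%:R]natr1.
set y := (m%:R + 1) * (2 * x).
have -> : (2 * (m%:R + 1) + 1) * (2 * x) = 2 * y + 2 * x by rewrite /y; ring.
have -> : (2 * m%:R + 1) * (2 * x) = 2 * y - 2 * x by rewrite /y; ring.
rewrite [sin (2 * y - _)]sinB [sin (2 * y + _)]sinD [cos (2 * y)]cos_2x; ring.
Qed.

Lemma sin_2piB (y : R) : sin (2 * pi - y) = - sin y.
Proof. by rewrite sinB (mulr_natl pi 2) sin2pi cos2pi; ring. Qed.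

Lemma mass_sine_ge x f (n : nat) : 0 < x -> 4 * x <= f -> f <= pi / 2 -> (2 * n%:R - 3) * x = pi - f ->
  (2 * n%:R + 1) / 4 <= mass n (sine x).
Proof.
move=> x0 f4 f2 nx.
have s0 : 0 < sin (2 * x) by apply: sin_gt0_pi; apply/andP; split; have := pi_gt0 R; lra.
have s40 : 0 < 4 * sin (2 * x) by rewrite mulr_gt0.
rewrite -(ler_pM2l s40) mass_sine.
have -> : (2 * n%:R + 1) * (2 * x) = 2 * pi - (2 * f - 8 * x) by move: nx; clear; lra.
have : 0 <= sin (2 * f - 8 * x) by apply: sin_ge0_pi; apply/andP; split; lra.
rewrite sin_2piB; clear; lra.
Qed.

Lemma mass_sine_le x (P : nat) : 0 < x -> 4 * x <= pi -> P%:R * (2 * x) < pi -> pi <= P.+1%:R * (2 * x) ->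
  mass P (sine x) <= (P%:R + 1) / 2.
Proof.
move=> x0 x4 P1; rewrite -[P.+1%:R]natr1 => P2.
have s0 : 0 < sin (2 * x) by apply: sin_gt0_pi; apply/andP; split; lra.
have s40 : 0 < 4 * sin (2 * x) by rewrite mulr_gt0.
rewrite -(ler_pM2l s40) mass_sine.
have -> : (2 * P%:R + 1) * (2 * x) = 2 * pi - (2 * (pi - P%:R * (2 * x)) - 2 * x) by clear; lra.
rewrite sin_2piB.
have : sin (2 * (pi - P%:R * (2 * x)) - 2 * x) <= sin (2 * x) by apply: le_sin; lra.
clear; lra.
Qed.

(** The index P is the last one before the sine weights change sign. *)
Lemma turning_index (x : R) : 0 < x -> exists P : nat, P%:R * (2 * x) < (pi : R) /\ (pi : R) <= P.+1%:R * (2 * x).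
Proof.
move=> x0; have p0 := pi_gt0 R.
pose Q (m : nat) := (pi : R) <= m%:R * (2 * x).
have ex : exists m : nat, Q m.
  exists (Num.bound (pi / (2 * x))); rewrite /Q -ler_pdivrMr ?mulr_gt0 //; apply: ltW.
  by apply: archi_boundP; rewrite divr_ge0 ?ltW ?mulr_gt0.
case: (ex_minnP ex) => -[|P] h1 h2; first by move: h1; rewrite /Q mul0r leNgt p0.
exists P; split => //; rewrite ltNge; apply/negP => /h2.
by rewrite ltnn.
Qed.

(** The surplus a w_n - w_(n+1) of the sine weights at the edge, evaluated by [tail_identity]. *)
Lemma tail_pos x f a b n : edge x f a b n ->
  0 <= a * sin (f - 3 * x) - sin (f - 5 * x) /\
  (2 * sin x) ^+ 2 * (cos x * (1 - 2 * sin x ^+ 2) * (2 - 3 * b)) <=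
    (a * sin (f - 3 * x) - sin (f - 5 * x)) * sin f.
Proof.
move=> e; have ed := edge_ed e; have tan1 := ed_tan1 ed; have hC := ed_hC ed; have ccl := cc_lb ed.
have H1 := ed_H1 ed; have H0 := ed_H0 ed.
have [h0 cc0 S0 C0] : [/\ 0 < sin x, 0 < cos x, 0 < sin f & 0 < cos f] by case: ed.
case: e => x0 f1 f2 nx n5 aE b0 b2 rel.
have ab : a + b = 1 by rewrite aE subrK.
have a0 : 1/2 <= a by rewrite aE; move: b2; clear; lra.
have id := tail_identity ab rel.
set K := a * _ - _ in id *.
have D1 : sin (f + x) - b * sin (f + 3 * x) <= sin f * cos x.
  have k1 : a * (b * sin (f + 3 * x)) <= 1 * (b * sin (f + 3 * x)).
    apply: ler_wpM2r; last by move: b0 aE; clear; lra.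
    rewrite mulr_ge0 ?(ltW b0) //.
    have ab0 : 0 < a * b by rewrite mulr_gt0 //; move: a0; clear; lra.
    by rewrite -(pmulr_rge0 _ ab0) rel !mulr_ge0 // ltW.
  by move: k1; rewrite mulrA rel [sin (f + x)]sinD; move: hC; clear; lra.
have D0 : 0 < sin (f + x) - b * sin (f + 3 * x).
  have ap : 0 < a by move: a0; clear; lra.
  rewrite -(pmulr_rgt0 _ ap).
  have -> : a * (sin (f + x) - b * sin (f + 3 * x)) = a * (sin f * cos x) + a * (sin x * cos f) - 2 * (sin x * cos f).
    by rewrite mulrBr [a * (b * _)]mulrA rel [sin (f + x)]sinD; ring.
  have k1 : 96/100 * sin f <= sin f * cos x.
    by rewrite mulrC; apply: ler_wpM2l; [exact: ltW | move: ccl H1; clear; lra].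
  have k2 : 5 * (sin x * cos f) <= sin f.
    apply: le_trans tan1; rewrite mulrC; apply: ler_wpM2l; first exact: ltW.
    by move: H0; clear; lra.
  have := ler_wpM2r (ltW S0) a0; have := ler_wpM2r (ltW hC) a0.
  have := ler_wpM2l (ltW ap) k1.
  by move: k2 hC; clear; lra.
have num : (2 * sin x * cos x) ^+ 2 * ((1 - 2 * sin x ^+ 2) * (2 - 3 * b)) <= sin (2 * x) * (sin (4 * x) - b * sin (6 * x)).
  have -> : 4 * x = 2 * (2 * x) by ring.
  have -> : 6 * x = 3 * (2 * x) by ring.
  rewrite [sin (2 * (2 * x))]sin_2x [sin (3 * _)]sin_3x cos_2x.
  have := cos2sin2 (2 * x); rewrite cos_2x => c2.
  have -> : sin (2 * x) ^+ 2 = 1 - (1 - 2 * sin x ^+ 2) ^+ 2 by rewrite c2; ring.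
  rewrite -sin_2x; set s := sin (2 * x); set H := sin x ^+ 2.
  have : 0 <= s ^+ 2 * (b * (2 * H * (5 - 8 * H))).
    apply: mulr_ge0; first exact: sqr_ge0.
    apply: mulr_ge0; first exact: ltW.
    by apply: mulr_ge0; move: H1 H0; rewrite -/H; clear; lra.
  by clear; lra.
have num0 : 0 <= (2 * sin x * cos x) ^+ 2 * ((1 - 2 * sin x ^+ 2) * (2 - 3 * b)).
  apply: mulr_ge0; first exact: sqr_ge0.
  by apply: mulr_ge0; move: H1 b2; clear; lra.
have K0 : 0 <= K by rewrite -(pmulr_lge0 _ D0) id; apply: le_trans num.
split=> //.
rewrite -(ler_pM2r cc0).
have -> : (2 * sin x) ^+ 2 * (cos x * (1 - 2 * sin x ^+ 2) * (2 - 3 * b)) * cos x =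
  (2 * sin x * cos x) ^+ 2 * ((1 - 2 * sin x ^+ 2) * (2 - 3 * b)) by ring.
apply: le_trans num _; rewrite -id -mulrA; exact: ler_wpM2l.
Qed.

(** The squares in the tail are dominated by the differences of G y = sin y sin (y + x) sin (y + 2x), so
    that the sum telescopes. *)
Lemma rho_bound x f a b n P : edge x f a b n -> P%:R * (2 * x) < pi -> pi <= P.+1%:R * (2 * x) -> (n <= P)%N ->
  6 * sin x * cos f * tail_mass n P (sine x) <= 102/100 * sin f * (sin f ^+ 2 - sin x ^+ 2).
Proof.
move=> e P1 P2 nP; have ed := edge_ed e; have tan1 := ed_tan1 ed; have hC := ed_hC ed; have ccl := cc_lb ed.
have H1 := ed_H1 ed; have H0 := ed_H0 ed.
have [h0 cc0 S0 C0] : [/\ 0 < sin x, 0 < cos x, 0 < sin f & 0 < cos f] by case: ed.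
case: e => x0 f1 f2 nx n5 aE b0 b2 rel.
have n0 : (0 < n)%N by move: n5; clear; lia.
have p0 := pi_gt0 R.
pose z (i : nat) := pi - i%:R * (2 * x).
have zS i : z i.+1 = z i - 2 * x by rewrite /z -[i.+1%:R]natr1; ring.
have zn : z n.-1 = f - x.
  have : n.-1%:R + 1 = n%:R :> R by rewrite natr1 prednK.
  by rewrite /z; move: nx; clear; nra.
pose G y := sin y * sin (y + x) * sin (y + 2 * x).
have Gstep y : G y - G (y - 2 * x) = 2 * sin y ^+ 2 * cos y * sin (3 * x).
  have e1 := prod_sin (y + x) (y + 2 * x); have e2 := prod_sin (y - 2 * x) (y - x).
  have -> : G y - G (y - 2 * x) = sin y * (sin (y + x) * sin (y + 2 * x) - sin (y - 2 * x) * sin (y - x)).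
    rewrite /G (_ : y - 2 * x + 2 * x = y); last by ring.
    by rewrite (_ : y - 2 * x + x = y - x); ring.
  have r1 : cos (y + x - (y + 2 * x)) = cos x by rewrite -cosN; congr cos; ring.
  have r2 : cos (y - 2 * x - (y - x)) = cos x by rewrite -cosN; congr cos; ring.
  have r3 : y + x + (y + 2 * x) = 2 * y + 3 * x by ring.
  have r4 : y - 2 * x + (y - x) = 2 * y - 3 * x by ring.
  rewrite r1 r3 in e1; rewrite r2 r4 in e2.
  have e3 : sin (y + x) * sin (y + 2 * x) - sin (y - 2 * x) * sin (y - x) = sin (2 * y) * sin (3 * x).
    move: e1 e2; rewrite [cos (2 * y + _)]cosD [cos (2 * y - _)]cosB; clear; lra.
  by rewrite e3 sin_2x; ring.
have sz i : sine x i = sin (z i).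
  by rewrite /sine /z sinB sinpi cospi; ring.
have step i : (n.-1 <= i < P.+1)%N -> 6 * sin x * cos f * sine x i ^+ 2 <= G (z i) - G (z i.+1).
  move=> /andP[i1 i2]; rewrite zS Gstep sz.
  have zlo : 0 <= z i.
    have : i%:R * (2 * x) <= P%:R * (2 * x) by apply: ler_wpM2r; rewrite ?mulr_ge0 ?(ltW x0) // ler_nat.
    by rewrite /z; move: P1; clear; lra.
  have zhi : z i <= f - x.
    rewrite -zn /z lerD2l lerN2; apply: ler_wpM2r; rewrite ?mulr_ge0 ?(ltW x0) //.
    by rewrite ler_nat.
  have cz : cos (f - x) <= cos (z i) by apply: le_cos => //; lra.
  have cf : cos f * (1 + 48/10 * sin x ^+ 2) <= cos (f - x).
    rewrite cosB.
    have k1 : cos f * (1 - 52/100 * sin x ^+ 2) <= cos f * cos x by apply: ler_wpM2l => //; exact: ltW.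
    have k2 := ler_wpM2l (ltW h0) tan1.
    have k3 : 0 <= sin x ^+ 2 * (cos f * sin x ^+ 2) by rewrite mulr_ge0 ?sqr_ge0 // mulr_ge0 ?sqr_ge0 ?(ltW C0).
    by move: k1 k2 k3 (mulr_ge0 (ltW C0) (ltW H0)); clear; lra.
  have k : 6 * sin x * cos f <= 2 * cos (z i) * sin (3 * x).
    rewrite sin_3x.
    have m0 : 0 <= sin x * (3 - 4 * sin x ^+ 2) by rewrite mulr_ge0 ?(ltW h0) //; move: H1; clear; lra.
    have := ler_wpM2r m0 (le_trans cf cz).
    have := mulr_ge0 (mulr_ge0 (ltW hC) (ltW H0)) (_ : 0 <= 104/10 - 192/10 * sin x ^+ 2).
    by move=> /(_ ltac:(move: H1; clear; lra)); clear; lra.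
  have := ler_wpM2r (sqr_ge0 (sin (z i))) k.
  by clear; lra.
have tele : 6 * sin x * cos f * tail_mass n P (sine x) <= G (z n.-1) - G (z P.+1).
  rewrite /tail_mass mulr_sumr; apply: le_trans (ler_sum_nat step) _.
  rewrite (eq_bigr (fun i => - (G (z i.+1) - G (z i)))); last by move=> i _; ring.
  rewrite sumrN telescope_sumr ?opprB //.
  by move: nP; clear; lia.
apply: le_trans tele _.
have Gn : G (z n.-1) = sin f * (sin f ^+ 2 - sin x ^+ 2).
  rewrite zn /G (_ : f - x + x = f); last by rewrite subrK.
  rewrite (_ : f - x + 2 * x = f + x); last by ring.
  rewrite sinB sinD.
  have c1 := cos2sin2 x; have c2 := cos2sin2 f.
  have -> : (sin f * cos x - cos f * sin x) * sin f * (sin f * cos x + cos f * sin x) =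
    sin f * (sin f ^+ 2 * cos x ^+ 2 - cos f ^+ 2 * sin x ^+ 2) by ring.
  by rewrite c1 c2; ring.
set y := z P - x.
have Gy : G (z P.+1) = sin y * (sin y ^+ 2 - sin x ^+ 2).
  have -> : z P.+1 = y - x by rewrite zS /y; ring.
  rewrite /G (_ : y - x + x = y); last by rewrite subrK.
  rewrite (_ : y - x + 2 * x = y + x); last by ring.
  rewrite sinB sinD.
  have c1 := cos2sin2 x; have c2 := cos2sin2 y.
  have -> : (sin y * cos x - cos y * sin x) * sin y * (sin y * cos x + cos y * sin x) =
    sin y * (sin y ^+ 2 * cos x ^+ 2 - cos y ^+ 2 * sin x ^+ 2) by ring.
  by rewrite c1 c2; ring.
have zP : 0 < z P /\ z P <= 2 * x.
  by rewrite /z; move: P1 P2; rewrite -[P.+1%:R]natr1; clear; lra.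
have x6 : x <= pi / 2 by move: f1 f2 x0; clear; lra.
have [zP1 zP2] := zP.
have sy1 : sin y <= sin x by apply: le_sin; move: zP1 zP2 x6 x0; rewrite /y; clear; lra.
have sy2 : - sin x <= sin y.
  by rewrite -sinN; apply: le_sin; move: zP1 zP2 x6 x0; rewrite /y; clear; lra.
(* The minimum of s^3 - s h^2 lies at s = h / sqrt 3, and 577/1000 is close to 1 / sqrt 3. *)
have Gl : - (4/10) * sin x ^+ 3 <= G (z P.+1).
  rewrite Gy; set h := sin x in h0 sy1 sy2 *; set s := sin y in sy1 sy2 *.
  have k := mulr_ge0 (sqr_ge0 (s - 577/1000 * h)) (_ : 0 <= s + 1154/1000 * h).
  have {}k := k ltac:(move: sy2 h0; clear; lra).
  have k2 := mulr_ge0 (sqr_ge0 h) (_ : 0 <= h + s).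
  have {}k2 := k2 ltac:(move: sy2; clear; lra).
  have k3 := mulr_ge0 (sqr_ge0 h) (_ : 0 <= h - s).
  have {}k3 := k3 ltac:(move: sy1; clear; lra).
  by move: k k2 k3; clear; lra.
have S3 : 3 * sin x <= sin f.
  rewrite leNgt; apply/negP => hlt.
  have k1 := ltr_pM (ltW S0) (ltW S0) hlt hlt.
  have k2 : (16/3 * (sin x * cos f)) ^+ 2 <= sin f ^+ 2.
    have t0 : 0 <= 16/3 * (sin x * cos f) by rewrite mulr_ge0 ?(ltW hC).
    rewrite ler_pXn2r ?nnegrE ?(ltW S0) //.
    apply: le_trans tan1; have := mulr_ge0 (ltW hC) (ltW H0); clear; lra.
  have k3 := cos2sin2 f.
  have e4 : (16/3 * (sin x * cos f)) ^+ 2 = 256/9 * (sin x ^+ 2 * cos f ^+ 2) by field.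
  rewrite e4 k3 in k2.
  have k4 : sin x ^+ 2 * sin f ^+ 2 <= 67/1000 * sin f ^+ 2 by apply: ler_wpM2r H1; exact: sqr_ge0.
  by move: k1 k2 k4 H0; clear; lra.
have S9 : 8 * sin x ^+ 2 <= sin f ^+ 2 - sin x ^+ 2.
  have h3 : 0 <= 3 * sin x by rewrite mulr_ge0 // ltW.
  by have := ler_pM h3 h3 S3 S3; clear; lra.
have fin : 24 * sin x ^+ 3 <= sin f * (sin f ^+ 2 - sin x ^+ 2).
  have -> : 24 * sin x ^+ 3 = (3 * sin x) * (8 * sin x ^+ 2) by ring.
  by apply: ler_pM => //; rewrite mulr_ge0 // ?sqr_ge0 // ltW.
rewrite Gn; have h3 : 0 < sin x ^+ 3 by rewrite exprn_gt0.
by move: Gl fin h3; clear; lra.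
Qed.
End EdgeProfile.

Section TaperBudgets.
Variable R : realType.
Implicit Types x f a b : R.

(** For n = 5 the phase is so close to pi / 2 that the angle equation would force a b below what b >= sin x
    allows. *)
Lemma edge_n6 x f a b n : edge x f a b n -> sin x <= b -> (5 < n)%N.
Proof.
move=> e hb; have ed := edge_ed e; have C3l := C3_lb ed; have bx0 := b_le_box0 ed.
have H1 := ed_H1 ed; have H0 := ed_H0 ed.
have [h0 cc0 S0 C0] : [/\ 0 < sin x, 0 < cos x, 0 < sin f & 0 < cos f] by case: ed.
case: e => x0 f1 f2 nx n5 aE b0 b2 rel.
rewrite ltn_neqAle eq_sym n5 andbT; apply/negP => /eqP n5E.
have x7 : 7 * x = pi - f by move: nx; rewrite n5E; clear; lra.
have C1 : cos f <= 5/6 * x.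
  have -> : cos f = sin (pi / 2 - f) by rewrite sin_pihalfB.
  apply: le_trans (sin_le_id _) _; move: x7 f1 f2; clear; lra.
have xh : 98/100 * x <= sin x by apply: x_le_sin => //; move: x7 f1 x0; clear; lra.
have hmax : sin x <= 259/1000.
  rewrite leNgt; apply/negP => hh.
  have k : 0 <= 259/1000 :> R by clear; lra.
  by have := ltr_pM k k hh hh; move: H1; clear; lra.
have C2 : cos f <= 851/1000 * sin x by move: C1 xh h0; clear; lra.
have q1 : 74/100 * sin x <= a * b.
  have k : 0 <= (b - sin x) * (1 - b - sin x).
    by apply: mulr_ge0; move: hb bx0 hmax; clear; lra.
  have k2 : 0 <= sin x * (259/1000 - sin x) by apply: mulr_ge0; move: h0 hmax; clear; lra.
  by rewrite aE; move: k k2 h0; clear; lra.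
have s2lo : 67/100 <= sin (f + 3 * x).
  have S97 : 97/100 <= sin f.
    rewrite leNgt; apply/negP => hlt.
    have := ltr_pM (ltW S0) (ltW S0) hlt hlt; have := sin2cos2 f => sc.
    have := ler_pM (ltW C0) (ltW C0) C2 C2.
    by move: sc H1; clear; lra.
  have c3 : 697/1000 <= cos (3 * x) by move: C3l H1; clear; lra.
  have s3 : 0 <= sin (3 * x).
    by rewrite sin_3x mulr_ge0 ?(ltW h0) //; move: H1; clear; lra.
  rewrite sinD.
  have k0 : 0 <= 97/100 :> R by clear; lra.
  have k1 : 0 <= 697/1000 :> R by clear; lra.
  have := ler_pM k0 k1 S97 c3; have := mulr_ge0 (ltW C0) s3.
  by clear; lra.
have k0 : 0 <= 74/100 * sin x by move: h0; clear; lra.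
have k1 : 0 <= 67/100 :> R by clear; lra.
have := ler_pM k0 k1 q1 s2lo; rewrite rel.
have := ler_wpM2l (ltW h0) C2; have := ler_wpM2l (ltW h0) hmax.
by move: h0; clear; nra.
Qed.

(** With n >= 6 the relation between x and f gives (9 + 16/3) x <= pi. *)
Lemma edge_small x f a b n : edge x f a b n -> sin x <= b -> sin x <= 2237/10000.
Proof.
move=> e hb; have n6 := edge_n6 e hb.
case: e => x0 f1 f2 nx n5 aE b0 b2 rel.
have k : 6%:R * x <= n%:R * x by rewrite ler_pM2r // ler_nat.
apply: le_trans (sin_le_id (ltW x0)) _.
have := pi_le3_2 R; move: k nx f1; clear; lra.
Qed.

(** The mass of the sine weights is about n / 2, the number of extended weights is determined by f, and the
    tail is bounded by [rho_bound]; [window_core] compares them. *)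
Lemma taper_mass x f a b n P dl : edge x f a b n -> P%:R * (2 * x) < pi -> pi <= P.+1%:R * (2 * x) ->
  (n <= P)%N -> sin x <= b -> dl <= 2 * b - 2 * sin x ->
  sine x n.-1 ^+ 2 + (2 * sin x) ^+ 2 * mass P (sine x) + 4 * dl * tail_mass n P (sine x) <= 2 * (2 * sin x) * mass n (sine x).
Proof.
move=> e P1 P2 nP hb hdl; have ed := edge_ed e; have hs := edge_small e hb.
have rb := rho_bound e P1 P2 nP.
have [h0 cc0 S0 C0] : [/\ 0 < sin x, 0 < cos x, 0 < sin f & 0 < cos f] by case: ed.
have r0 : 0 <= tail_mass n P (sine x) by apply: sumr_ge0 => i _; exact: sqr_ge0.
have wc := window_core ed r0 rb hs hb.
have f7 := edge_7 e.
case: e => x0 f1 f2 nx n5 aE b0 b2 rel.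
have n0 : (0 < n)%N by move: n5; clear; lia.
have gp : sine x n.-1 ^+ 2 = (sin f * cos x - cos f * sin x) ^+ 2 by rewrite (sine_np n0 nx) sinB.
have f4 : 4 * x <= f by move: f1 x0; clear; lra.
have x4 : 4 * x <= pi by move: f7 f1 x0; clear; lra.
have Wl := mass_sine_ge x0 f4 f2 nx.
have SPu := mass_sine_le x0 x4 P1 P2.
have hx : sin x <= x by exact: sin_le_id (ltW x0).
have xh : 98/100 * x <= sin x by apply: x_le_sin => //; move: f7 f1 x0; clear; lra.
have pi3 := pi_ge3 R; have pi32 := pi_le3_2 R.
have Cf : cos f <= pi / 2 - f.
  have -> : cos f = sin (pi / 2 - f) by rewrite sin_pihalfB.
  by apply: sin_le_id; move: f2; clear; lra.
have e1 : 4 * dl * tail_mass n P (sine x) <= 8 * (b - sin x) * tail_mass n P (sine x).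
  by apply: ler_wpM2r => //; move: hdl; clear; lra.
have e2 : (2 * sin x) ^+ 2 * mass P (sine x) <= (2 * sin x) ^+ 2 * ((P%:R + 1) / 2).
  by apply: ler_wpM2l => //; exact: sqr_ge0.
have e3 : 2 * (2 * sin x) * ((2 * n%:R + 1) / 4) <= 2 * (2 * sin x) * mass n (sine x).
  by apply: ler_wpM2l => //; rewrite !mulr_ge0 // ltW.
(* P is about n + f / (2x), because P is the last index with 2 P x < pi. *)
have hP : 2 * sin x ^+ 2 * (P%:R + 1) <= 2 * sin x ^+ 2 * n%:R - sin x ^+ 2 + 16/10 * sin x.
  have k1 : 2 * x * (P%:R + 1) <= x * (2 * n%:R - 1) + f by move: P1 nx; clear; lra.
  have k2 : sin x * (2 * (P%:R + 1) - (2 * n%:R - 1)) <= f.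
    have [k3|k3] := lerP 0 (2 * (P%:R + 1) - (2 * n%:R - 1) : R).
      by have := ler_wpM2r k3 hx; move: k1; clear; lra.
    have : sin x * (2 * (P%:R + 1) - (2 * n%:R - 1)) <= 0 by rewrite mulr_ge0_le0 ?ltW.
    by move: f1 x0; clear; lra.
  have f16 : f <= 16/10 by move: f2 pi32; clear; lra.
  have := ler_wpM2l (ltW h0) (le_trans k2 f16).
  by clear; lra.
have hn : (1 - sin x) * (147/100 + 98/100 * cos f + 294/100 * sin x) <= (1 - sin x) * (2 * sin x * n%:R).
  apply: ler_wpM2l; first by move: hs; clear; lra.
  have k1 : 98/100 * (2 * x * n%:R) <= 2 * sin x * n%:R.
    by have := ler_wpM2r (ler0n R n) xh; clear; lra.
  by move: k1 nx Cf hx pi3; clear; lra.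
rewrite gp; have := sqr_ge0 (sin x); move: wc e1 e2 e3 hP hn h0; clear; lra.
Qed.

Lemma taper_step x f a b n P : edge x f a b n -> P%:R * (2 * x) < pi -> pi <= P.+1%:R * (2 * x) ->
  (n <= P)%N ->
  jumps n (sine x) + 4/3 * b ^+ 2 * tail_mass n P (sine x) - a * b * sine x 1%N ^+ 2 <= (2 * sin x) ^+ 2 * mass n (sine x).
Proof.
move=> e P1 P2 nP; have ed := edge_ed e.
have tc := taper_core ed (rho_bound e P1 P2 nP).
case: e => x0 f1 f2 nx n5 aE b0 b2 rel.
rewrite jumps_sine (sine_n nx) (sine_nS nx) sine1.
have gap : sin (f - 3 * x) - sin (f - 5 * x) =
   2 * sin x * (cos f * (1 - 8 * sin x ^+ 2 * (1 - sin x ^+ 2)) + sin f * (4 * sin x * cos x * (1 - 2 * sin x ^+ 2))).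
  have -> : f - 3 * x = f - 4 * x + x by ring.
  have -> : f - 5 * x = f - 4 * x - x by ring.
  rewrite [sin (f - 4 * x + x)]sinD [sin (f - 4 * x - x)]sinB cosB.
  have -> : 4 * x = 2 * (2 * x) by ring.
  rewrite [cos (2 * (2 * x))]cos_2x [sin (2 * (2 * x))]sin_2x cos_2x sin_2x.
  have c2 := cos2sin2 x.
  have -> : (2 * sin x * cos x) ^+ 2 = 4 * sin x ^+ 2 * (1 - sin x ^+ 2) by rewrite -c2; ring.
  by ring.
rewrite gap; move: tc; clear; lra.
Qed.

(** Further right no tail occurs and the nonnegative surplus at the edge is enough. *)
Lemma taper_flat x f a b n : edge x f a b n ->
  jumps n (sine x) + b * sine x n ^+ 2 - a * b * sine x 1%N ^+ 2 <= (2 * sin x) ^+ 2 * mass n (sine x).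
Proof.
move=> e; have [K0 _] := tail_pos e.
case: e => x0 f1 f2 nx n5 aE b0 b2 rel.
rewrite jumps_sine (sine_n nx) (sine_nS nx).
have s0 : 0 <= sin (f - 3 * x).
  have p0 := pi_gt0 R.
  by apply: sin_ge0_pi; apply/andP; split; move: p0 x0 f1 f2; clear; lra.
have ab0 : 0 <= a * b * sine x 1%N ^+ 2.
  by apply: mulr_ge0; [apply: mulr_ge0; move: b0 b2; rewrite ?aE; clear; lra | exact: sqr_ge0].
by have := mulr_ge0 s0 K0; move: ab0; rewrite aE; clear; lra.
Qed.

Lemma taper_jumps x P : 0 < x -> P%:R * (2 * x) < pi -> pi <= P.+1%:R * (2 * x) -> 2 * x <= pi ->
  jumps P.+1 (trunc P (sine x)) <= (2 * sin x) ^+ 2 * mass P (sine x).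
Proof.
move=> x0 P1 P2 x2; rewrite jumps_truncS ?sine0 // jumps_sine.
have s0 : 0 <= sine x P.
  by apply: sin_ge0_pi; rewrite (ltW P1) andbT mulr_ge0 ?ler0n // mulr_ge0 // ltW.
have s1 : sine x P.+1 <= 0.
  have : 0 <= sin (P.+1%:R * (2 * x) - pi).
    apply: sin_ge0_pi; move: P1 P2 x2; rewrite -[P.+1%:R]natr1 => P1 P2 x2.
    by apply/andP; split; move: P1 P2 x2; clear; lra.
  by rewrite sinB sinpi cospi /sine; clear; lra.
have : sine x P * sine x P.+1 <= 0 by rewrite mulr_ge0_le0.
by clear; lra.
Qed.
End TaperBudgets.

(** * Windows of full length only *)

(** Cauchy-Schwarz for the row with weights x d, y, z, the residual being measured in units of d. *)
Lemma row_cauchy (R : realFieldType) (x y z d e u1 u2 : R) : 0 <= x -> 0 <= y -> 0 <= z -> 0 < d ->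
  d * (x * e + y * u1 + z * u2) ^+ 2 <= (x * d + y + z) * (x * e ^+ 2 + d * (y * u1 ^+ 2 + z * u2 ^+ 2)).
Proof.
move=> x0 y0 z0 d0.
have k1 := mulr_ge0 (mulr_ge0 x0 y0) (sqr_ge0 (e - d * u1)).
have k2 := mulr_ge0 (mulr_ge0 x0 z0) (sqr_ge0 (e - d * u2)).
have k3 := mulr_ge0 (mulr_ge0 (mulr_ge0 y0 z0) (ltW d0)) (sqr_ge0 (u1 - u2)).
lra.
Qed.

(** A surplus s in the roughness of the weights pays for the extra cost cl. *)
Lemma pool_close (R : realFieldType) (nu dl la W U s cl Q : R) : 0 < dl -> 0 < la -> 0 < W -> 0 < U -> 0 <= nu ->
  Q = la ^+ 2 * W - s -> cl <= (dl + la) / la * s ->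
  nu ^+ 2 * (W * U) <= ((dl + la) * dl * W + (dl + la) / la * Q + cl) * U -> nu <= dl + la.
Proof.
move=> d0 l0 W0 U0 n0 -> hc.
rewrite mulrA ler_pM2r // => h.
have : nu ^+ 2 * W <= (dl + la) ^+ 2 * W.
  have e : (dl + la) / la * (la ^+ 2 * W - s) = (dl + la) * la * W - (dl + la) / la * s.
    by field; rewrite gt_eqF.
  by move: h hc; rewrite e; clear; lra.
by rewrite ler_pM2r // ler_pXn2r ?nnegrE // addr_ge0 ?ltW.
Qed.

Section Regimes.
Variable R : realType.

(** Sine weights with the angle of windows of length n - 2 are smoother than required for length n; the
    surplus consists of a part at the first weight and a part at the last weight. *)
Lemma sine_rough (x : R) (n : nat) (a b : R) : (0 < n)%N -> a + b = 1 ->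
  rough n a b (trunc n (sine x)) = (2 * sin x) ^+ 2 * mass n (sine x) -
    (b * sine x 1%N ^+ 2 + sine x n * (a * sine x n - sine x n.+1)).
Proof.
move=> n0 ab; rewrite rough_trunc // ab (jumps_rec _ (sine_rec x)) sine0.
by rewrite (_ : a = 1 - b); [ring | rewrite -ab addrK].
Qed.

(** The three regimes. If f <= 16 x / 3, the windows are wide enough in relation to the angle for zero padding
    at both ends. Otherwise the padding on the right is still paid by the first weight, and for the left end the
    strength b of the leak decides: for 2 b <= dl + la the adjoint bound is strong, and otherwise x is small and
    tapered windows apply. *)
Lemma hat_half (N n : nat) (a b dl nu : R) u eta p q E (x f : R) :
  chain N n a b dl nu u eta p q E -> (2 < n)%N -> (n <= N)%N ->
  a = 1 - b -> 0 <= b -> b <= 1/2 -> 0 < dl -> 0 < mass N u -> 0 <= nu ->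
  0 < x -> 3 * x <= f -> f <= pi / 2 -> (2 * n%:R - 3) * x = pi - f ->
  a * b * sin (f + 3 * x) = 2 * sin x * cos f ->
  nu <= dl + 2 * sin x.
Proof.
move=> ch n3 nN aE b0 b2 d0 U0 nu0 x0 f3 f2 nx rel.
have p0 := pi_gt0 R.
have n0 : (0 < n)%N by apply: leq_trans n3.
have ab : a + b = 1 by rewrite aE subrK.
have a0 : 0 <= a by rewrite aE; move: b2; clear; lra.
have x2 : 2 * x < pi by move: f3 f2 p0 x0; clear; lra.
have h0 : 0 < sin x by apply: sin_gt0_pi; apply/andP; split; move: x2 x0; clear; lra.
set la := 2 * sin x; have l0 : 0 < la by rewrite mulr_gt0.
rewrite leNgt; apply/negP => hlt.
pose w := trunc n (sine x).
have w0 : w 0%N = 0 by [].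
have wn i : (n < i)%N -> w i = 0 by move=> hi; rewrite /w /trunc [(i <= n)%N]leqNgt hi andbF.
have w1 : w 1%N = sine x 1%N by rewrite /w /trunc n0.
have wnn : w n = sin (f - 3 * x) by rewrite /w /trunc n0 leqnn (sine_n nx).
have wnp : w n.-1 = sin (f - x).
  rewrite /w /trunc ifT ?(sine_np n0 nx) //; move: n3; clear; lia.
have W0 : 0 < mass n w.
  rewrite mass_trunc /mass big_ltn //; apply: ltr_pwDl; last by rewrite sumr_ge0 // => i _; exact: sqr_ge0.
  by rewrite exprn_gt0 // /sine mul1r sin_gt0_pi //; apply/andP; split; move: x2 x0; clear; lra.
have mu0 : 0 < dl + la by rewrite addr_gt0.
have Q := sine_rough x n0 ab; rewrite -/w -(mass_trunc n (sine x)) -/w -/la in Q.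
rewrite (sine_n nx) (sine_nS nx) in Q.
set s1 := sin (f - 3 * x) in Q wnn.
set K := a * s1 - _ in Q.
have s10 : 0 <= s1.
  by apply: sin_ge0_pi; apply/andP; split; move: x0 f3 f2 p0; clear; lra.
have r1 : 1 <= (dl + la) / la by rewrite ler_pdivlMr // mul1r lerDr ltW.
have [f16|/ltW f16] := lerP f (16/3 * x).
  (* First regime: zero padding at both ends. *)
  have n5 : 5 * x < f -> f + 7 * x <= pi.
    move=> f5; have n5 : (4 < n)%N.
      rewrite ltnNge; apply/negP => n4.
      have : n%:R * x <= 4%:R * x by apply: ler_wpM2r; [exact: ltW | rewrite ler_nat].
      by move: nx f5 f2; clear; lra.
    have : 5%:R * x <= n%:R * x by apply: ler_wpM2r; [exact: ltW | rewrite ler_nat].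
    by move: nx; clear; lra.
  have ov := edge_overlap x0 f3 f2 a0 b0 rel f16 n5.
  rewrite -/s1 in ov.
  have L0 s : 0 <= (a * w n * u s) ^+ 2 by exact: sqr_ge0.
  have hL : \sum_(1 <= s < N.+1) (a * w n * u s) ^+ 2 <= a ^+ 2 * s1 ^+ 2 * mass N u.
    rewrite /mass mulr_sumr; apply: ler_sum_nat => j _; rewrite wnn !exprMn; exact: lexx.
  have hp := hat_pool ch a0 b0 ab n0 nN w0 wn d0 l0 L0 (fun s hs => left_padded ch nN wn hs) hL.
  rewrite -[_ + _ + b ^+ 2 * _]addrA in hp.
  have : nu <= dl + la; last by rewrite leNgt hlt.
  apply: (pool_close d0 l0 W0 U0 nu0 Q _ hp).
  have s0 : 0 <= b * sine x 1%N ^+ 2 + s1 * K - (a ^+ 2 * s1 ^+ 2 + b ^+ 2 * w 1%N ^+ 2).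
    rewrite w1 sine1 -sin_2x /K aE.
    by move: ov; rewrite aE; clear; lra.
  have ss : 0 <= b * sine x 1%N ^+ 2 + s1 * K.
    have := addr_ge0 (mulr_ge0 (sqr_ge0 a) (sqr_ge0 s1)) (mulr_ge0 (sqr_ge0 b) (sqr_ge0 (w 1%N))).
    by move: s0; clear; lra.
  have := ler_wpM2r ss r1; move: s0; clear; lra.
have n5 : (4 < n)%N.
  rewrite ltnNge; apply/negP => n4.
  have : n%:R * x <= 4%:R * x by apply: ler_wpM2r; [exact: ltW | rewrite ler_nat].
  by move: nx f16 f2 x0; clear; lra.
have mkedge : 0 < b -> edge x f a b n by move=> bp; split.
have w1sq : b ^+ 2 * w 1%N ^+ 2 <= (dl + la) / la * (b * sine x 1%N ^+ 2).
  rewrite w1; apply: le_trans (_ : b * sine x 1%N ^+ 2 <= _).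
    apply: ler_wpM2r; first exact: sqr_ge0.
    by rewrite expr2 ler_piMl //; move: b2; clear; lra.
  by rewrite ler_peMl // mulr_ge0 // sqr_ge0.
have [b2mu|/ltW b2mu] := lerP (2 * b) (dl + la).
  (* Second regime: adjoint windows on the left, zero padding on the right. *)
  have bnu : b < nu by apply: le_lt_trans hlt; move: b2mu b0; clear; lra.
  set beta := b ^+ 2 / (nu ^+ 2 - b ^+ 2).
  have beta0 : 0 <= beta.
    rewrite divr_ge0 ?sqr_ge0 // subr_ge0.
    by have := ler_pM b0 b0 (ltW bnu) (ltW bnu); rewrite -!expr2.
  pose L s := beta * (`|w n| * eta s + `|w n.-1 - w n| * (a * u s.-1) + `|w n| * (b * u s.+1)) ^+ 2.
  have L0 s : 0 <= L s by rewrite mulr_ge0 // sqr_ge0.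
  have gap0 : 0 <= sin (f - x) - s1.
    rewrite subr_ge0; apply: le_sin; move: x0 f3 f2; clear; lra.
  set D0 := s1 * dl + a * (sin (f - x) - s1) + b * s1.
  have y0 : 0 <= a * (sin (f - x) - s1) by rewrite mulr_ge0.
  have z0 : 0 <= b * s1 by rewrite mulr_ge0.
  have D00 : 0 <= D0 by rewrite !addr_ge0 // mulr_ge0 // ltW.
  have hL : \sum_(1 <= s < N.+1) L s <= beta * D0 ^+ 2 * mass N u.
    rewrite -(ler_pM2l d0) /L -mulr_sumr wnn wnp (ger0_norm s10) (ger0_norm gap0).
    rewrite mulrCA -mulrA [leRHS]mulrCA; apply: ler_wpM2l => //.
    rewrite mulr_sumr.
    apply: le_trans (_ : \sum_(1 <= j < N.+1) D0 * (s1 * eta j ^+ 2 + dl * (a * (sin (f - x) - s1) * u j.-1 ^+ 2 + b * s1 * u j.+1 ^+ 2)) <= _).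
      apply: ler_sum_nat => j _.
      have -> : s1 * eta j + (sin (f - x) - s1) * (a * u j.-1) + s1 * (b * u j.+1) =
        s1 * eta j + a * (sin (f - x) - s1) * u j.-1 + b * s1 * u j.+1 by ring.
      exact: row_cauchy.
    rewrite -mulr_sumr big_split /= -mulr_sumr -mulr_sumr big_split /= -!mulr_sumr.
    have -> : dl * (D0 ^+ 2 * mass N u) = D0 * (s1 * (dl ^+ 2 * mass N u) + dl * (a * (sin (f - x) - s1) * mass N u + b * s1 * mass N u)).
      by rewrite /D0; ring.
    apply: ler_wpM2l => //; apply: lerD; first by apply: ler_wpM2l => //; exact: (ch_res ch).
    apply: ler_wpM2l; first exact: ltW.
    by apply: lerD; apply: ler_wpM2l => //; [exact: (sum_pred_le N (ch_u0 ch)) | exact: (sum_succ_le (ch_uN ch))].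
  have hp := hat_pool ch a0 b0 ab n0 nN w0 wn d0 l0 L0 (fun s hs => left_dual ch b0 nN wn hs bnu) hL.
  rewrite -[_ + _ + b ^+ 2 * _]addrA in hp.
  have : nu <= dl + la; last by rewrite leNgt hlt.
  apply: (pool_close d0 l0 W0 U0 nu0 Q _ hp).
  rewrite addrC mulrDr; apply: lerD => //.
  have [b00|bn0] := eqVneq b 0.
    rewrite /beta b00 expr0n mul0r mul0r.
    have K0 : 0 <= K.
      rewrite /K aE b00 subr0 mul1r subr_ge0; apply: le_sin; move: x0 f16 f2; clear; lra.
    by apply: mulr_ge0; [apply: le_trans r1 | rewrite mulr_ge0].
  have bp : 0 < b by rewrite lt_neqAle eq_sym bn0.
  have e := mkedge bp; have ed := edge_ed e; have [K0 KS] := tail_pos e.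
  apply: (dual_budget ed mu0 b2mu hlt K0 KS D00 _ s10).
  have bend := bend_le_s1 ed.
  have S1 : sin (f - x) <= sin f by apply: le_sin; move: x0 f3 f2; clear; lra.
  have gapE : sin (f - x) - s1 = la * cos f + la * (la * sin (f - x)).
    have e1 := prod_sin (f - x) x.
    have -> : s1 = sin (f - x - 2 * x) by congr sin; ring.
    have -> : la * cos f = la * cos ((f - x) + x) by congr (_ * cos _); ring.
    rewrite [sin (f - x - 2 * x)]sinB sin_2x cos_2x [cos (f - x + x)]cosD /la.
    by clear; ring.
  have k1 : a * (la * sin (f - x)) <= s1.
    apply: le_trans bend; rewrite /la.
    have -> : a * (2 * sin x * sin (f - x)) = 2 * a * sin x * sin (f - x) by ring.
    by apply: ler_wpM2l => //; rewrite !mulr_ge0 // ltW.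
  have k2 := ler_wpM2l (ltW l0) k1.
  have k3 : a * (la * cos f) = a ^+ 2 * sin (f + 3 * x) * b.
    by rewrite /la -rel; ring.
  have D0E : D0 = s1 * dl + (a ^+ 2 * sin (f + 3 * x) * b + la * (a * (la * sin (f - x)))) + b * s1.
    by rewrite /D0 gapE mulrDr k3; ring.
  rewrite D0E.
  have s20 : 0 <= a ^+ 2 * sin (f + 3 * x).
    rewrite mulr_ge0 ?sqr_ge0 // sin_ge0_pi //; apply/andP; split; move: x0 f16 f2 p0; clear; lra.
  have k4 := ler_wpM2r s20 b2mu; have k5 := ler_wpM2r s10 b2mu.
  by rewrite -/s1; move: k2 k4 k5; clear; lra.
(* Third regime: 2 b > dl + la forces sin x < b, and tapered windows apply. *)
have hx : sin x <= b by move: b2mu d0; rewrite /la; clear; lra.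
have bp : 0 < b by apply: lt_le_trans hx.
have e := mkedge bp; have ed := edge_ed e; have [K0 KS] := tail_pos e.
have [P [P1 P2]] := turning_index x0.
have nP : (n <= P)%N.
  rewrite leqNgt; apply/negP => Pn.
  have : P.+1%:R * (2 * x) <= n%:R * (2 * x) by apply: ler_wpM2r; [rewrite mulr_ge0 // ltW | rewrite ler_nat].
  by move: P2 nx f3 f16 x0; clear; lra.
have nu_le : nu <= dl + la; last by move: nu_le; rewrite leNgt hlt.
have hdl : dl <= 2 * b - 2 * sin x by move: b2mu; rewrite /la; clear; lra.
have gn : sine x n ^+ 2 <= sine x n.-1 ^+ 2.
  rewrite (sine_n nx) (sine_np n0 nx) -/s1 !expr2.
  have k : s1 <= sin (f - x) by apply: le_sin; move: x0 f3 f2; clear; lra.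
  by apply: ler_pM.
apply: (taper_windows ch a0 b0 ab n3 nN nP (sine0 x) gn d0 l0) => //.
- by apply: taper_jumps => //; exact: ltW.
- exact: (taper_mass e).
- exact: (taper_step e).
- exact: (taper_flat e).
- by rewrite -(mass_trunc n (sine x)).
Qed.
End Regimes.

Section HatWindows.
Variable R : realType.
(** The phase f = pi - (2 n - 3) x turns the equation for the angle of windows of length n - 2 into the
    relation of [hat_half]; if b > 1/2, the mirror image of the chain is used. *)
Lemma hat_windows (N n : nat) (a b dl nu t : R) u eta p q E :
  chain N n a b dl nu u eta p q E -> (2 < n)%N -> (n <= N)%N ->
  0 <= a -> 0 <= b -> a + b = 1 -> 0 < dl -> 0 < mass N u -> 0 <= nu ->
  pi / (2 * (n - 2)%:R + 1) <= t -> t <= pi / ((n - 2)%:R + 2) ->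
  2 * sin (t / 2) * cos (((n - 2)%:R + 2^-1) * t) + a * b * sin (((n - 2)%:R - 1) * t) = 0 ->
  nu <= dl + 2 * sin (t / 2).
Proof.
move=> ch n3 nN a0 b0 ab d0 U0 nu0.
have n2 : (2 <= n)%N by apply: ltnW.
have n3R : 3 <= n%:R :> R by rewrite ler_nat.
rewrite natrB // => t1 t2 eqn.
have p0 := pi_gt0 R.
set x := t / 2; have tE : t = 2 * x by rewrite /x; lra.
have x1 : pi <= (2 * n%:R - 3) * (2 * x).
  by move: t1; rewrite ler_pdivrMr; [rewrite tE; clear; lra | move: n3R; clear; lra].
have x2 : n%:R * (2 * x) <= pi.
  by move: t2; rewrite ler_pdivlMr; [rewrite tE; clear; lra | move: n3R; clear; lra].
have x0 : 0 < x.
  have n23 : 0 < 2 * n%:R - 3 :> R by move: n3R; clear; lra.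
  have : 0 < (2 * n%:R - 3) * (2 * x) by apply: lt_le_trans x1.
  by rewrite pmulr_rgt0 //; clear; lra.
pose f := pi - (2 * n%:R - 3) * x.
have nx : (2 * n%:R - 3) * x = pi - f by rewrite /f; ring.
have f3 : 3 * x <= f by rewrite /f; move: x2; clear; lra.
have f2 : f <= pi / 2 by rewrite /f; move: x1; clear; lra.
have rel : a * b * sin (f + 3 * x) = 2 * sin x * cos f.
  move: eqn; rewrite -/x tE.
  have -> : (n%:R - 2 + 2^-1) * (2 * x) = pi - f by move: nx; clear; lra.
  have -> : (n%:R - 2 - 1) * (2 * x) = pi - (f + 3 * x) by move: nx; clear; lra.
  by rewrite cosB [sin (pi - _)]sinB sinpi cospi; clear; lra.
have [b2|b2] := lerP b (1/2).
  by apply: (hat_half ch n3 nN _ b0 b2 d0 U0 nu0 x0 f3 f2 nx rel); rewrite -ab addrK.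
have a2 : a <= 1/2 by move: b2 ab; clear; lra.
have n0 : (0 < n)%N by apply: leq_trans n3.
have UE : mass N (flip N u) = mass N u.
  by rewrite /mass (sum_flip N predT (fun j => u j ^+ 2)).
apply: (hat_half (chain_flip n0 nN ch) n3 nN _ a0 a2 d0 _ nu0 x0 f3 f2 nx).
- by rewrite -ab addrAC subrr add0r.
- by rewrite UE.
- by rewrite [b * a]mulrC.
Qed.
End HatWindows.

Local Open Scope complex_scope.
Local Open Scope sesquilinear_scope.

(** * Euclidean norms and the smallest singular value *)

Section Euclid.
Variable R : realType.
Implicit Types (z w : R[i]).

Definition rdot1 z w : R := complex.Re z * complex.Re w + complex.Im z * complex.Im w.

(** Real part of the hermitian product, restricted to the coordinates in P. *)
Definition rdot n (P : pred 'I_n) (x y : 'cV[R[i]]_n) : R := \sum_(i | P i) rdot1 (x i 0) (y i 0).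

Lemma normc_sqr z : ComplexField.Normc.normc z ^+ 2 = rdot1 z z.
Proof.
by case: z => a b /=; rewrite sqr_sqrtr ?addr_ge0 ?sqr_ge0 // /rdot1 /= !expr2.
Qed.

Lemma rdot1_ge0 z : 0 <= rdot1 z z.
Proof. by rewrite -normc_sqr sqr_ge0. Qed.

Lemma rdot1C z w : rdot1 z w = rdot1 w z.
Proof. by rewrite /rdot1; congr (_ + _); rewrite mulrC. Qed.

Lemma rdot1_eq0 z : rdot1 z z = 0 -> z = 0.
Proof.
case: z => a b; rewrite /rdot1 /= => /eqP.
rewrite paddr_eq0 -?expr2 ?sqr_ge0 // !sqrf_eq0 => /andP[/eqP-> /eqP->]; reflexivity.
Qed.

Lemma rdot1Re z w : rdot1 z w = complex.Re (Num.conj z * w).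
Proof.
case: z => a b; case: w => c d; rewrite /rdot1 /= mulNr opprK //.
Qed.

Lemma rdot_ge0 n (P : pred 'I_n) x : 0 <= rdot P x x.
Proof. by apply: sumr_ge0 => i _; exact: rdot1_ge0. Qed.

Lemma rdotC n (P : pred 'I_n) x y : rdot P x y = rdot P y x.
Proof. by apply: eq_bigr => i _; exact: rdot1C. Qed.

Lemma vnorm2E n (x : 'cV[R[i]]_n) : vnorm2 x = Num.sqrt (rdot predT x x).
Proof. by congr Num.sqrt; apply: eq_bigr => i _; rewrite normc_sqr. Qed.

Lemma vnorm2_sqr n (x : 'cV[R[i]]_n) : vnorm2 x ^+ 2 = rdot predT x x.
Proof. by rewrite vnorm2E sqr_sqrtr // rdot_ge0. Qed.

Lemma vnorm2_ge0 n (x : 'cV[R[i]]_n) : 0 <= vnorm2 x.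
Proof. exact: sqrtr_ge0. Qed.

Lemma rdot_eq0 n (x : 'cV[R[i]]_n) : rdot predT x x = 0 -> x = 0.
Proof.
move=> /eqP; rewrite psumr_eq0 => [/allP h|i _]; last exact: rdot1_ge0.
apply/matrixP => i j; rewrite (ord1 j) mxE; apply: rdot1_eq0.
by apply/eqP; apply: h; rewrite mem_index_enum.
Qed.

Lemma rdot_mx n (x y : 'cV[R[i]]_n) : rdot predT x y = complex.Re ((x ^t* *m y) 0 0).
Proof.
rewrite mxE raddf_sum; apply: eq_bigr => i _; rewrite rdot1Re !mxE //.
Qed.

Lemma ctr_mul p q r (A : 'M[R[i]]_(p, q)) (B : 'M[R[i]]_(q, r)) : (A *m B) ^t* = B ^t* *m A ^t*.
Proof. by rewrite trmx_mul map_mxM. Qed.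

Lemma ctrK p q (A : 'M[R[i]]_(p, q)) : A ^t* ^t* = A.
Proof. by apply/matrixP => i j; rewrite !mxE conjCK. Qed.

Lemma rdot_adj p q (T : 'M[R[i]]_(p, q)) x y : rdot predT x (T *m y) = rdot predT (T ^t* *m x) y.
Proof. by rewrite !rdot_mx ctr_mul ctrK mulmxA. Qed.

Lemma rdot1_scale (k : R) z w : rdot1 (k%:C * z) w = k * rdot1 z w.
Proof. by case: z => a b; case: w => c d; rewrite /rdot1 /=; ring. Qed.

Lemma rdot_scale n P (k : R) (x y : 'cV[R[i]]_n) : rdot P (k%:C *: x) y = k * rdot P x y.
Proof. by rewrite /rdot mulr_sumr; apply: eq_bigr => i _; rewrite mxE rdot1_scale. Qed.

Lemma rdot1D z w v : rdot1 (z + w) v = rdot1 z v + rdot1 w v.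
Proof. by case: z => a b; case: w => c d; rewrite /rdot1 /=; ring. Qed.

Lemma rdotD n P (x y v : 'cV[R[i]]_n) : rdot P (x + y) v = rdot P x v + rdot P y v.
Proof. by rewrite /rdot -big_split; apply: eq_bigr => i _; rewrite mxE rdot1D. Qed.

Lemma rdot_cs n P (x y : 'cV[R[i]]_n) : rdot P x y ^+ 2 <= rdot P x x * rdot P y y.
Proof.
have [y0|y0] := eqVneq (rdot P y y) 0.
  have -> : rdot P x y = 0; last by rewrite expr0n y0 mulr0.
  rewrite /rdot big1 // => i Pi.
  have /eqP := y0; rewrite psumr_eq0 => [/allP h|j _]; last exact: rdot1_ge0.
  have /implyP /(_ Pi) /eqP /rdot1_eq0 -> := h i (mem_index_enum i).
  by rewrite /rdot1 !mulr0 addr0.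
have yp : 0 < rdot P y y by rewrite lt_neqAle eq_sym y0 rdot_ge0.
have := rdot_ge0 P ((rdot P y y)%:C *: x + (- rdot P x y)%:C *: y).
rewrite rdotD !rdot_scale ![rdot P _ (_ + _)]rdotC !rdotD !rdot_scale [rdot P y x]rdotC => h.
by rewrite -(ler_pM2l yp); move: h; clear; lra.
Qed.

Lemma vnorm2_cs n (x y : 'cV[R[i]]_n) : rdot predT x y <= vnorm2 x * vnorm2 y.
Proof.
apply: le_trans (ler_norm _) _.
rewrite -(@ler_pXn2r _ 2) ?nnegrE ?mulr_ge0 ?vnorm2_ge0 //.
by rewrite real_normK ?num_real // exprMn !vnorm2_sqr rdot_cs.
Qed.

Lemma vnorm2D n (x y : 'cV[R[i]]_n) : vnorm2 (x + y) <= vnorm2 x + vnorm2 y.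
Proof.
rewrite -(@ler_pXn2r _ 2) ?nnegrE ?addr_ge0 ?vnorm2_ge0 //.
rewrite vnorm2_sqr rdotD ![rdot predT _ (_ + _)]rdotC !rdotD [rdot predT y x]rdotC sqrrD !vnorm2_sqr.
have := vnorm2_cs x y; lra.
Qed.

Lemma vnorm2_eq0 n (x : 'cV[R[i]]_n) : vnorm2 x = 0 -> x = 0.
Proof. by move=> h; apply: rdot_eq0; rewrite -vnorm2_sqr h expr0n. Qed.

Lemma vnorm2_gt0 n (x : 'cV[R[i]]_n) : x != 0 -> 0 < vnorm2 x.
Proof.
move=> x0; rewrite lt_neqAle vnorm2_ge0 andbT; apply: contra x0 => /eqP h.
by apply/eqP; apply: vnorm2_eq0.
Qed.

Lemma vnorm2Z n (k : R) (x : 'cV[R[i]]_n) : 0 <= k -> vnorm2 (k%:C *: x) = k * vnorm2 x.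
Proof.
move=> k0; apply/eqP; rewrite -(@eqrXn2 _ 2) ?mulr_ge0 ?vnorm2_ge0 //.
by rewrite vnorm2_sqr rdot_scale rdotC rdot_scale exprMn vnorm2_sqr mulrA.
Qed.

Lemma vnorm20 n : vnorm2 (0 : 'cV[R[i]]_n) = 0.
Proof. by rewrite vnorm2E /rdot big1 ?sqrtr0 // => i _; rewrite mxE /rdot1 /= !mulr0 addr0. Qed.

Lemma mx_bounded p n (E : 'M[R[i]]_(p, n)) : exists K : R, 0 <= K /\ forall x, vnorm2 (E *m x) <= K * vnorm2 x.
Proof.
exists (\sum_(j < n) vnorm2 (col j E)); split; first by apply: sumr_ge0 => j _; exact: vnorm2_ge0.
move=> x.
have -> : E *m x = \sum_(j < n) (x j 0) *: col j E.
  apply/matrixP => i k; rewrite (ord1 k) !mxE summxE; apply: eq_bigr => j _.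
  by rewrite !mxE mulrC.
have tri (r : seq 'I_n) : vnorm2 (\sum_(j <- r) (x j 0) *: col j E) <= \sum_(j <- r) vnorm2 ((x j 0) *: col j E).
  elim: r => [|j r IH]; first by rewrite !big_nil vnorm20.
  by rewrite !big_cons; apply: le_trans (vnorm2D _ _) _; rewrite lerD2l.
apply: le_trans (tri _) _; rewrite mulr_suml; apply: ler_sum => j _.
rewrite mulrC -(@ler_pXn2r _ 2) ?nnegrE ?mulr_ge0 ?vnorm2_ge0 //.
rewrite exprMn !vnorm2_sqr.
have -> : rdot predT (x j 0 *: col j E) (x j 0 *: col j E) = rdot1 (x j 0) (x j 0) * rdot predT (col j E) (col j E).
  rewrite /rdot mulr_sumr; apply: eq_bigr => i _; rewrite !mxE.
  by case: (x j 0) => a b; case: (E i j) => c d; rewrite /rdot1 /=; ring.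
apply: ler_wpM2r; first exact: rdot_ge0.
by rewrite /rdot (bigD1 j) //= lerDl sumr_ge0 // => i _; exact: rdot1_ge0.
Qed.

Lemma opnorm2_le p n (E : 'M[R[i]]_(p, n)) x : vnorm2 (E *m x) <= opnorm2 E * vnorm2 x.
Proof.
have [K [K0 hK]] := mx_bounded E.
have [->|x0] := eqVneq x 0; first by rewrite mulmx0 !vnorm20 mulr0.
have xp := vnorm2_gt0 x0.
have k0 : 0 <= (vnorm2 x)^-1 by rewrite invr_ge0 ltW.
rewrite -ler_pdivrMr // mulrC -vnorm2Z // scalemxAr.
apply: ub_le_sup.
  exists K => _ [y /= hy <-]; apply: le_trans (hK y) _.
  by rewrite ler_piMr.
exists ((vnorm2 x)^-1%:C *: x) => //=.
by rewrite vnorm2Z // mulVf // gt_eqF.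
Qed.

Lemma opnorm2_ge0 p n (E : 'M[R[i]]_(p, n)) : 0 <= opnorm2 E.
Proof.
have [K [K0 hK]] := mx_bounded E.
apply: ub_le_sup.
  exists K => _ [y /= hy <-]; apply: le_trans (hK y) _.
  by rewrite ler_piMr.
by exists 0; rewrite /= ?mulmx0 vnorm20 // ler01.
Qed.

(** A bound for E is a bound for its adjoint, as |E* w|^2 = <w, E E* w>. *)
Lemma opnorm2_adj p n (E : 'M[R[i]]_(p, n)) (w : 'cV[R[i]]_p) : vnorm2 (E ^t* *m w) <= opnorm2 E * vnorm2 w.
Proof.
have [h0|h0] := eqVneq (vnorm2 (E ^t* *m w)) 0; first by rewrite h0 mulr_ge0 ?opnorm2_ge0 ?vnorm2_ge0.
have hp : 0 < vnorm2 (E ^t* *m w) by rewrite lt_neqAle eq_sym h0 vnorm2_ge0.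
rewrite -(ler_pM2r hp) -[X in X <= _]expr2 vnorm2_sqr -rdot_adj.
apply: le_trans (vnorm2_cs _ _) _.
rewrite mulrC [leRHS]mulrAC ler_wpM2r ?vnorm2_ge0 //; exact: opnorm2_le.
Qed.
End Euclid.

Section Smin.
Variable R : realType.
Variable n : nat.
Implicit Types (E : 'M[R[i]]_n) (z : 'cV[R[i]]_n).

Lemma ctr_selfE m (z : 'cV[R[i]]_m) : (z ^t* *m z) 0 0 = (rdot predT z z)%:C.
Proof.
rewrite mxE raddf_sum; apply: eq_bigr => i _; rewrite !mxE.
by case: (z i 0) => a b; rewrite /rdot1 /=; apply/eqP; rewrite eq_complex /=; apply/andP; split; apply/eqP; ring.
Qed.

Lemma eigenvalue_gram E a : eigenvalue (E ^t* *m E) a ->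
  exists2 z, z != 0 & a = (rdot predT (E *m z) (E *m z) / rdot predT z z)%:C.
Proof.
case/eigenvalueP => v vE v0; pose z := v ^t*.
have z0 : z != 0.
  by apply: contra v0 => /eqP h; rewrite -[v]ctrK -/z h; apply/eqP/matrixP => i j; rewrite !mxE conjC0.
exists z => //.
have zz : rdot predT z z != 0 by apply: contra z0 => /eqP /rdot_eq0 ->.
have : ((E *m z) ^t* *m (E *m z)) 0 0 = a * (z ^t* *m z) 0 0.
  have zt : z ^t* = v by rewrite /z ctrK.
  by rewrite ctr_mul zt mulmxA -[v *m _ *m _]mulmxA vE -scalemxAl mxE.
rewrite !ctr_selfE => h.
have zzC : (rdot predT z z)%:C != 0 :> R[i] by rewrite eq_complex /= negb_and zz.
by apply: (mulIf zzC); rewrite -h -rmorphM /= divfK.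
Qed.

Lemma singular_witness E s : singular_value E s -> exists2 z, z != 0 & vnorm2 (E *m z) = s * vnorm2 z.
Proof.
case=> s0 /eigenvalue_gram[z z0 h]; exists z => //.
have e : s ^+ 2 = rdot predT (E *m z) (E *m z) / rdot predT z z by move/eqP: h; rewrite eq_complex /= => /andP[/eqP ->].
have zz : rdot predT z z != 0 by apply: contra z0 => /eqP /rdot_eq0 ->.
apply/eqP; rewrite -(@eqrXn2 _ 2) ?mulr_ge0 ?vnorm2_ge0 //.
by rewrite exprMn !vnorm2_sqr e divfK.
Qed.

Lemma eigenvalue_singular E a : eigenvalue (E ^t* *m E) a ->
  exists s, singular_value E s /\ a = (s ^+ 2)%:C.
Proof.
move=> h; have [z z0 e] := eigenvalue_gram h.
exists (vnorm2 (E *m z) / vnorm2 z).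
have e2 : a = ((vnorm2 (E *m z) / vnorm2 z) ^+ 2)%:C by rewrite e expr_div_n !vnorm2_sqr.
split; last exact: e2.
split; first by rewrite divr_ge0 // vnorm2_ge0.
by rewrite -e2.
Qed.

Lemma smin_lb E s : singular_value E s -> smin E <= s.
Proof. by move=> h; apply: ge_inf => //; exists 0 => x []. Qed.

(** The Gram matrix is diagonalised by a unitary matrix, and its eigenvalues are squares of singular
    values. *)
Lemma smin_le E z : smin E * vnorm2 z <= vnorm2 (E *m z).
Proof.
have [s0|s0] := lerP (smin E) 0.
  by apply: le_trans (vnorm2_ge0 _); rewrite mulr_le0_ge0 ?vnorm2_ge0.
have herm : (E ^t* *m E) \is hermsymmx.
  by apply/is_hermitianmxP; rewrite expr0 scale1r ctr_mul ctrK.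
have /orthomx_spectralP G := hermitian_normalmx herm.
set P := spectralmx _ in G; set d := spectral_diag _ in G.
have Pu : P \is unitarymx := spectral_unitarymx _.
have PU : P \in unitmx := unitarymx_unit Pu.
pose w := P *m z.
have ww : rdot predT w w = rdot predT z z.
  by rewrite /w rdot_adj mulmxA -(invmx_unitary Pu) mulVmx // mul1mx.
have nE : rdot predT (E *m z) (E *m z) = \sum_i complex.Re (d 0 i) * rdot1 (w i 0) (w i 0).
  rewrite rdot_adj mulmxA G (invmx_unitary Pu) -mulmxA -[P ^t* *m _ *m _]mulmxA -rdot_adj.
  rewrite -[_ *m P *m z]mulmxA -/w; apply: eq_bigr => i _; rewrite mul_diag_mx mxE.
  by case: (d 0 i) => a b; case: (w i 0) => u v; rewrite /rdot1 /=; ring.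
have dE i : smin E ^+ 2 <= complex.Re (d 0 i).
  have ev : eigenvalue (E ^t* *m E) (d 0 i).
    apply/eigenvalueP; exists (row i P).
      rewrite -row_mul G !mulmxA mulmxV // mul1mx row_mul row_diag_mx -scalemxAl rowE //.
    apply/eqP => h; have h2 : row i P *m (P ^t* *m delta_mx i (0 : 'I_1)) = 0 by rewrite h mul0mx.
    move/matrixP: h2 => /(_ 0 0).
    rewrite mulmxA -row_mul (unitarymxP Pu) rowE mulmx1 mul_delta_mx !mxE eqxx => /eqP.
    by rewrite oner_eq0.
  have [s [sE ->]] := eigenvalue_singular ev.
  rewrite /= ler_pXn2r ?nnegrE ?(ltW s0) //; first exact: smin_lb.
  by case: sE.
rewrite -(@ler_pXn2r _ 2) ?nnegrE ?mulr_ge0 ?vnorm2_ge0 ?(ltW s0) //.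
rewrite exprMn !vnorm2_sqr nE -ww /rdot mulr_sumr; apply: ler_sum => i _.
by apply: ler_wpM2r; [exact: rdot1_ge0 | exact: dE].
Qed.

Lemma smin_lt_witness E (c : R) : (0 < n)%N -> smin E < c -> exists2 z, z != 0 & vnorm2 (E *m z) <= c * vnorm2 z.
Proof.
move=> n0 hc.
have hi : [set s | singular_value E s] !=set0.
  have [a /eigenvalue_singular[s [sE _]]] := eigenvalue_closed (E ^t* *m E) n0.
  by exists s.
have [s sE sc] := inf_lt hi hc.
have [z z0 ez] := singular_witness sE; exists z => //; rewrite ez.
by apply: ler_wpM2r; [exact: vnorm2_ge0 | exact: ltW].
Qed.


Lemma bounded_below_unit E (c : R) : 0 < c -> (forall z, c * vnorm2 z <= vnorm2 (E *m z)) -> E \in unitmx.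
Proof.
move=> c0 h; rewrite -unitmx_tr unitmxE unitfE; apply/negP => /det0P[v v0 vE].
have z0 : v^T != 0 by apply: contra v0 => /eqP e; rewrite -[v]trmxK e trmx0.
have := h v^T; rewrite -[E]trmxK -trmx_mul vE trmx0 vnorm20 leNgt.
by rewrite mulr_gt0 // vnorm2_gt0.
Qed.

(** For a square matrix a lower bound passes to the adjoint through the inverse. *)
Lemma bounded_below_adj E (c : R) : 0 < c -> (forall z, c * vnorm2 z <= vnorm2 (E *m z)) ->
  forall z, c * vnorm2 z <= vnorm2 (E ^t* *m z).
Proof.
move=> c0 h z; have Eu := bounded_below_unit c0 h.
have [->|z0] := eqVneq z 0; first by rewrite mulmx0 !vnorm20 mulr0.
pose w := invmx E *m z.
have Ew : E *m w = z by rewrite /w mulmxA mulmxV // mul1mx.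
have e1 : vnorm2 z ^+ 2 <= vnorm2 (E ^t* *m z) * vnorm2 w.
  by rewrite vnorm2_sqr -{2}Ew rdot_adj; exact: vnorm2_cs.
have e2 := h w; rewrite Ew in e2.
have zp := vnorm2_gt0 z0.
rewrite -(ler_pM2r zp).
have e3 := ler_wpM2l (ltW c0) e1; have e4 := ler_wpM2l (vnorm2_ge0 (E ^t* *m z)) e2.
by rewrite -mulrA -expr2; apply: le_trans e3 _; rewrite mulrCA.
Qed.
End Smin.

(** * Adjoint windows *)

Section Dual.
Variable R : realType.
Variable n : nat.
Implicit Types (T : 'M[R[i]]_n) (z : 'cV[R[i]]_n) (P Q e : pred 'I_n).

Definition supported P z := forall i, ~~ P i -> z i 0 = 0.

Definition restr P z : 'cV[R[i]]_n := \col_i (if P i then z i 0 else 0).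

Lemma restrE P z : restr P z = diag_mx (\row_i (P i)%:R) *m z.
Proof. by apply/matrixP => i j; rewrite (ord1 j) mul_diag_mx !mxE; case: (P i); rewrite ?mul1r ?mul0r. Qed.

Lemma rdot10 (w : R[i]) : rdot1 0 w = 0.
Proof. by rewrite /rdot1 /= !mul0r addr0. Qed.

Lemma rdot_restr P (x y : 'cV[R[i]]_n) : rdot predT (restr P x) y = rdot P x y.
Proof.
rewrite /rdot [RHS]big_mkcond; apply: eq_bigr => i _; rewrite mxE.
by case: ifP => // _; rewrite rdot10.
Qed.

Lemma rdot_supp P (x y : 'cV[R[i]]_n) : supported P x -> rdot predT x y = rdot P x y.
Proof.
move=> h; rewrite /rdot [RHS]big_mkcond; apply: eq_bigr => i _.
by case: ifP => // /negbT /h ->; rewrite rdot10.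
Qed.

Lemma restr_supp P x : supported P x -> restr P x = x.
Proof. by move=> h; apply/matrixP => i j; rewrite (ord1 j) mxE; case: ifP => // /negbT /h. Qed.

Lemma rdot1_young (w : R) (x y : R[i]) : 0 < w -> 2 * rdot1 x y <= w * rdot1 x x + rdot1 y y / w.
Proof.
move=> w0; rewrite -subr_ge0.
have -> : w * rdot1 x x + rdot1 y y / w - 2 * rdot1 x y =
   ((w * complex.Re x - complex.Re y) ^+ 2 + (w * complex.Im x - complex.Im y) ^+ 2) / w.
  by rewrite /rdot1; field; rewrite gt_eqF.
by rewrite divr_ge0 ?addr_ge0 ?sqr_ge0 // ltW.
Qed.

(** Let P be a window inside the full window Q, and suppose that T* leaks from P to Q only through the
    rows e, with strength b. Then the compression of T* to P is bounded below, hence invertible; with p such that the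
    restriction of T* p to P is z one has |z|^2 = <p, T z>, and Young's inequality with the weight nu^2 - b^2 on e and
    nu^2 elsewhere uses up exactly what the lower bound for T* p provides. *)
Lemma adjoint_window T P Q e (b nu : R) : 0 <= b -> b < nu ->
  (forall i, P i -> Q i) -> (forall i, e i -> P i) ->
  (forall p, supported P p -> nu ^+ 2 * rdot P p p <= rdot Q (T ^t* *m p) (T ^t* *m p)) ->
  (forall p, supported P p ->
     rdot Q (T ^t* *m p) (T ^t* *m p) <= rdot P (T ^t* *m p) (T ^t* *m p) + b ^+ 2 * rdot e p p) ->
  forall z, supported P z ->
  nu ^+ 2 * rdot P z z <= rdot P (T *m z) (T *m z) + b ^+ 2 / (nu ^+ 2 - b ^+ 2) * rdot e (T *m z) (T *m z).
Proof.
move=> b0 bnu PQ eP low split_adj z zP.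
have nu0 : 0 < nu by apply: le_lt_trans bnu.
have gap : 0 < nu ^+ 2 - b ^+ 2 by rewrite subr_gt0 ltr_pXn2r ?nnegrE ?(ltW nu0).
have sub (p : 'cV[R[i]]_n) : rdot e p p <= rdot P p p.
  rewrite /rdot big_mkcond [leRHS]big_mkcond; apply: ler_sum => i _.
  case: ifP => [/eP ->|_] //; case: ifP => _ //; exact: rdot1_ge0.
have coer (p : 'cV[R[i]]_n) : supported P p -> (nu ^+ 2 - b ^+ 2) * rdot P p p <= rdot P (T ^t* *m p) (T ^t* *m p).
  move=> hp; have h1 := low p hp; have h2 := split_adj p hp.
  have h3 := ler_wpM2l (sqr_ge0 b) (sub p).
  by move: h1 h2 h3; generalize (rdot P p p) (rdot e p p) (rdot P (T ^t* *m p) (T ^t* *m p)) (rdot Q (T ^t* *m p) (T ^t* *m p)); clear; move=> *; lra.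
pose D := diag_mx (\row_i (P i)%:R) : 'M[R[i]]_n.
have DE (x : 'cV[R[i]]_n) : D *m x = restr P x by rewrite restrE.
pose G := D *m T ^t* *m D + (1%:M - D).
have GE (x : 'cV[R[i]]_n) : G *m x = restr P (T ^t* *m restr P x) + (x - restr P x).
  by rewrite /G mulmxDl mulmxBl mul1mx -!mulmxA !DE.
have Gu : G \in unitmx.
  rewrite -unitmx_tr unitmxE unitfE; apply/negP => /det0P[v v0 vE].
  have z0 : v^T != 0 by apply: contra v0 => /eqP h; rewrite -[v]trmxK h trmx0.
  have : G *m v^T = 0 by rewrite -[G]trmxK -trmx_mul vE trmx0.
  rewrite GE => /matrixP G0.
  have vP : supported P v^T.
    by move=> i /negbTE hi; have := G0 i 0; rewrite !mxE hi add0r subr0.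
  have : rdot P v^T v^T = 0.
    apply/eqP; rewrite eq_le rdot_ge0 andbT -(pmulr_rle0 _ gap).
    apply: le_trans (coer _ vP) _.
    rewrite /rdot big1 // => i hi; have := G0 i 0; rewrite !mxE hi subrr addr0 (restr_supp vP) => ->.
    by rewrite rdot10.
  by rewrite -rdot_supp // => /rdot_eq0 h; rewrite h eqxx in z0.
pose p := invmx G *m z.
have Gp : G *m p = z by rewrite /p mulmxA mulmxV // mul1mx.
have pP : supported P p.
  move=> i hi; have := zP i hi; rewrite -Gp GE !mxE (negbTE hi) add0r subr0 //.
have pz : restr P (T ^t* *m p) = z.
  by move: Gp; rewrite GE (restr_supp pP) subrr addr0.
have zz : rdot P z z = rdot P p (T *m z).
  rewrite -(rdot_supp _ zP) -{1}pz rdot_restr -(rdot_supp _ pP) rdot_adj.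
  by rewrite rdotC [RHS]rdotC (rdot_supp _ zP).
have zz2 : rdot P (T ^t* *m p) (T ^t* *m p) = rdot P z z.
  rewrite /rdot; apply: eq_bigr => i hi; move/matrixP: pz => /(_ i 0); rewrite !mxE hi => ->; reflexivity.
have h1 := low p pP; have h2 := split_adj p pP; rewrite zz2 in h2.
pose om i := if e i then nu ^+ 2 - b ^+ 2 else nu ^+ 2.
have om0 i : 0 < om i by rewrite /om; case: ifP => _ //; rewrite exprn_gt0.
have young : 2 * rdot P z z <= \sum_(i | P i) om i * rdot1 (p i 0) (p i 0) +
   \sum_(i | P i) rdot1 ((T *m z) i 0) ((T *m z) i 0) / om i.
  rewrite zz /rdot mulr_sumr -big_split; apply: ler_sum => i _; exact: rdot1_young.
have s1 : \sum_(i | P i) om i * rdot1 (p i 0) (p i 0) = nu ^+ 2 * rdot P p p - b ^+ 2 * rdot e p p.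
  have -> : rdot e p p = \sum_(i | P i) (if e i then rdot1 (p i 0) (p i 0) else 0).
    rewrite /rdot -big_mkcondr; apply: eq_bigl => i.
    by case ei: (e i); rewrite ?andbT ?andbF // eP.
  rewrite /rdot !mulr_sumr -sumrB; apply: eq_bigr => i _; rewrite /om; case: ifP => _; ring.
have s2 : \sum_(i | P i) rdot1 ((T *m z) i 0) ((T *m z) i 0) / om i =
   (rdot P (T *m z) (T *m z) + b ^+ 2 / (nu ^+ 2 - b ^+ 2) * rdot e (T *m z) (T *m z)) / nu ^+ 2.
  have -> : rdot e (T *m z) (T *m z) = \sum_(i | P i) (if e i then rdot1 ((T *m z) i 0) ((T *m z) i 0) else 0).
    rewrite /rdot -big_mkcondr; apply: eq_bigl => i.
    by case ei: (e i); rewrite ?andbT ?andbF // eP.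
  rewrite /rdot mulr_sumr -big_split mulr_suml; apply: eq_bigr => i _; rewrite /om /=; case: ifP => _.
    by field; rewrite !gt_eqF.
  by rewrite mulr0 addr0.
have nu2 : 0 < nu ^+ 2 by rewrite exprn_gt0.
rewrite s1 s2 in young.
rewrite mulrC -ler_pdivlMr //.
have fin (x pp ep QQ X c d : R) : 2 * x <= c * pp - d * ep + X -> c * pp <= QQ ->
    QQ <= x + d * ep -> x <= X by clear; lra.
exact: fin young h1 h2.
Qed.
End Dual.

(** * Block coordinates *)

Section Transfer.
Variable R : realType.
Variables (p n : nat) (f : 'I_p -> 'I_n) (P : pred 'I_n).
Hypotheses (f_inj : injective f) (f_im : forall i, P i <-> exists k, f k = i).
Implicit Types (T : 'M[R[i]]_n) (z : 'cV[R[i]]_n).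

Lemma sum_image (V : nmodType) (F : 'I_n -> V) : \sum_(i | P i) F i = \sum_(k < p) F (f k).
Proof.
rewrite -(big_imset F (in2W f_inj)) /=; apply: eq_bigl => i.
apply/idP/imsetP => [/f_im[k <-]|[k _ ->]]; first by exists k.
by apply/f_im; exists k.
Qed.

Lemma mxsub_window T z : supported P z ->
  rdot predT (mxsub f f T *m (\col_k z (f k) 0)) (mxsub f f T *m (\col_k z (f k) 0)) = rdot P (T *m z) (T *m z).
Proof.
move=> zP; rewrite [RHS]/rdot sum_image; apply: eq_bigr => k _.
suff -> : (mxsub f f T *m (\col_k z (f k) 0)) k 0 = (T *m z) (f k) 0 by [].
rewrite !mxE [RHS](bigID P) /= [X in _ + X]big1 ?addr0; last by move=> i /zP ->; rewrite mulr0.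
by rewrite sum_image; apply: eq_bigr => l _; rewrite !mxE.
Qed.

Lemma col_window z : rdot predT (\col_k z (f k) 0) (\col_k z (f k) 0) = rdot P z z.
Proof. by rewrite [RHS]/rdot sum_image; apply: eq_bigr => k _; rewrite !mxE. Qed.

(** A lower bound for the smallest singular value of a principal submatrix, read for vectors of full length
    supported in the window, together with its counterpart for the adjoint. *)
Lemma window_lb T (c : R) : 0 < c -> c <= smin (mxsub f f T) -> forall z, supported P z ->
  c ^+ 2 * rdot P z z <= rdot P (T *m z) (T *m z) /\
  c ^+ 2 * rdot P z z <= rdot P (T ^t* *m z) (T ^t* *m z).
Proof.
move=> c0 hc z zP.
have low w : c * vnorm2 w <= vnorm2 (mxsub f f T *m w).
  by apply: le_trans (smin_le _ _); apply: ler_wpM2r => //; exact: vnorm2_ge0.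
have adj := bounded_below_adj c0 low.
have sqle (x y : R) : 0 <= x -> c * x <= y -> c ^+ 2 * x ^+ 2 <= y ^+ 2.
  move=> x0 h; have cx : 0 <= c * x by rewrite mulr_ge0 // ltW.
  by have := ler_pM cx cx h h; rewrite -!expr2 exprMn.
rewrite -(col_window z) -!(mxsub_window _ zP) -!vnorm2_sqr; split.
  exact: sqle (vnorm2_ge0 _) (low _).
apply: sqle (vnorm2_ge0 _) _.
have -> : mxsub f f (T ^t*) = (mxsub f f T) ^t* by apply/matrixP => i j; rewrite !mxE.
exact: adj.
Qed.
End Transfer.

Section Blocks.
Variables (R : realType) (N : nat) (m : 'I_N -> nat).
Local Notation M := (\sum_(i < N) m i)%N.
Implicit Types A : 'M[R[i]]_M.

Definition blk (i : 'I_M) : 'I_N := tagnat.sig1 i.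

Definition inblk k l : pred 'I_M := fun i => (k <= blk i < k + l)%N.

Lemma blk_rank J (k : 'I_(m J)) : blk (tagnat.Rank J k) = J.
Proof. exact: tagnat.Rank1K. Qed.

Lemma rank_inj J : injective (@tagnat.Rank N m J).
Proof.
move=> k l /(congr1 val) /eqP; rewrite tagnat.eq_Rank eqxx /= => /eqP h; exact: val_inj.
Qed.

Lemma rank_im J i : (blk i == J) <-> exists k, @tagnat.Rank N m J k = i.
Proof.
split=> [/eqP <-|[k <-]]; last by rewrite blk_rank.
by exists (tagnat.sig2 i); exact: tagnat.sig2K.
Qed.

Section Window.
Variables (n k : nat) (kn : (k + n <= N)%N).

(** The position in the full matrix of an index of a window. *)
Definition embed (i : 'I_(\sum_(i < n) m (block_idx kn i))) : 'I_M :=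
  tagnat.Rank (block_idx kn (tagnat.sig1 i)) (tagnat.sig2 i).

Lemma embed_rank J (l : 'I_(m (block_idx kn J))) :
  embed (@tagnat.Rank n (fun i => m (block_idx kn i)) J l) = tagnat.Rank (block_idx kn J) l.
Proof.
apply: ord_inj; rewrite /embed !tagnat.RankEsum tagnat.Rank2K /=.
by rewrite tagnat.Rank1K.
Qed.

Lemma embed_inj : injective embed.
Proof.
move=> i j h; have /eqP := congr1 val h; rewrite /= tagnat.eq_Rank => /andP[/eqP e1 /eqP e2].
have e3 : tagnat.sig1 i = tagnat.sig1 j.
  by apply/val_inj; move/(congr1 val): e1 => /= /addnI.
by apply: ord_inj; rewrite [LHS]tagnat.rect [RHS]tagnat.rect e2 e3.
Qed.

Lemma embed_im i : inblk k n i <-> exists l, embed l = i.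
Proof.
split=> [/andP[h1 h2]|[l <-]]; last first.
  by rewrite /inblk blk_rank /= leq_addr ltn_add2l ltn_ord.
have hJ : (blk i - k < n)%N by move: h1 h2; clear; lia.
have e : block_idx kn (Ordinal hJ) = blk i by apply/val_inj => /=; rewrite subnKC.
have gen J' (eJ : block_idx kn (Ordinal hJ) = J') (l : 'I_(m J')) :
    exists l', embed l' = tagnat.Rank J' l.
  by move: l; case: _ / eJ => l; exists (tagnat.Rank (Ordinal hJ) l); exact: embed_rank.
by have [l' hl'] := gen _ e (tagnat.sig2 i); exists l'; rewrite hl'; exact: tagnat.sig2K.
Qed.

Lemma Bsub_mxsub A (lam : R[i]) : Bsub A kn - lam%:M = mxsub embed embed (tridiag A - lam%:M).
Proof.
apply/matrixP => i j; rewrite !mxE (inj_eq embed_inj) //.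
Qed.
End Window.

Lemma tridiagE A i j : tridiag A i j = if (blk i <= (blk j).+1)%N && (blk j <= (blk i).+1)%N then A i j else 0.
Proof.
rewrite mxE -/(blk i) -/(blk j); case: ifP => _; rewrite mxE //.
by rewrite !tagnat.sig2K.
Qed.

Lemma block_bound A J K (x : 'cV[R[i]]_M) :
  \sum_(i | blk i == J) rdot1 (\sum_(j | blk j == K) A i j * x j 0) (\sum_(j | blk j == K) A i j * x j 0)
  <= opnorm2 (submxblock A J K) ^+ 2 * rdot [pred j | blk j == K] x x.
Proof.
pose z := \col_k x (@tagnat.Rank N m K k) 0.
have zE : rdot [pred j | blk j == K] x x = vnorm2 z ^+ 2.
  by rewrite vnorm2_sqr /z (col_window (@rank_inj K) (rank_im K)).
have -> : \sum_(i | blk i == J) rdot1 (\sum_(j | blk j == K) A i j * x j 0) (\sum_(j | blk j == K) A i j * x j 0) =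
   vnorm2 (submxblock A J K *m z) ^+ 2.
  rewrite vnorm2_sqr (sum_image (@rank_inj J) (rank_im J)); apply: eq_bigr => k _.
  have e : \sum_(j | blk j == K) A (tagnat.Rank J k) j * x j 0 = (submxblock A J K *m z) k 0.
    by rewrite mxE (sum_image (@rank_inj K) (rank_im K)); apply: eq_bigr => l _; rewrite !mxE.
  by rewrite e.
rewrite zE -exprMn ler_pXn2r ?nnegrE ?mulr_ge0 ?vnorm2_ge0 ?opnorm2_ge0 //; exact: opnorm2_le.
Qed.

Lemma block_bound_adj A J K (x : 'cV[R[i]]_M) :
  \sum_(i | blk i == K) rdot1 (\sum_(j | blk j == J) A ^t* i j * x j 0) (\sum_(j | blk j == J) A ^t* i j * x j 0)
  <= opnorm2 (submxblock A J K) ^+ 2 * rdot [pred j | blk j == J] x x.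
Proof.
pose z := \col_k x (@tagnat.Rank N m J k) 0.
have zE : rdot [pred j | blk j == J] x x = vnorm2 z ^+ 2.
  by rewrite vnorm2_sqr /z (col_window (@rank_inj J) (rank_im J)).
have -> : \sum_(i | blk i == K) rdot1 (\sum_(j | blk j == J) A ^t* i j * x j 0) (\sum_(j | blk j == J) A ^t* i j * x j 0) =
   vnorm2 ((submxblock A J K) ^t* *m z) ^+ 2.
  rewrite vnorm2_sqr (sum_image (@rank_inj K) (rank_im K)); apply: eq_bigr => k _.
  have e : \sum_(j | blk j == J) A ^t* (tagnat.Rank K k) j * x j 0 = ((submxblock A J K) ^t* *m z) k 0.
    by rewrite mxE (sum_image (@rank_inj J) (rank_im J)); apply: eq_bigr => l _; rewrite !mxE.
  by rewrite e.
rewrite zE -exprMn ler_pXn2r ?nnegrE ?mulr_ge0 ?vnorm2_ge0 ?opnorm2_ge0 //; exact: opnorm2_adj.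
Qed.

Lemma opnorm2_rL A (J K : 'I_N) : J = K.+1 :> nat -> opnorm2 (submxblock A J K) <= rL A.
Proof.
move=> h; apply: le_trans (_ : \big[Num.max/0]_(j < N | J == j.+1 :> nat) opnorm2 (submxblock A J j) <= _).
  by apply: (le_bigmax_cond _ (fun j => opnorm2 (submxblock A J j))); rewrite h.
exact: (@le_bigmax _ _ 'I_N (0 : R) (fun i : 'I_N => \big[Num.max/0]_(j < N | i == j.+1 :> nat) opnorm2 (submxblock A i j)) J).
Qed.

Lemma opnorm2_rU A (J K : 'I_N) : K = J.+1 :> nat -> opnorm2 (submxblock A J K) <= rU A.
Proof.
move=> h; apply: le_trans (_ : \big[Num.max/0]_(j < N | j == J.+1 :> nat) opnorm2 (submxblock A J j) <= _).
  by apply: (le_bigmax_cond _ (fun j => opnorm2 (submxblock A J j))); rewrite h.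
exact: (@le_bigmax _ _ 'I_N (0 : R) (fun i : 'I_N => \big[Num.max/0]_(j < N | j == i.+1 :> nat) opnorm2 (submxblock A i j)) J).
Qed.

Lemma rL_ge0 A : 0 <= rL A.
Proof.
by apply: bigmax_ge_id.
Qed.

Lemma rU_ge0 A : 0 <= rU A.
Proof. by apply: bigmax_ge_id. Qed.
End Blocks.

(** * Rescaled block vectors *)

Lemma quad_le (R : realFieldType) (al be ga e l m yl yu lu : R) :
  0 <= e -> 0 <= l -> 0 <= m -> `|yl| <= e * l -> `|yu| <= e * m -> `|lu| <= l * m ->
  al ^+ 2 * e ^+ 2 + be ^+ 2 * l ^+ 2 + ga ^+ 2 * m ^+ 2 + 2 * (al * be * yl + al * ga * yu + be * ga * lu) <=
  (`|al| * e + `|be| * l + `|ga| * m) ^+ 2.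
Proof.
move=> e0 l0 m0 h1 h2 h3.
have k (s t x y : R) : `|x| <= y -> s * t * x <= `|s| * `|t| * y.
  by move=> h; apply: le_trans (ler_norm _) _; rewrite !normrM; apply: ler_wpM2l => //; rewrite mulr_ge0.
have k1 := k al be _ _ h1; have k2 := k al ga _ _ h2; have k3 := k be ga _ _ h3.
rewrite -(real_normK (num_real al)) -(real_normK (num_real be)) -(real_normK (num_real ga)).
by move: k1 k2 k3; clear; lra.
Qed.

Lemma convex_le (R : realFieldType) (a b B C : R) : 0 <= a -> 0 <= b -> a + b = 1 ->
  (a * B + b * C) ^+ 2 <= a * B ^+ 2 + b * C ^+ 2.
Proof.
move=> a0 b0 ab; have := mulr_ge0 (mulr_ge0 a0 b0) (sqr_ge0 (B - C)).
have -> : a = 1 - b by lra.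
lra.
Qed.

Lemma comb3 (K : nzRingType) n (al be ga : K) (y l u : 'cV[K]_n) i :
  (al *: y + be *: l + ga *: u) i 0 = al * y i 0 + be * l i 0 + ga * u i 0.
Proof. by rewrite !mxE. Qed.

Lemma rdot1_comb3 (R : realType) (al be ga : R) (y l u : R[i]) :
  rdot1 (al%:C * y + be%:C * l + ga%:C * u) (al%:C * y + be%:C * l + ga%:C * u) =
  al ^+ 2 * rdot1 y y + be ^+ 2 * rdot1 l l + ga ^+ 2 * rdot1 u u +
  2 * (al * be * rdot1 y l + al * ga * rdot1 y u + be * ga * rdot1 l u).
Proof. by case: y l u => [y1 y2] [l1 l2] [u1 u2]; rewrite /rdot1 /=; ring. Qed.

Lemma rdot_comb3 (R : realType) n (P : pred 'I_n) (al be ga : R) (y l u : 'cV[R[i]]_n) :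
  let w := al%:C *: y + be%:C *: l + ga%:C *: u in
  rdot P w w = al ^+ 2 * rdot P y y + be ^+ 2 * rdot P l l + ga ^+ 2 * rdot P u u +
  2 * (al * be * rdot P y l + al * ga * rdot P y u + be * ga * rdot P l u).
Proof.
rewrite /= /rdot !mulr_sumr -!big_split mulr_sumr -big_split /=.
by apply: eq_bigr => i _; rewrite comb3 rdot1_comb3.
Qed.

Section ScaledVector.
Variables (R : realType) (N : nat) (m : 'I_N -> nat).
Local Notation M := (\sum_(i < N) m i)%N.
Variables (A : 'M[R[i]]_M) (lam : R[i]) (x : 'cV[R[i]]_M).

Local Notation T := (tridiag A - lam%:M).

Definition TL : 'M[R[i]]_M := \matrix_(i, j) if (blk i == (blk j).+1 :> nat) then A i j else 0.
Definition TU : 'M[R[i]]_M := \matrix_(i, j) if (blk j == (blk i).+1 :> nat) then A i j else 0.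
Definition TD : 'M[R[i]]_M := \matrix_(i, j) if (blk i == blk j) then T i j else 0.

Lemma T_split : T = TD + TL + TU.
Proof.
apply/matrixP => i j.
have RE : (TD + TL + TU) i j = (if blk i == blk j then T i j else 0) +
    (if blk i == (blk j).+1 :> nat then A i j else 0) + (if blk j == (blk i).+1 :> nat then A i j else 0).
  by rewrite mxE [TU i j]mxE [(TD + TL) i j]mxE [TL i j]mxE [TD i j]mxE.
rewrite RE {RE}; have [ij|ij] := eqVneq (blk i) (blk j).
  by rewrite ij !ltn_eqF // !addr0.
have -> : T i j = if (blk i <= (blk j).+1)%N && (blk j <= (blk i).+1)%N then A i j else 0.
  rewrite mxE tridiagE !mxE.
  by case: eqP => [e|_]; [rewrite e eqxx in ij | rewrite mulr0n subr0].
rewrite add0r.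
case: (ltngtP (blk i) (blk j)) => h; last by move/val_inj: h => /eqP; rewrite (negbTE ij).
  rewrite (leq_trans (ltnW h)) // andTb (_ : (blk i == (blk j).+1 :> nat) = false); last by move: h; clear; lia.
  rewrite add0r (_ : (blk j <= (blk i).+1)%N = (blk j == (blk i).+1 :> nat)) //; move: h; clear; lia.
rewrite (leq_trans (ltnW h)) // andbT (_ : (blk j == (blk i).+1 :> nat) = false); last by move: h; clear; lia.
rewrite addr0 (_ : (blk i <= (blk j).+1)%N = (blk i == (blk j).+1 :> nat)) //; move: h; clear; lia.
Qed.

Definition scale_blocks (v : nat -> R) : 'cV[R[i]]_M := \col_i ((v (blk i).+1)%:C * x i 0).

(** Blocks are counted from 1 here, so that 0 and N + 1 stand for empty blocks at the ends. *)
Definition in_block j : pred 'I_M := fun i => (blk i).+1 == j.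

(** After rescaling the blocks, a row consists of the rescaled residual and of the couplings multiplied by
    differences of neighbouring scale factors: the diagonal block, and with it lambda, has disappeared. *)
Lemma T_scale v i : (T *m scale_blocks v) i 0 =
  ((v (blk i).+1)%:C *: (T *m x) + (v (blk i) - v (blk i).+1)%:C *: (TL *m x) + (v (blk i).+2 - v (blk i).+1)%:C *: (TU *m x)) i 0.
Proof.
have eD : (TD *m scale_blocks v) i 0 = (v (blk i).+1)%:C * (TD *m x) i 0.
  rewrite !mxE mulr_sumr; apply: eq_bigr => j _; rewrite !mxE; case: eqP => [->|_]; last by rewrite !mul0r mulr0.
  by rewrite mulrCA.
have eL : (TL *m scale_blocks v) i 0 = (v (blk i))%:C * (TL *m x) i 0.
  rewrite !mxE mulr_sumr; apply: eq_bigr => j _; rewrite !mxE; case: eqP => [->|_]; last by rewrite !mul0r mulr0.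
  by rewrite mulrCA.
have eU : (TU *m scale_blocks v) i 0 = (v (blk i).+2)%:C * (TU *m x) i 0.
  rewrite !mxE mulr_sumr; apply: eq_bigr => j _; rewrite !mxE; case: eqP => [->|_]; last by rewrite !mul0r mulr0.
  by rewrite mulrCA.
have e z : (T *m z) i 0 = (TD *m z) i 0 + (TL *m z) i 0 + (TU *m z) i 0.
  by rewrite T_split !mulmxDl !mxE.
rewrite comb3 !e eD eL eU !rmorphB /=.
by ring.
Qed.

Definition bnorm2 j (z : 'cV[R[i]]_M) := rdot (in_block j) z z.

Lemma bnorm2_ge0 j z : 0 <= bnorm2 j z. Proof. exact: rdot_ge0. Qed.

Lemma bnorm2_out j z : (j == 0%N) || (N < j)%N -> bnorm2 j z = 0.
Proof.
move=> h; apply: big1 => i /eqP e; exfalso; have := ltn_ord (blk i); move: h e; clear; lia.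
Qed.

Lemma block_form v j : bnorm2 j (T *m scale_blocks v) =
  v j ^+ 2 * bnorm2 j (T *m x) + (v j.-1 - v j) ^+ 2 * bnorm2 j (TL *m x) + (v j.+1 - v j) ^+ 2 * bnorm2 j (TU *m x) +
  2 * (v j * (v j.-1 - v j) * rdot (in_block j) (T *m x) (TL *m x) + v j * (v j.+1 - v j) * rdot (in_block j) (T *m x) (TU *m x)
   + (v j.-1 - v j) * (v j.+1 - v j) * rdot (in_block j) (TL *m x) (TU *m x)).
Proof.
set w := (v j)%:C *: (T *m x) + (v j.-1 - v j)%:C *: (TL *m x) + (v j.+1 - v j)%:C *: (TU *m x).
have -> : bnorm2 j (T *m scale_blocks v) = rdot (in_block j) w w.
  by apply: eq_bigr => i /eqP ij; rewrite T_scale /w -ij.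
exact: rdot_comb3.
Qed.
End ScaledVector.

Section Couplings.
Variables (R : realType) (N : nat) (m : 'I_N -> nat).
Local Notation M := (\sum_(i < N) m i)%N.
Variables (A : 'M[R[i]]_M) (lam : R[i]).
Implicit Types (x z p : 'cV[R[i]]_M).

Local Notation T := (tridiag A - lam%:M).

Lemma ctrE k l (B : 'M[R[i]]_(k, l)) i j : (B ^t*) i j = Num.conj (B j i).
Proof. by rewrite !mxE. Qed.

Lemma T_off (i j : 'I_M) : i != j ->
  T i j = if (blk i <= (blk j).+1)%N && (blk j <= (blk i).+1)%N then A i j else 0.
Proof. by move=> ij; rewrite mxE tridiagE !mxE (negbTE ij) mulr0n subr0. Qed.

Lemma in_blockP (J : 'I_N) (i : 'I_M) : in_block J.+1 i = (blk i == J).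
Proof. by rewrite /in_block eqSS. Qed.

Lemma bnorm2_block (J : 'I_N) z : bnorm2 J.+1 z = rdot [pred j | blk j == J] z z.
Proof. by apply: eq_bigl => i; rewrite in_blockP. Qed.

Lemma sum_ord_adj (P : pred 'I_N) (F : 'I_M -> R[i]) (K : 'I_N) :
  (forall J, P J -> J = K) -> P K ->
  \sum_j (if P (blk j) then F j else 0) = \sum_(j | blk j == K) F j.
Proof.
move=> h PK; rewrite -big_mkcond; apply: eq_bigl => j.
by apply/idP/eqP => [/h|->].
Qed.

Lemma TL_le j x : (1 <= j <= N)%N -> bnorm2 j (TL A *m x) <= rL A ^+ 2 * bnorm2 j.-1 x.
Proof.
case: j => // j jN; have {jN}jN : (j < N)%N by [].
set J := Ordinal jN; rewrite (bnorm2_block J).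
case: j jN @J => [|k] kN J.
  rewrite /rdot big1; first by apply: mulr_ge0; [exact: sqr_ge0 | exact: bnorm2_ge0].
  move=> i /eqP iJ.
  rewrite (_ : (TL A *m x) i 0 = 0) ?rdot10 // mxE big1 // => j _.
  by rewrite mxE iJ /= mul0r.
have kN' : (k < N)%N by apply: ltnW.
set K := Ordinal kN'.
have -> : bnorm2 k.+2.-1 x = rdot [pred j | blk j == K] x x by rewrite -(bnorm2_block K).
have -> : rdot [pred j | blk j == J] (TL A *m x) (TL A *m x) =
  \sum_(i | blk i == J) rdot1 (\sum_(j | blk j == K) A i j * x j 0) (\sum_(j | blk j == K) A i j * x j 0).
  apply: eq_bigr => i /eqP iJ.
  suff -> : (TL A *m x) i 0 = \sum_(j | blk j == K) A i j * x j 0 by [].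
  rewrite mxE -(@sum_ord_adj (fun L => J == L.+1 :> nat) _ K) //.
    by apply: eq_bigr => j _; rewrite mxE iJ; case: ifP => _ //; rewrite mul0r.
  by move=> L /eqP [e]; apply/val_inj.
apply: le_trans (block_bound _ _ _ _) _; apply: ler_wpM2r; first exact: rdot_ge0.
by rewrite ler_pXn2r ?nnegrE ?opnorm2_ge0 ?rL_ge0 //; exact: opnorm2_rL.
Qed.

Lemma TU_le j x : (1 <= j <= N)%N -> bnorm2 j (TU A *m x) <= rU A ^+ 2 * bnorm2 j.+1 x.
Proof.
case: j => // j jN; have {jN}jN : (j < N)%N by [].
set J := Ordinal jN; rewrite (bnorm2_block J).
have [jN'|jN'] := ltnP j.+1 N; last first.
  rewrite /rdot big1; first by apply: mulr_ge0; [exact: sqr_ge0 | exact: bnorm2_ge0].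
  move=> i /eqP iJ.
  rewrite (_ : (TU A *m x) i 0 = 0) ?rdot10 // mxE big1 // => k _.
  rewrite mxE iJ /= ifF ?mul0r //; apply/eqP => e.
  by have := ltn_ord (blk k); rewrite e ltnNge jN'.
set K := Ordinal jN'.
have -> : bnorm2 j.+2 x = rdot [pred j | blk j == K] x x by rewrite -(bnorm2_block K).
have -> : rdot [pred j | blk j == J] (TU A *m x) (TU A *m x) =
  \sum_(i | blk i == J) rdot1 (\sum_(j | blk j == K) A i j * x j 0) (\sum_(j | blk j == K) A i j * x j 0).
  apply: eq_bigr => i /eqP iJ.
  suff -> : (TU A *m x) i 0 = \sum_(j | blk j == K) A i j * x j 0 by [].
  rewrite mxE -(@sum_ord_adj (fun L => L == J.+1 :> nat) _ K) //.
    by apply: eq_bigr => k _; rewrite mxE iJ; case: ifP => _ //; rewrite mul0r.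
  by move=> L /eqP e; apply/val_inj.
apply: le_trans (block_bound _ _ _ _) _; apply: ler_wpM2r; first exact: rdot_ge0.
by rewrite ler_pXn2r ?nnegrE ?opnorm2_ge0 ?rU_ge0 //; exact: opnorm2_rU.
Qed.

Lemma rdot_blocks (P : pred 'I_M) (Q : pred nat) x : (forall i, P i = Q (blk i).+1) ->
  rdot P x x = \sum_(1 <= j < N.+1 | Q j) bnorm2 j x.
Proof.
move=> PQ; have -> : rdot P x x = rdot [pred i | Q (blk i).+1] x x by apply: eq_bigl => i; exact: PQ.
rewrite big_add1 /= big_mkord /rdot (partition_big (@blk N m) (fun J : 'I_N => Q J.+1)) //=.
apply: eq_bigr => J QJ; rewrite bnorm2_block; apply: eq_bigl => i /=.
by case: eqP => [->|_]; rewrite ?andbT ?andbF.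
Qed.

Lemma rdot_all x : rdot predT x x = \sum_(1 <= j < N.+1) bnorm2 j x.
Proof. exact: rdot_blocks. Qed.

Lemma bnorm2_scale x v j : bnorm2 j (scale_blocks x v) = v j ^+ 2 * bnorm2 j x.
Proof.
rewrite /bnorm2 /rdot mulr_sumr; apply: eq_bigr => i /eqP <-.
by rewrite mxE rdot1_scale rdot1C rdot1_scale mulrA expr2.
Qed.

Definition adjacent (K L : 'I_N) := (K <= L.+1)%N && (L <= K.+1)%N.

Section Exit.
Variables (P : pred 'I_N) (J : 'I_N) (beta : R).
Hypothesis exit_from : forall L K, P L -> ~~ P K -> adjacent L K -> L = J.
Hypothesis exit_to : forall K L, ~~ P K -> ~~ P L -> adjacent J K -> adjacent J L -> L = K.
Hypothesis exit_norm : forall K, ~~ P K -> adjacent J K -> opnorm2 (submxblock A J K) <= beta.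
Hypothesis beta0 : 0 <= beta.

(** The hypotheses say that the set P of blocks is joined to its complement through the block J only, and
    that J has a single neighbour outside. Then T* maps a vector supported in P to P and to this neighbour. *)
Lemma adj_exit p i : supported [pred i | P (blk i)] p -> ~~ P (blk i) ->
  (T ^t* *m p) i 0 = if adjacent J (blk i) then \sum_(j | blk j == J) A ^t* i j * p j 0 else 0.
Proof.
move=> pP iP; rewrite mxE.
have -> : (if adjacent J (blk i) then \sum_(j | blk j == J) A ^t* i j * p j 0 else 0) =
    \sum_j (if adjacent J (blk i) && (blk j == J) then A ^t* i j * p j 0 else 0).
  by case: ifP => _; rewrite ?big1_eq // [LHS]big_mkcond.
apply: eq_bigr => j _; have [jP|jP] := boolP (P (blk j)); last by rewrite (pP j jP) !mulr0 if_same.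
have ne : j != i by apply: contraNneq iP => <-.
rewrite [T ^t* i j]ctrE T_off // -/(adjacent (blk j) (blk i)).
have -> : adjacent (blk j) (blk i) = adjacent J (blk i) && (blk j == J).
  apply/idP/andP => [h|[h /eqP -> //]]; have e := exit_from jP iP h.
  by rewrite -e h eqxx.
by case: ifP => _; rewrite ?ctrE // conjC0 mul0r.
Qed.

Lemma split_exit (Q : pred 'I_M) p : supported [pred i | P (blk i)] p -> (forall i, P (blk i) -> Q i) ->
  rdot Q (T ^t* *m p) (T ^t* *m p) <=
  rdot [pred i | P (blk i)] (T ^t* *m p) (T ^t* *m p) + beta ^+ 2 * rdot [pred i | blk i == J] p p.
Proof.
move=> pP PQ; rewrite /rdot (bigID [pred i | P (blk i)]) /=; apply: lerD.
  apply: le_of_eq; apply: eq_bigl => i.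
  by case: (boolP (P (blk i))) => [/PQ ->|]; rewrite ?andbF.
case: (pickP [pred K | ~~ P K && adjacent J K]) => [K /andP[nK aK]|none]; last first.
  rewrite big1; first by apply: mulr_ge0; [exact: sqr_ge0 | exact: rdot_ge0].
  move=> i /andP[_ iP]; rewrite adj_exit // ifF ?rdot10 //.
  by have := none (blk i); rewrite /= iP.
apply: le_trans (_ : \sum_(i | blk i == K) rdot1 ((T ^t* *m p) i 0) ((T ^t* *m p) i 0) <= _).
  rewrite big_mkcond [leRHS]big_mkcond; apply: ler_sum => i _.
  case: ifP => [/andP[_ iP]|_]; last by case: ifP => _ //; exact: rdot1_ge0.
  rewrite adj_exit //; case: ifP => [h|_]; last by rewrite rdot10; case: ifP => _ //; exact: rdot1_ge0.
  by rewrite (exit_to nK iP aK h) eqxx.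
apply: le_trans (_ : opnorm2 (submxblock A J K) ^+ 2 * rdot [pred j | blk j == J] p p <= _).
  apply: le_trans (block_bound_adj _ _ _ _).
  by apply: le_of_eq; apply: eq_bigr => i /eqP iK; rewrite adj_exit // iK ?aK.
apply: ler_wpM2r; first exact: rdot_ge0.
by rewrite ler_pXn2r ?nnegrE ?opnorm2_ge0 ?exit_norm.
Qed.
End Exit.
End Couplings.

(** * The chain of an approximate singular vector *)

Section ChainOfVector.
Variables (R : realType) (N : nat) (m : 'I_N -> nat).
Local Notation M := (\sum_(i < N) m i)%N.
Variables (A : 'M[R[i]]_M) (lam : R[i]) (x : 'cV[R[i]]_M) (r a b c dl : R).
Local Notation T := (tridiag A - lam%:M).
Hypotheses (r0 : 0 < r) (a0 : 0 <= a) (b0 : 0 <= b) (ab : a + b = 1).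
Hypotheses (hL : rL A <= a * r) (hU : rU A <= b * r) (c0 : 0 < c).

(** Block norms of x and, in units of r, the block norms of T x, its products with the couplings, and the row
    energies; together they form a chain. *)
Definition mag j : R := Num.sqrt (bnorm2 j x).
Definition rsd j : R := Num.sqrt (bnorm2 j (T *m x)) / r.
Definition cpl j : R := rdot (in_block j) (T *m x) (TL A *m x) / r ^+ 2.
Definition cpu j : R := rdot (in_block j) (T *m x) (TU A *m x) / r ^+ 2.
Definition energy v j : R := bnorm2 j (T *m scale_blocks x v) / r ^+ 2.

Lemma r2_gt0 : 0 < r ^+ 2. Proof. by rewrite exprn_gt0. Qed.

Lemma mag_sqr j : mag j ^+ 2 = bnorm2 j x.
Proof. by rewrite /mag sqr_sqrtr // bnorm2_ge0. Qed.

Lemma mass_mag : mass N mag = rdot predT x x.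
Proof. by rewrite rdot_all; apply: eq_bigr => j _; rewrite mag_sqr. Qed.

Lemma rdot_sqrt j (z w : 'cV[R[i]]_M) : `|rdot (in_block j) z w| <= Num.sqrt (bnorm2 j z) * Num.sqrt (bnorm2 j w).
Proof.
rewrite -(@ler_pXn2r _ 2) ?nnegrE ?mulr_ge0 ?sqrtr_ge0 //.
by rewrite real_normK ?num_real // exprMn !sqr_sqrtr ?bnorm2_ge0 // rdot_cs.
Qed.

Lemma TL_sqrt j : (1 <= j <= N)%N -> Num.sqrt (bnorm2 j (TL A *m x)) <= r * (a * mag j.-1).
Proof.
move=> hj; rewrite -(@ler_pXn2r _ 2) ?nnegrE ?sqrtr_ge0 //; last first.
  by apply: mulr_ge0; [exact: ltW | apply: mulr_ge0 => //; exact: sqrtr_ge0].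
rewrite sqr_sqrtr ?bnorm2_ge0 // mulrA exprMn mag_sqr.
apply: le_trans (TL_le _ _ hj) _; apply: ler_wpM2r; first exact: bnorm2_ge0.
have ar : 0 <= a * r by rewrite mulr_ge0 // ltW.
by rewrite [r * a]mulrC ler_pXn2r ?nnegrE ?rL_ge0.
Qed.

Lemma TU_sqrt j : (1 <= j <= N)%N -> Num.sqrt (bnorm2 j (TU A *m x)) <= r * (b * mag j.+1).
Proof.
move=> hj; rewrite -(@ler_pXn2r _ 2) ?nnegrE ?sqrtr_ge0 //; last first.
  by apply: mulr_ge0; [exact: ltW | apply: mulr_ge0 => //; exact: sqrtr_ge0].
rewrite sqr_sqrtr ?bnorm2_ge0 // mulrA exprMn mag_sqr.
apply: le_trans (TU_le _ _ hj) _; apply: ler_wpM2r; first exact: bnorm2_ge0.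
have br : 0 <= b * r by rewrite mulr_ge0 // ltW.
by rewrite [r * b]mulrC ler_pXn2r ?nnegrE ?rU_ge0.
Qed.

Lemma energy_ge0 v j : 0 <= energy v j.
Proof. by rewrite divr_ge0 ?bnorm2_ge0 // sqr_ge0. Qed.

Lemma rsdE j : Num.sqrt (bnorm2 j (T *m x)) = r * rsd j.
Proof. by rewrite /rsd mulrC divfK // gt_eqF. Qed.

(** The triangle inequality for the row [T_scale]. *)
Lemma energy_le v j : (1 <= j <= N)%N -> energy v j <=
  (`|v j| * rsd j + `|v j.-1 - v j| * (a * mag j.-1) + `|v j.+1 - v j| * (b * mag j.+1)) ^+ 2.
Proof.
move=> hj; rewrite /energy ler_pdivrMr ?r2_gt0 // -exprMn block_form.
rewrite -[bnorm2 j (T *m x)]sqr_sqrtr ?bnorm2_ge0 // -[bnorm2 j (TL A *m x)]sqr_sqrtr ?bnorm2_ge0 // -[bnorm2 j (TU A *m x)]sqr_sqrtr ?bnorm2_ge0 //.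
apply: le_trans (quad_le _ _ _ (sqrtr_ge0 _) (sqrtr_ge0 _) (sqrtr_ge0 _) (rdot_sqrt _ _ _) (rdot_sqrt _ _ _) (rdot_sqrt _ _ _)) _.
have h1 := ler_wpM2l (normr_ge0 (v j.-1 - v j)) (TL_sqrt hj).
have h2 := ler_wpM2l (normr_ge0 (v j.+1 - v j)) (TU_sqrt hj).
have k0 : 0 <= `|v j| * Num.sqrt (bnorm2 j (T *m x)) + `|v j.-1 - v j| * Num.sqrt (bnorm2 j (TL A *m x)) + `|v j.+1 - v j| * Num.sqrt (bnorm2 j (TU A *m x)).
  by rewrite !addr_ge0 // mulr_ge0 // sqrtr_ge0.
have k : `|v j| * Num.sqrt (bnorm2 j (T *m x)) + `|v j.-1 - v j| * Num.sqrt (bnorm2 j (TL A *m x)) + `|v j.+1 - v j| * Num.sqrt (bnorm2 j (TU A *m x)) <=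
  (`|v j| * rsd j + `|v j.-1 - v j| * (a * mag j.-1) + `|v j.+1 - v j| * (b * mag j.+1)) * r.
  rewrite rsdE !mulrDl; apply: lerD; first apply: lerD.
  - by rewrite mulrA mulrAC.
  - by apply: le_trans h1 _; rewrite mulrCA mulrC.
  - by apply: le_trans h2 _; rewrite mulrCA mulrC.
by rewrite ler_pXn2r ?nnegrE //; apply: le_trans k.
Qed.

(** The two couplings of a row are only separated from each other, by convexity; their products with
    the residual are kept. *)
Lemma energy_le_cross v j : (1 <= j <= N)%N -> energy v j <=
  v j ^+ 2 * rsd j ^+ 2 + 2 * v j * ((v j.-1 - v j) * cpl j + (v j.+1 - v j) * cpu j) +
  (a * (v j.-1 - v j) ^+ 2 * mag j.-1 ^+ 2 + b * (v j.+1 - v j) ^+ 2 * mag j.+1 ^+ 2).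
Proof.
move=> hj; rewrite /energy block_form.
set y := bnorm2 j (T *m x); set l := bnorm2 j (TL A *m x); set w := bnorm2 j (TU A *m x).
set yl := rdot _ _ _; set yu := rdot _ _ _; set lu := rdot _ _ _.
have lu_le : (v j.-1 - v j) ^+ 2 * l + (v j.+1 - v j) ^+ 2 * w + 2 * ((v j.-1 - v j) * (v j.+1 - v j) * lu) <=
    r ^+ 2 * (a * (v j.-1 - v j) ^+ 2 * mag j.-1 ^+ 2 + b * (v j.+1 - v j) ^+ 2 * mag j.+1 ^+ 2).
  have h := quad_le 0 (v j.-1 - v j) (v j.+1 - v j) (lexx (0 : R)) (sqrtr_ge0 l) (sqrtr_ge0 w)
    (_ : `|0| <= 0 * Num.sqrt l) (_ : `|0| <= 0 * Num.sqrt w) (rdot_sqrt j (TL A *m x) (TU A *m x)).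
  have {}h := h ltac:(by rewrite normr0 mul0r) ltac:(by rewrite normr0 mul0r).
  rewrite !sqr_sqrtr ?bnorm2_ge0 // -/l -/w -/lu normr0 !mul0r expr0n mul0r !add0r in h.
  apply: (le_trans h).
  have h1 := ler_wpM2l (normr_ge0 (v j.-1 - v j)) (TL_sqrt hj).
  have h2 := ler_wpM2l (normr_ge0 (v j.+1 - v j)) (TU_sqrt hj).
  have k0 : 0 <= `|v j.-1 - v j| * Num.sqrt l + `|v j.+1 - v j| * Num.sqrt w by rewrite !addr_ge0 // mulr_ge0 // sqrtr_ge0.
  have k := lerD h1 h2.
  apply: (le_trans (ler_pM k0 k0 k k)).
  have cv := convex_le (`|v j.-1 - v j| * mag j.-1) (`|v j.+1 - v j| * mag j.+1) a0 b0 ab.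
  rewrite !exprMn !real_normK ?num_real // in cv.
  have := ler_wpM2l (sqr_ge0 r) cv.
  rewrite [X in X <= _ -> _](_ : _ = (`|v j.-1 - v j| * (r * (a * mag j.-1)) + `|v j.+1 - v j| * (r * (b * mag j.+1))) *
   (`|v j.-1 - v j| * (r * (a * mag j.-1)) + `|v j.+1 - v j| * (r * (b * mag j.+1)))); last by ring.
  by move=> h3; apply: (le_trans h3); rewrite !mulrA.
rewrite ler_pdivrMr ?r2_gt0 //.
have e1 : y = r ^+ 2 * rsd j ^+ 2 by rewrite -exprMn -rsdE sqr_sqrtr ?bnorm2_ge0.
have e2 : yl = r ^+ 2 * cpl j by rewrite /cpl mulrC divfK // gt_eqF // r2_gt0.
have e3 : yu = r ^+ 2 * cpu j by rewrite /cpu mulrC divfK // gt_eqF // r2_gt0.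
have fin (X1 X2 l1 w1 Y Z : R) : X1 + X2 + Z <= Y -> l1 = w1 -> l1 + (X1 + X2 + Z) <= Y + w1 by move=> h ->; rewrite addrC lerD2r.
rewrite e1 e2 e3.
set LHS := (X in X <= _); set RHS := (X in _ <= X).
have -> : LHS = (v j ^+ 2 * rsd j ^+ 2 + 2 * v j * ((v j.-1 - v j) * cpl j + (v j.+1 - v j) * cpu j)) * r ^+ 2 +
  ((v j.-1 - v j) ^+ 2 * l + (v j.+1 - v j) ^+ 2 * w + 2 * ((v j.-1 - v j) * (v j.+1 - v j) * lu)).
  by rewrite /LHS; ring.
rewrite /RHS [leRHS]mulrDl lerD2l [leRHS]mulrC; exact: lu_le.
Qed.

Lemma window_energy k l (kn : (k + l <= N)%N) v : c <= smin (Bsub A kn - lam%:M) ->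
  (forall j, (1 <= j <= N)%N -> ~~ ((k < j) && (j <= k + l))%N -> v j = 0) ->
  (c / r) ^+ 2 * (\sum_(1 <= j < N.+1) v j ^+ 2 * mag j ^+ 2) <=
  \sum_(1 <= j < N.+1 | ((k < j) && (j <= k + l))%N) energy v j.
Proof.
move=> hc hv; pose z := scale_blocks x v.
rewrite Bsub_mxsub in hc.
have zP : supported (inblk k l) z.
  move=> i hi; rewrite mxE hv ?mul0r //; first by rewrite /= ltn_ord.
have [h _] := window_lb (@embed_inj N m l k kn) (embed_im kn) c0 hc zP.
have e (z' : 'cV[R[i]]_M) : rdot (inblk k l) z' z' = \sum_(1 <= j < N.+1 | ((k < j) && (j <= k + l))%N) bnorm2 j z'.
  exact: rdot_blocks.
rewrite !e in h.
have -> : \sum_(1 <= j < N.+1) v j ^+ 2 * mag j ^+ 2 = \sum_(1 <= j < N.+1 | ((k < j) && (j <= k + l))%N) bnorm2 j z.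
  rewrite [RHS]big_mkcond; apply: eq_big_nat => j hj; rewrite bnorm2_scale mag_sqr.
  by case: ifP => // /negbT hj'; rewrite hv // expr0n mul0r.
rewrite /energy -mulr_suml ler_pdivlMr ?r2_gt0 // expr_div_n mulrAC divfK; last by rewrite gt_eqF // r2_gt0.
exact: h.
Qed.

Variable n : nat.
Hypotheses (n0 : (0 < n)%N) (nN : (n <= N)%N).
Hypothesis full : forall k (kn : (k + n <= N)%N), c <= smin (Bsub A kn - lam%:M).
Hypothesis res : rdot predT (T *m x) (T *m x) <= (dl * r) ^+ 2 * rdot predT x x.

Lemma full_energy s v : (n <= s <= N)%N -> (forall j, (1 <= j <= N)%N -> ~~ inwin n s j -> v j = 0) ->
  (c / r) ^+ 2 * (\sum_(1 <= j < N.+1) v j ^+ 2 * mag j ^+ 2) <=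
  \sum_(1 <= j < N.+1 | inwin n s j) energy v j.
Proof.
move=> hs hv; have kn : (s - n + n <= N)%N by move: hs; clear; lia.
have e j : ((s - n < j) && (j <= s - n + n))%N = inwin n s j.
  by rewrite /inwin; move: hs; clear; lia.
apply: le_trans (window_energy (full kn) _) _.
  by move=> j hj; rewrite e; apply: hv.
by apply: le_of_eq; apply: eq_bigl => j; rewrite e.
Qed.

(** A window overhanging an end is a part of a full window at that end, which it can leave only through
    one off-diagonal block; [adjoint_window] applies. *)
Lemma exit_energy k (kn : (k + n <= N)%N) s (J : 'I_N) beta v :
  let P := [pred L : 'I_N | inwin n s L.+1] in
  (forall L : 'I_N, P L -> (k <= L < k + n)%N) -> P J ->
  (forall L K, P L -> ~~ P K -> adjacent L K -> L = J) ->
  (forall K L, ~~ P K -> ~~ P L -> adjacent J K -> adjacent J L -> L = K) ->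
  (forall K, ~~ P K -> adjacent J K -> opnorm2 (submxblock A J K) <= beta * r) ->
  0 <= beta -> beta < c / r -> (forall j, (1 <= j <= N)%N -> ~~ inwin n s j -> v j = 0) ->
  (c / r) ^+ 2 * (\sum_(1 <= j < N.+1) v j ^+ 2 * mag j ^+ 2) <=
  \sum_(1 <= j < N.+1 | inwin n s j) energy v j + beta ^+ 2 / ((c / r) ^+ 2 - beta ^+ 2) * energy v J.+1.
Proof.
move=> P0 Pk PJ from to norm beta0 hb hv; pose z := scale_blocks x v.
pose P : pred 'I_M := [pred i | P0 (blk i)].
have hc := full kn; rewrite Bsub_mxsub in hc.
have wl := window_lb (@embed_inj N m n k kn) (embed_im kn) c0 hc.
have PQ i : P i -> inblk k n i by move/Pk.
have suppPQ (p : 'cV[R[i]]_M) : supported P p -> supported (inblk k n) p.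
  by move=> hp i hi; apply: hp; apply: contra hi => /PQ.
have zP : supported P z by move=> i hi; rewrite mxE hv ?mul0r // ltn_ord.
have br : beta * r < c by rewrite -ltr_pdivlMr.
have br0 : 0 <= beta * r by rewrite mulr_ge0 // ltW.
have JP i : [pred i | blk i == J] i -> P i by move=> /= /eqP e; rewrite /P /= e.
have low p : supported P p -> c ^+ 2 * rdot P p p <= rdot (inblk k n) (T ^t* *m p) (T ^t* *m p).
  move=> hp; have [_ h2] := wl p (suppPQ p hp).
  by rewrite -(rdot_supp _ hp) (rdot_supp _ (suppPQ p hp)).
have h := adjoint_window br0 br PQ JP low (fun p hp => split_exit lam from to norm br0 hp PQ) zP.
have eP (w : 'cV[R[i]]_M) : rdot P w w = \sum_(1 <= j < N.+1 | inwin n s j) bnorm2 j w.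
  exact: (rdot_blocks (Q := inwin n s)).
rewrite !eP -!bnorm2_block in h.
have -> : \sum_(1 <= j < N.+1) v j ^+ 2 * mag j ^+ 2 = \sum_(1 <= j < N.+1 | inwin n s j) bnorm2 j z.
  rewrite [RHS]big_mkcond; apply: eq_big_nat => j hj; rewrite bnorm2_scale mag_sqr.
  by case: ifP => // /negbT hj'; rewrite hv // expr0n mul0r.
have r2 := r2_gt0.
have cE : beta ^+ 2 / ((c / r) ^+ 2 - beta ^+ 2) = (beta * r) ^+ 2 / (c ^+ 2 - (beta * r) ^+ 2).
  have -> : c ^+ 2 - (beta * r) ^+ 2 = ((c / r) ^+ 2 - beta ^+ 2) * r ^+ 2 by field; rewrite gt_eqF.
  by rewrite [(_ * r) ^+ 2]exprMn -[RHS]mulf_div (divff (lt0r_neq0 r2)) mulr1.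
rewrite cE /energy -mulr_suml mulrA -mulrDl ler_pdivlMr // expr_div_n mulrAC divfK; last by rewrite gt_eqF.
exact: h.
Qed.

Lemma left_energy s v : (1 <= s < n)%N -> (forall j, (1 <= j <= N)%N -> ~~ inwin n s j -> v j = 0) -> b < c / r ->
  (c / r) ^+ 2 * (\sum_(1 <= j < N.+1) v j ^+ 2 * mag j ^+ 2) <=
  \sum_(1 <= j < N.+1 | inwin n s j) energy v j + b ^+ 2 / ((c / r) ^+ 2 - b ^+ 2) * energy v s.
Proof.
move=> hs hv hb; have kn : (0 + n <= N)%N by rewrite add0n.
have sN : (s.-1 < N)%N by move: hs nN; clear; lia.
have sE : s = (Ordinal sN).+1 :> nat by rewrite /= prednK //; case/andP: hs.
rewrite [in energy v s]sE.
apply: (exit_energy kn _ _ _ _ _ b0 hb hv).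
- by move=> L /=; rewrite /inwin; move: hs; clear; lia.
- by rewrite /= /inwin; move: hs; clear; lia.
- by move=> L K /= h1 h2 h3; apply: val_inj; move: h1 h2 h3 hs; rewrite /adjacent /inwin /=; clear; lia.
- by move=> K L /= h1 h2 h3 h4; apply: val_inj; move: h1 h2 h3 h4 hs; rewrite /adjacent /inwin /=; clear; lia.
move=> K /= h1 h2; apply: le_trans hU; apply: opnorm2_rU => /=.
by move: h1 h2 hs; rewrite /adjacent /inwin /=; clear; lia.
Qed.

Lemma right_energy s v : (N < s < N + n)%N -> (forall j, (1 <= j <= N)%N -> ~~ inwin n s j -> v j = 0) -> a < c / r ->
  (c / r) ^+ 2 * (\sum_(1 <= j < N.+1) v j ^+ 2 * mag j ^+ 2) <=
  \sum_(1 <= j < N.+1 | inwin n s j) energy v j + a ^+ 2 / ((c / r) ^+ 2 - a ^+ 2) * energy v (s - n).+1.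
Proof.
move=> hs hv hb; have kn : (N - n + n <= N)%N by rewrite subnK.
have sN : (s - n < N)%N by move: hs nN; clear; lia.
apply: (exit_energy (J := Ordinal sN) kn _ _ _ _ _ a0 hb hv).
- by move=> L /=; have := ltn_ord L; rewrite /inwin; move: hs nN; clear; lia.
- by rewrite /= /inwin; move: hs nN; clear; lia.
- by move=> L K /= h1 h2 h3; have := ltn_ord K; move=> h4; apply: val_inj; move: h1 h2 h3 h4 hs nN; rewrite /adjacent /inwin /=; clear; lia.
- move=> K L /= h1 h2 h3 h4; have h5 := ltn_ord K; have h6 := ltn_ord L; apply: val_inj.
  by move: h1 h2 h3 h4 h5 h6 hs nN; rewrite /adjacent /inwin /=; clear; lia.
move=> K /= h1 h2; apply: le_trans hL; apply: opnorm2_rL => /=.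
have h3 := ltn_ord K; by move: h1 h2 h3 hs nN; rewrite /adjacent /inwin /=; clear; lia.
Qed.

Lemma res_sum : \sum_(1 <= j < N.+1) rsd j ^+ 2 <= dl ^+ 2 * mass N mag.
Proof.
have -> : \sum_(1 <= j < N.+1) rsd j ^+ 2 = rdot predT (T *m x) (T *m x) / r ^+ 2.
  rewrite rdot_all mulr_suml; apply: eq_bigr => j _.
  by rewrite /rsd expr_div_n sqr_sqrtr // bnorm2_ge0.
by rewrite ler_pdivrMr ?r2_gt0 // mass_mag mulrAC -exprMn.
Qed.

Lemma mag0 : mag 0 = 0. Proof. by rewrite /mag bnorm2_out // sqrtr0. Qed.
Lemma magN : mag N.+1 = 0. Proof. by rewrite /mag bnorm2_out ?sqrtr0 // ltnSn orbT. Qed.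

Lemma build_chain : chain N n a b dl (c / r) mag rsd cpl cpu energy.
Proof.
split.
- exact: mag0.
- exact: magN.
- by move=> j; exact: sqrtr_ge0.
- by move=> j; rewrite divr_ge0 ?sqrtr_ge0 // ltW.
- move=> j hj; rewrite normrM normfV [`|r ^+ 2|]ger0_norm ?(ltW r2_gt0) // ler_pdivrMr ?r2_gt0 //.
  apply: le_trans (rdot_sqrt _ _ _) _; rewrite rsdE.
  have -> : rsd j * (a * mag j.-1) * r ^+ 2 = (r * rsd j) * (r * (a * mag j.-1)) by ring.
  apply: ler_wpM2l; last exact: TL_sqrt.
  by rewrite -rsdE sqrtr_ge0.
- move=> j hj; rewrite normrM normfV [`|r ^+ 2|]ger0_norm ?(ltW r2_gt0) // ler_pdivrMr ?r2_gt0 //.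
  apply: le_trans (rdot_sqrt _ _ _) _; rewrite rsdE.
  have -> : rsd j * (b * mag j.+1) * r ^+ 2 = (r * rsd j) * (r * (b * mag j.+1)) by ring.
  apply: ler_wpM2l; last exact: TU_sqrt.
  by rewrite -rsdE sqrtr_ge0.
- exact: energy_ge0.
- exact: energy_le.
- exact: energy_le_cross.
- exact: res_sum.
- exact: full_energy.
- exact: left_energy.
- exact: right_energy.
Qed.
End ChainOfVector.

(** * Inclusion sets *)

(** Finitely many strict bounds leave a common margin. *)
Lemma uniform_gap (R : realType) (mu : R) (K : nat) (P : nat -> R -> Prop) :
  (forall k c c', c' <= c -> P k c -> P k c') ->
  (forall k, (k < K)%N -> exists2 c, mu < c & P k c) ->
  exists2 c, mu < c & forall k, (k < K)%N -> P k c.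
Proof.
move=> mono; elim: K => [|K IH] h; first by exists (mu + 1) => //; rewrite ltrDl.
have [|c1 c1mu h1] := IH; first by move=> k kK; apply: h; apply: ltnW.
have [//|c2 c2mu h2] := h K.
exists (Num.min c1 c2); first by rewrite lt_min c1mu c2mu.
move=> k; rewrite ltnS leq_eqVlt => /orP[/eqP ->|kK].
  by apply: mono h2; rewrite ge_min lexx orbT.
by apply: mono (h1 k kK); rewrite ge_min lexx.
Qed.

Lemma vnorm2N (R : realType) n (z : 'cV[R[i]]_n) : vnorm2 (- z) = vnorm2 z.
Proof.
rewrite !vnorm2E; congr Num.sqrt; apply: eq_bigr => i _; rewrite mxE.
by case: (z i 0) => u v; rewrite /rdot1 /= !mulrNN.
Qed.

Section Inclusion.
Variables (R : realType) (N : nat) (m : 'I_N -> nat).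
Local Notation M := (\sum_(i < N) m i)%N.
Variables (A : 'M[R[i]]_M) (lam : R[i]).
Local Notation T := (tridiag A - lam%:M).

(** Length l and offset k of the blocks B_{l,k} that enter sigma: full windows anywhere, shorter ones at
    the two ends. *)
Definition truncation n k l := (l == n) || ((1 <= l < n) && ((k == 0) || (k == N - l)))%N.

Lemma truncation_gap (mu : R) (D : nat -> nat -> bool) :
  (forall k l (kn : (k + l <= N)%N), D k l -> mu < smin (Bsub A kn - lam%:M)) ->
  exists2 c, mu < c & forall k l (kn : (k + l <= N)%N), D k l -> c <= smin (Bsub A kn - lam%:M).
Proof.
move=> h.
pose P l c := forall k (kn : (k + l <= N)%N), D k l -> c <= smin (Bsub A kn - lam%:M).
have [|l lN|c hc H] := @uniform_gap R mu N.+1 P.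
- by move=> l c c' cc' H k kn d; apply: le_trans cc' (H k kn d).
- have [|k kN|c hc H] := @uniform_gap R mu N.+1 (fun k c => forall kn : (k + l <= N)%N, D k l -> c <= smin (Bsub A kn - lam%:M)).
  + by move=> k c c' cc' H kn d; apply: le_trans cc' (H kn d).
  + have /orP[kn|kn] : (k + l <= N)%N || (N < k + l)%N by case: leqP.
      have [d|d] := boolP (D k l); last by exists (mu + 1); [rewrite ltrDl | move=> ? d'; case/negP: d].
      exists (smin (Bsub A kn - lam%:M)); first exact: h.
      by move=> kn' _; rewrite (bool_irrelevance kn' kn).
    by exists (mu + 1); [rewrite ltrDl | move=> kn'; have := leq_trans kn kn'; rewrite ltnn].
  by exists c => // k kn; apply: H; rewrite ltnS; apply: leq_trans kn; rewrite leq_addr.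
exists c => // k l kn; apply: (H l _ k kn); rewrite ltnS; apply: leq_trans kn; rewrite leq_addl //.
Qed.

(** Replacing A by its tridiagonal part costs the norm of the remainder. *)
Lemma residual_witness (eps eps' : R) : (0 < M)%N -> pseudospec eps A lam -> eps < eps' ->
  exists2 x : 'cV[R[i]]_M, x != 0 & vnorm2 (T *m x) <= (eps' + opnorm2 (offtridiag A)) * vnorm2 x.
Proof.
move=> M0 h lt; have [x x0 hx] := smin_lt_witness M0 (le_lt_trans h lt).
exists x => //.
have -> : T *m x = (A - lam%:M) *m x + (- offtridiag A) *m x.
  by rewrite -mulmxDl; congr (_ *m x); rewrite /offtridiag opprB [RHS]addrC addrA subrK.
apply: le_trans (vnorm2D _ _) _; rewrite mulrDl; apply: lerD => //.
by rewrite mulNmx vnorm2N; exact: opnorm2_le.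
Qed.

(** The windows overhanging an end are exactly the shorter truncations. *)
Lemma truncations_core (n : nat) (r a b t c e : R) (x : 'cV[R[i]]_M) :
  (0 < n < N)%N -> 0 < r -> 0 <= a -> 0 <= b -> a + b = 1 -> rL A <= a * r -> rU A <= b * r ->
  0 < t < pi -> 2 * sin (t / 2) * cos ((n%:R + 2^-1) * t) + a * b * sin ((n%:R - 1) * t) = 0 ->
  0 < e -> x != 0 -> vnorm2 (T *m x) <= e * vnorm2 x -> 0 < c ->
  (forall k l (kn : (k + l <= N)%N), truncation n k l -> c <= smin (Bsub A kn - lam%:M)) ->
  c <= e + 2 * r * sin (t / 2).
Proof.
move=> /andP[n0 nN] r0 a0 b0 ab hL hU ht eqn e0 x0 hx c0 hc.
have res : rdot predT (T *m x) (T *m x) <= (e / r * r) ^+ 2 * rdot predT x x.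
  rewrite divfK ?gt_eqF // -!vnorm2_sqr -exprMn ler_pXn2r ?nnegrE ?vnorm2_ge0 //.
  by rewrite mulr_ge0 ?vnorm2_ge0 // ltW.
have U0 : 0 < mass N (mag x).
  by rewrite mass_mag -vnorm2_sqr exprn_gt0 // vnorm2_gt0.
have win s v k l (kn : (k + l <= N)%N) : truncation n k l -> (forall j, (1 <= j <= N)%N -> ((k < j) && (j <= k + l))%N = inwin n s j) ->
    (forall j, ~~ inwin n s j -> v j = 0) ->
    (c / r) ^+ 2 * (\sum_(1 <= j < N.+1) v j ^+ 2 * mag x j ^+ 2) <= \sum_(1 <= j < N.+1 | inwin n s j) energy A lam x r v j.
  move=> D jE hv; apply: le_trans (window_energy x r0 c0 (hc k l kn D) _) _.
    by move=> j hj; rewrite jE //; apply: hv.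
  apply: le_of_eq; rewrite big_mkcond [RHS]big_mkcond.
  by apply: eq_big_nat => j hj; rewrite jE.
have main := @sigma_windows R n N a b (e / r) (c / r) t (mag x) (rsd A lam x r) (energy A lam x r).
have : c / r <= e / r + 2 * sin (t / 2).
  apply: main => //.
  - by rewrite divr_gt0.
  - exact: mag0.
  - exact: magN.
  - by move=> v j hj; exact: energy_le.
  - exact: res_sum.
  - by rewrite divr_ge0 ?ltW.
  move=> s v hs hv; have [sn|sn] := ltnP s n.
    have kn : (0 + s <= N)%N by move: sn nN; clear; lia.
    apply: (win s v 0%N s kn) => //; first by rewrite /truncation; move: hs sn; clear; lia.
    by move=> j; rewrite /inwin; move: sn; clear; lia.
  have [sN|sN] := leqP s N.
    have kn : (s - n + n <= N)%N by rewrite subnK.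
    apply: (win s v (s - n)%N n kn) => //; first by rewrite /truncation eqxx.
    by move=> j; rewrite /inwin; move: sn; clear; lia.
  have kn : (N - (N + n - s) + (N + n - s) <= N)%N by rewrite subnK //; move: sN nN; clear; lia.
  apply: (win s v (N - (N + n - s))%N (N + n - s)%N kn) => //.
    by rewrite /truncation; move: hs sN; clear; lia.
  by move=> j; rewrite /inwin; move: hs sn sN nN; clear; lia.
rewrite ler_pdivrMr // mulrDl divfK ?gt_eqF //.
by rewrite -[2 * r * _]mulrA [r * _]mulrC mulrA.
Qed.

Lemma principal_core (n : nat) (r a b t c e : R) (x : 'cV[R[i]]_M) :
  (2 < n < N)%N -> 0 < r -> 0 <= a -> 0 <= b -> a + b = 1 -> rL A <= a * r -> rU A <= b * r ->
  pi / (2 * (n - 2)%:R + 1) <= t -> t <= pi / ((n - 2)%:R + 2) ->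
  2 * sin (t / 2) * cos (((n - 2)%:R + 2^-1) * t) + a * b * sin (((n - 2)%:R - 1) * t) = 0 ->
  0 < e -> x != 0 -> vnorm2 (T *m x) <= e * vnorm2 x -> 0 < c ->
  (forall k (kn : (k + n <= N)%N), c <= smin (Bsub A kn - lam%:M)) ->
  c <= e + 2 * r * sin (t / 2).
Proof.
move=> /andP[n2 nN] r0 a0 b0 ab hL hU t1 t2 eqn e0 x0 hx c0 hc.
have res : rdot predT (T *m x) (T *m x) <= (e / r * r) ^+ 2 * rdot predT x x.
  rewrite divfK ?gt_eqF // -!vnorm2_sqr -exprMn ler_pXn2r ?nnegrE ?vnorm2_ge0 //.
  by rewrite mulr_ge0 ?vnorm2_ge0 // ltW.
have U0 : 0 < mass N (mag x).
  by rewrite mass_mag -vnorm2_sqr exprn_gt0 // vnorm2_gt0.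
have ch : chain N n a b (e / r) (c / r) (mag x) (rsd A lam x r) (cpl A lam x r) (cpu A lam x r) (energy A lam x r).
  by apply: build_chain => //; exact: ltnW.
have : c / r <= e / r + 2 * sin (t / 2).
  apply: (hat_windows ch) => //; first exact: ltnW.
    by rewrite divr_gt0.
  by rewrite divr_ge0 ?ltW.
rewrite ler_pdivrMr // mulrDl divfK ?gt_eqF //.
by rewrite -[2 * r * _]mulrA [r * _]mulrC mulrA.
Qed.

(** If r_L + r_U > 0, take r = r_L + r_U and the angle of the theorem. Otherwise there is no coupling
    and no angle; an arbitrarily small r then serves as unit, and the bound is reached up to d. *)
Lemma splitting_exists (n : nat) (d : R) : (0 < n)%N -> 0 < d ->
  exists r a b t, [/\ 0 < r, [/\ 0 <= a, 0 <= b, a + b = 1, rL A <= a * r & rU A <= b * r],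
    [/\ pi / (2 * n%:R + 1) <= t, t <= pi / (n%:R + 2) &
    2 * sin (t / 2) * cos ((n%:R + 2^-1) * t) + a * b * sin ((n%:R - 1) * t) = 0] &
    2 * r * sin (t / 2) + opnorm2 (offtridiag A) <= eps_ A n + d].
Proof.
move=> n0 d0; have l0 := rL_ge0 A; have u0 := rU_ge0 A.
have [r0|r0] := eqVneq (rLU A) 0.
  have [t [t1 t2 eqn]] := @theta_exists R n (1/2 * (1/2)) n0 ltac:(lra) ltac:(lra).
  exists (d / 2), (1/2), (1/2), t; split; first lra.
  - by rewrite /rLU in r0; split; lra.
  - by [].
  rewrite /eps_ r0 eqxx addrC lerD2l.
  have := sin_le1 (t / 2); set s := sin _ => s1.
  have -> : 2 * (d / 2) * s = d * s by field.
  by rewrite -[leRHS]mulr1; apply: ler_wpM2l => //; exact: ltW.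
have rp : 0 < rLU A by rewrite lt_neqAle eq_sym r0 addr_ge0.
pose a := rL A / rLU A; pose b := rU A / rLU A.
have a0 : 0 <= a by rewrite divr_ge0 // ltW.
have b0 : 0 <= b by rewrite divr_ge0 // ltW.
have ab : a + b = 1 by rewrite /a /b -mulrDl divff.
have abE : rL A * rU A / rLU A ^+ 2 = a * b by rewrite /a /b; field.
have ab4 : a * b <= 1/4.
  by have -> : a = 1 - b; [lra | have := sqr_ge0 (b - 1/2); lra].
have [t1 eqn] : [set t | pi / (2 * n%:R + 1) <= t <= pi / (n%:R + 2) /\ theta_eqn A n t] (theta A n).
  have [t [h1 h2 h3]] := theta_exists n0 (mulr_ge0 a0 b0) ab4.
  have := @xgetPex _ 0 [set t | pi / (2 * n%:R + 1) <= t <= pi / (n%:R + 2) /\ theta_eqn A n t].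
  by apply; exists t; split; [rewrite h1 h2 | rewrite /theta_eqn abE].
exists (rLU A), a, b, (theta A n); split => //.
- by split; rewrite // /a /b divfK.
- by case/andP: t1; split => //; rewrite -abE.
by rewrite /eps_ (negbTE r0) lerDl ltW.
Qed.

(** If lambda belonged to no set of the union, all smallest singular values would exceed the
    threshold by a common margin 4 d. An approximate singular vector of A - lambda then contradicts
    [truncations_core]. *)
Lemma pseudospec_truncations (eps : R) n : (0 < M)%N -> 0 <= eps -> (0 < n < N)%N ->
  pseudospec eps A lam -> sigma A n eps lam.
Proof.
move=> M0 eps0 hn hlam; apply: contrapT => hs.
have n0 : (0 < n)%N by case/andP: hn.
set mu := eps + eps_ A n.
have [|c cmu hc] := @truncation_gap mu (truncation n).
  move=> k l kn; rewrite ltNge => D; apply/negP => le; apply: hs.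
  case/orP: D => [/eqP ln|/andP[hl /orP[/eqP k0|/eqP kN]]]; subst.
  - by left; exists k, kn.
  - by right; exists l; split; [move: hl; clear; lia | left; exists kn].
  - by right; exists l; split; [move: hl; clear; lia | right; exists kn].
pose d := (c - mu) / 4; have d0 : 0 < d by rewrite divr_gt0 // subr_gt0.
have [r [a [b [t [r0 [a0 b0 ab hL hU] [t1 t2 eqn] ht]]]]] := splitting_exists n0 d0.
have [|x x0 hx] := @residual_witness eps (eps + d) M0 hlam; first by rewrite ltrDl.
have t0 : 0 < t.
  by apply: lt_le_trans t1; rewrite divr_gt0 ?pi_gt0 // ltr_wpDl // mulr_ge0.
have tpi : t < pi.
  apply: le_lt_trans t2 _; rewrite ltr_pdivrMr ?ltr_wpDl // ltr_pMr ?pi_gt0 //.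
  by rewrite ltr_wpDl // ltrDl.
have C0 := opnorm2_ge0 (offtridiag A).
have e0 : 0 < eps + d + opnorm2 (offtridiag A) by rewrite ltr_wpDr // ltr_wpDl.
have s0 : 0 <= 2 * r * sin (t / 2).
  rewrite !mulr_ge0 ?(ltW r0) // ltW // sin_gt0_pi //; apply/andP; split; lra.
have : c <= eps + d + opnorm2 (offtridiag A) + 2 * r * sin (t / 2).
  have [c0|c0] := lerP c 0; first by apply: le_trans c0 _; rewrite addr_ge0 // ltW.
  apply: (truncations_core hn r0 a0 b0 ab hL hU _ eqn e0 x0 hx c0 hc).
  by rewrite t0.
by move: ht cmu; rewrite /d /mu; lra.
Qed.

Lemma pseudospec_principal (eps : R) n : (0 < M)%N -> 0 <= eps -> (2 < n < N)%N ->
  pseudospec eps A lam -> sigma_hat A n eps lam.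
Proof.
move=> M0 eps0 hn hlam; apply: contrapT => hs.
have n0 : (0 < n - 2)%N by rewrite subn_gt0; case/andP: hn.
set mu := eps + eps_ A (n - 2).
have [|c cmu hc] := @truncation_gap mu (fun _ l => l == n).
  move=> k l kn; rewrite ltNge => /eqP D; apply/negP => le; apply: hs; subst.
  by exists k, kn.
pose d := (c - mu) / 4; have d0 : 0 < d by rewrite divr_gt0 // subr_gt0.
have [r [a [b [t [r0 [a0 b0 ab hL hU] [t1 t2 eqn] ht]]]]] := splitting_exists n0 d0.
have [|x x0 hx] := @residual_witness eps (eps + d) M0 hlam; first by rewrite ltrDl.
have t0 : 0 < t.
  by apply: lt_le_trans t1; rewrite divr_gt0 ?pi_gt0 // ltr_wpDl // mulr_ge0.
have tpi : t < pi.
  apply: le_lt_trans t2 _; rewrite ltr_pdivrMr ?ltr_wpDl // ltr_pMr ?pi_gt0 //.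
  by rewrite ltr_wpDl // ltrDl.
have C0 := opnorm2_ge0 (offtridiag A).
have e0 : 0 < eps + d + opnorm2 (offtridiag A) by rewrite ltr_wpDr // ltr_wpDl.
have s0 : 0 <= 2 * r * sin (t / 2).
  rewrite !mulr_ge0 ?(ltW r0) // ltW // sin_gt0_pi //; apply/andP; split; lra.
have : c <= eps + d + opnorm2 (offtridiag A) + 2 * r * sin (t / 2).
  have [c0|c0] := lerP c 0; first by apply: le_trans c0 _; rewrite addr_ge0 // ltW.
  apply: (principal_core hn r0 a0 b0 ab hL hU t1 t2 eqn e0 x0 hx c0 _) => k kn.
  exact: hc.
by move: ht cmu; rewrite /d /mu; lra.
Qed.

Lemma pseudospec_Sigma (eps : R) n : (0 < M)%N -> 0 <= eps -> (0 < n < N)%N ->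
  pseudospec eps A lam -> Sigma A n eps lam.
Proof.
move=> M0 eps0 hn h; rewrite /Sigma; case: leqP => n2.
  exact: pseudospec_truncations.
split; first exact: pseudospec_truncations.
by apply: pseudospec_principal => //; rewrite n2; case/andP: hn.
Qed.
End Inclusion.

Lemma spec_pseudospec (R : realType) n (E : 'M[R[i]]_n) : spec E `<=` pseudospec 0 E.
Proof.
move=> lam /eigenvalueP[v vE v0]; rewrite /pseudospec /= leNgt; apply/negP => s0.
have : E - lam%:M \in unitmx by apply: (bounded_below_unit s0) => z; exact: smin_le.
move/mulmxV => h; move/eqP: v0; apply.
by rewrite -[v]mulmx1 -h mulmxA mulmxBr vE mul_mx_scalar subrr mul0mx.
Qed.

Theorem theorem1p1 (R : realType) (M N : nat) (m : 'I_N -> nat)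
    (hM : (\sum_(i < N) m i)%N = M)
    (hm : forall i : 'I_N, (1 <= m i <= M - 1)%N)
    (hN : (1 < N <= M)%N)
    (A : 'M[R[i]]_(\sum_(i < N) m i)) :
  (forall (eps : R) (n : nat), 0 <= eps -> (1 <= n <= N - 1)%N ->
     pseudospec eps A `<=` Sigma A n eps)
  /\ (forall n : nat, (1 <= n <= N - 1)%N -> spec A `<=` Sigma A n 0).
Proof.
have M0 : (0 < \sum_(i < N) m i)%N by rewrite hM; move: hN; clear; lia.
have hn n : (1 <= n <= N - 1)%N -> (0 < n < N)%N by clear; lia.
split=> [eps n eps0 /hn nN lam|n /hn nN lam /spec_pseudospec]; exact: pseudospec_Sigma.
Qed.
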